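(* Let $\{\ell_n\}_{n\ge1}$ be a decreasing sequence of positive numbers tending to $0$ such that there are constants $0<M_0\le M_1<\infty$ with $M_0/n\le \ell_n\le M_1/n$ for every $n$. Let $\alpha>0$ and consider the Poisson circle covering model with parameter $\alpha$ and lengths $\{\ell_n\}$, with associated random sets $F_t\subseteq C$. Let $\beta_0=\inf\{\beta:\sum_{n=1}^\infty e^{\ell_1+\cdots+\ell_n}/n^{1+\beta}<\infty\}$. Fix $x\in C$. (i) $P(\exists t\in[0,1]:x\in F_t)=1$ if and only if $$\sum_{n=1}^\infty\frac{e^{\ell_1+\ell_2+\cdots+\ell_n}}{n^{1+\alpha}}<\infty.$$ In particular, if $\ell_n=c/n$ for all $n$ (with $c>0$), then this holds if and only if $c<\alpha$. (ii) Almost surely, $$\mathrm{HD}(\{t\in[0,1]:x\in F_t\})=\max\left\{1-\frac{\beta_0}{\alpha},\,0\right\}.$$ In particular, if $\ell_n=c/n$ for all $n$ with $0<c\le\alpha$, then $\mathrm{HD}(\{t\in[0,1]:x\in F_t\})=1-\frac c\alpha$ almost surely.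
   Context: $C$ is the circle of circumference $1$, with arclength metric. Poisson model with parameter $\alpha\ge0$: let $\{C_{i,j}\}_{i,j\ge1}$ and $\{Y_{i,j}\}_{i,j\ge1}$ be mutually independent random variables, with $C_{i,j}$ uniformly distributed on $C$ and $Y_{i,j}$ exponentially distributed with rate parameter $\ell_i^{-\alpha}$. Let $T_{i,0}:=0$ and $T_{i,j}:=\sum_{k=1}^jY_{i,k}$ for $j\ge1$, and let $U_{i,t}:=C_{i,j}$ for $t\in[T_{i,j-1},T_{i,j})$; that is, the center of the $i$th arc is resampled uniformly at the times of a rate $\ell_i^{-\alpha}$ Poisson process. For each $n$ and $t\ge 0$, $I_{n,t}$ is the open arc of $C$ with center $U_{n,t}$ and length $\ell_n$ (an arc of length greater than $1$ is all of $C$). Put $E_t:=\limsup_n I_{n,t}$ (the set of points belonging to $I_{n,t}$ for infinitely many $n$) and $F_t:=C\setminus E_t$. $\mathrm{HD}$ denotes Hausdorff dimension, with $\mathrm{HD}(\varnothing)=0$. *)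

(* Defs.v *)
From HB Require Import structures.
From mathcomp Require Import all_boot all_order all_algebra finmap.
From mathcomp Require Import all_classical all_reals all_analysis.

Set Implicit Arguments.
Unset Strict Implicit.
Unset Printing Implicit Defensive.

Import Order.TTheory GRing.Theory Num.Theory.
Import numFieldNormedType.Exports.

Local Open Scope classical_set_scope.
Local Open Scope ring_scope.

(* Sequences that are indexed by the integers >= 1 in the source are indexed by
   [nat] here, index [n] standing for [n + 1]: [l n] is the length
   $\ell_{n+1}$, and [C i j], [Y i j] are $C_{i+1,j+1}$, $Y_{i+1,j+1}$. *)

Section Hausdorff.
Context {R : realType}.
Local Open Scope ereal_scope.
Implicit Types (A : set R) (s delta : R).

(* [diam set0 = -oo] *)
Definition diam A : \bar R :=
  ereal_sup [set (`|p.1 - p.2|%R)%:E | p in A `*` A].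

(* $|A|^s$, with the convention $|\emptyset|^s = 0$ even for $s = 0$; for
   nonempty sets $0^0 = 1$, so that the 0-dimensional measure counts points *)
Definition diam_pow s A : \bar R :=
  if `[< A = set0 >] then 0 else poweR (diam A) s.

Definition hausdorff_premeasure s delta A : \bar R :=
  ereal_inf [set \sum_(0 <= k <oo) diam_pow s (V k) | V in
    [set V : nat -> set R |
      A `<=` \bigcup_k V k /\ forall k, diam (V k) <= delta%:E]].

Definition hausdorff_measure s A : \bar R :=
  ereal_sup [set hausdorff_premeasure s delta A | delta in
    [set delta : R | (0 < delta)%R]].

(* [hausdorff_dim set0 = 0], since only [s >= 0] is considered *)
Definition hausdorff_dim A : \bar R :=
  ereal_inf [set s%:E | s in
    [set s : R | (0 <= s)%R /\ hausdorff_measure s A = 0]].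

End Hausdorff.

Section Circle.
Context {R : realType}.

(* The circle of circumference 1 is R/Z, with set of representatives [0, 1[. *)
Definition circle : set R := `[0, 1[.

(* The arclength metric of R/Z; it is 1-periodic in both arguments, so its
   arguments may be arbitrary real representatives. *)
Definition circle_dist (x y : R) : R :=
  let z := x - y - (Num.floor (x - y))%:~R in Num.min z (1 - z).

(* The distance is at most 1/2, so this is the whole circle if [len > 1]. *)
Definition open_arc (center len : R) : set R :=
  [set y | circle y /\ circle_dist y center < len / 2].

End Circle.

Section Independence.
Context d (T : measurableType d) (R : realType) (P : probability T R).

Definition mutually_independent (I : choiceType) (X : I -> {RV P >-> R}) :=
  forall (J : {fset I}) (B : I -> set R), (forall i, measurable (B i)) ->
    P (\bigcap_(i in [set` J]) (X i @^-1` B i)) =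
    (\prod_(i <- J) P (X i @^-1` B i))%E.

End Independence.

Section PoissonCovering.
Context d (T : measurableType d) (R : realType) (P : probability T R).
Variables (alpha : R) (l : nat -> R) (C Y : nat -> nat -> {RV P >-> R}).

(* The laws are compared on Borel sets only: [P] and the integral have no
   meaning on nonmeasurable sets. *)
Record poisson_model : Prop := PoissonModel {
  center_uniform : forall i j (A : set R), measurable A ->
    distribution P (C i j) A = uniform_prob (@ltr01 R) A ;
  holding_exponential : forall i j (A : set R), measurable A ->
    distribution P (Y i j) A = exponential_prob (l i `^ (- alpha)) A ;
  model_independent : mutually_independent
    (fun k : (nat * nat) + (nat * nat) =>
       match k with inl p => C p.1 p.2 | inr p => Y p.1 p.2 end)
}.

Definition jump_time (i j : nat) (w : T) : R := \sum_(k < j) Y i k w.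

(* Almost surely, for all [i] and [t >= 0] exactly one [j] satisfies the
   condition; [get] returns it. *)
Definition arc_center (i : nat) (t : R) (w : T) : R :=
  C i (get [set j : nat | jump_time i j w <= t < jump_time i j.+1 w]) w.

Definition arc (n : nat) (t : R) (w : T) : set R :=
  open_arc (arc_center n t w) (l n).

Definition covered (t : R) (w : T) : set R :=
  lim_sup_set (fun n => arc n t w).

Definition uncovered (t : R) (w : T) : set R := circle `\` covered t w.

Definition exceptional_times (x : R) (w : T) : set R :=
  [set t | 0 <= t <= 1 /\ uncovered t w x].

End PoissonCovering.

Section CoveringSeries.
Context {R : realType}.

Definition covering_series (l : nat -> R) (b : R) : \bar R :=
  (\sum_(0 <= n <oo)
     (expR (\sum_(k < n.+1) l k) / n.+1%:R `^ (1 + b))%:E)%E.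

(* The infimum is taken in [R]: when $M_0/n \le \ell_n \le M_1/n$ the set is
   nonempty and bounded below, by $M_0$. *)
Definition beta0 (l : nat -> R) : R :=
  inf [set b : R | (covering_series l b < +oo)%E].

End CoveringSeries.

(* Main.v *)
Require Import Defs.
From HB Require Import structures.
From mathcomp Require Import all_boot all_order all_algebra finmap.
From mathcomp Require Import all_classical all_reals all_analysis.
From mathcomp Require Import measurable_realfun ring lra zify.

Set Implicit Arguments.
Unset Strict Implicit.
Unset Printing Implicit Defensive.

Import Order.TTheory GRing.Theory Num.Theory.
Import numFieldNormedType.Exports.

Local Open Scope classical_set_scope.
Local Open Scope ring_scope.

(* For fixed [x], the indicators of "[x] lies outside the [n]-th arc at time [t]"
   are independent two-state Markov chains in [t], which jump at rate
   [r_n = l_n^(-alpha)].  The probability that [x] is uncovered by the arcs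
   [m <= n < N] at both of the times [s] and [s + u] is [p^2 * ker u], where [p] is
   the one-time probability and
     [ker u = prod_n (1 + l_n / (1 - l_n) * exp (- r_n * u))],
   which is comparable with [exp (l_1 + ... + l_n)] for [u] of order [n^(-alpha)].
   By a layer-cake summation, [int_0^1 u^(-s) ker u du] and the series
   [sum_n exp (l_1 + ... + l_n) / n^(1 + alpha * (1 - s))] converge together.

   Upper bounds: by the Markov property at the first uncovered time, the
   probability that an interval of length [e] contains an uncovered time is at
   most [2 * e / int_0^e ker].  For [e = 1] this tends to [0] when the series
   diverges, and for [e] of order [n^(-alpha)] it is of order
   [exp (- (l_1 + ... + l_n))], which bounds the cost of covering the
   exceptional times.

   Lower bounds: the normalized counting measure of the uncovered points of a
   fine grid has variance close to [0] when [m] is large, and bounded expected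
   [s]-energy; by Cauchy-Schwarz the cost of any finite cover of the times that are
   uncovered at level [N] is bounded below, uniformly in [N].  Limits of such
   times as [N] grows are exceptional: almost surely no two chains jump
   simultaneously, so at the limit time all chains but one are locally constant,
   and one arc does not matter for the limsup.  By compactness the lower bound
   passes to open covers of the set of exceptional times. *)

(** * Independence and the memoryless property *)

(** Randomness is handled through finitely many arcs [m <= n < N] and finitely many grid times, so
    that expectations are finite sums of probabilities. Real times are reached afterwards, by
    right-continuity of the paths in the upper bounds and by compactness in the lower ones. The
    index [m] has two roles. Dropping the first arcs makes every remaining [l n] less than [1],
    hence [p > 0], and does not change the limsup. Letting [m] grow makes the variance as small as
    desired, so that the second moment method yields probabilities close to [1] and thus an almost
    sure statement. The Markov property is stated without conditional expectations: an event is cut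
    along the number [j] of jumps made by time [s], and on each piece it depends on finitely many
    variables of the arc in question, independent of the later ones. The obstacle in the lower
    bounds is that the uncovered times of a level are closed only from the right: a limit from the
    left may fall on a jump that covers [x]. Existence in (i) is the case [s = 0] of the estimate
    used for the dimension, applied to the empty cover. *)

Section Independence.
Context d (T : measurableType d) (R : realType) (P : probability T R).
Context (I : choiceType) (X : I -> {RV P >-> R}).
Hypothesis indX : mutually_independent X.

Definition cylinders (K : set I) : set (set T) :=
  [set A | exists i B, [/\ K i, measurable B & A = X i @^-1` B]].

Lemma cylinders_measurable K : cylinders K `<=` measurable.
Proof. by move=> _ [i [B [Ki mB ->]]]; rewrite -[_ @^-1` _]setTI; exact: measurable_funPT. Qed.

Lemma sigma_cylinders_measurable K : <<s cylinders K >> `<=` measurable.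
Proof. apply: smallest_sub; [exact: sigma_algebra_measurable|exact: cylinders_measurable]. Qed.

Let boxes (K : set I) : set (set T) :=
  [set A | exists (J : {fset I}) (B : I -> set R),
    [/\ forall i, i \in J -> K i, forall i, measurable (B i) &
        A = \bigcap_(i in [set` J]) (X i @^-1` B i)]].

Let boxes_setI K : setI_closed (boxes K).
Proof.
move=> _ _ [J [B [JK mB ->]]] [J' [B' [JK' mB' ->]]].
exists (J `|` J')%fset.
exists (fun i => (if i \in J then B i else setT) `&` (if i \in J' then B' i else setT)).
split.
- by move=> i; rewrite inE => /orP[/JK|/JK'].
- by move=> i; apply: measurableI; case: ifP.
- apply/seteqP; split => w /=.
    move=> [H H'] i /=; rewrite inE => _; split.
      by case: ifPn => // iJ; exact: H.
    by case: ifPn => // iJ; exact: H'.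
  move=> H; split => i /= iJ.
    by have := H i; rewrite /= inE iJ => /(_ isT)[].
  by have := H i; rewrite /= inE iJ orbT => /(_ isT)[].
Qed.

(** Dynkin's theorem: the events [D] independent of [X i0] form a lambda-system that contains the
    boxes, a pi-system whose sigma-algebra contains all cylinders over [K]. For a box over [J], the
    product formula over [i0] and [J] splits off the factor of [i0], since [i0] is not in [J]. *)
Lemma independent_sigma (K : set I) (i0 : I) (D : set T) (B : set R) :
  ~ K i0 -> <<s cylinders K >> D -> measurable B ->
  P (D `&` X i0 @^-1` B) = (P D * P (X i0 @^-1` B))%E.
Proof.
move=> Ki0 sD mB.
have mF : measurable (X i0 @^-1` B).
  by rewrite -[_ @^-1` _]setTI; exact: measurable_funPT.
set F := X i0 @^-1` B in mF *.
have sub : <<s cylinders K >> `<=` <<s boxes K >>.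
  apply: smallest_sub; first exact: smallest_sigma_algebra.
  move=> _ [i [C [Ki mC ->]]]; apply: sub_sigma_algebra.
  exists [fset i]%fset, (fun=> C); split => //.
    by move=> j; rewrite !inE => /eqP ->.
  apply/seteqP; split => w /=; first by move=> ? j /=; rewrite inE => /eqP ->.
  by move/(_ i); apply; rewrite /= inE.
have bm : boxes K `<=` @measurable _ T.
  move=> _ [J [C [_ mC ->]]]; apply: fin_bigcap_measurable => // i _.
  by rewrite -[_ @^-1` _]setTI; exact: measurable_funPT.
have sbm : <<s boxes K >> `<=` @measurable _ T.
  by apply: smallest_sub => //; exact: sigma_algebra_measurable.
apply: (@dynkin_induction _ (g_sigma_algebraType (boxes K)) (boxes K)
  (fun D => P (D `&` F) = (P D * P F)%E)) => //.
- by rewrite setTI probability_setT mul1e.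
- move=> _ [J [C [JK mC ->]]].
  have i0J : i0 \notin J by apply/negP => /JK.
  have mC' i : measurable (if i == i0 then B else C i) by case: ifP.
  have := indX (i0 |` J)%fset mC'.
  rewrite big_fsetU1//= eqxx muleC.
  rewrite (_ : \bigcap_(i in _) _ = \bigcap_(i in [set` J]) (X i @^-1` C i) `&` F); last first.
    apply/seteqP; split => w /=.
      move=> H; split.
        move=> i /= iJ; have := H i; rewrite /= inE iJ orbT => /(_ isT).
        by case: eqP => // ii0; rewrite -ii0 iJ in i0J.
      by have := H i0; rewrite /= !inE eqxx; apply.
    move=> [H Fw] i /=; rewrite !inE => /orP[/eqP ->|iJ]; first by rewrite eqxx.
    by case: eqP => [->//|_]; exact: H.
  move=> ->; congr (_ * _)%E; rewrite [RHS]indX//; apply: eq_big_seq => i iJ.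
  by case: eqP => // ii0; rewrite -ii0 iJ in i0J.
- move=> S mS H; have mS' : measurable (S : set T) by exact: sbm.
  rewrite [_ `&` F](_ : _ = F `\` (S `&` F)); last first.
    by rewrite setDIr setDv setU0 setIC -setDE.
  rewrite measureD//; last 2 first.
    exact: measurableI.
    by rewrite (le_lt_trans (probability_le1 P mF))// ltry.
  rewrite setIA [F `&` S]setIC -setIA setIid [X in (_ - X)%E = _]H.
  rewrite [P (~` S)]probability_setC// muleBl ?mul1e//; exact: fin_num_measure.
- move=> G mG tG H.
  have mG' n : measurable (G n : set T) by apply: sbm; exact: mG.
  rewrite setI_bigcupl measure_bigcup//=; last 2 first.
    by move=> n _; exact: measurableI.
    by apply: (@sub_trivIset _ _ _ setT) => //; apply: trivIset_setIr.
  rewrite measure_bigcup//= [RHS]muleC.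
  have PF : P F = (fine (P F))%:E by rewrite fineK// fin_num_measure.
  rewrite PF -nneseriesZl//; first by apply: eq_eseriesr => n _; rewrite H muleC -PF.
- exact: sub.
Qed.

End Independence.

Section Sections.
Context d (T : measurableType d) (R : realType) (P : probability T R).
Context (I : choiceType) (X : I -> {RV P >-> R}).
Hypothesis indX : mutually_independent X.
Variables (K : set I) (i0 : I).
Hypothesis Ki0 : ~ K i0.

Local Notation TK := (g_sigma_algebraType (cylinders X K)).

Lemma measurable_cylinders (A : set T) :
  measurable (A : set TK) -> measurable A.
Proof. exact: sigma_cylinders_measurable. Qed.

Lemma measurable_fun_cylinders (f : T -> R) :
  measurable_fun setT (f : TK -> R) -> measurable_fun setT f.
Proof.
by move=> mf _ B mB; rewrite setTI; apply: measurable_cylinders; rewrite -[_ @^-1` _]setTI; exact: mf.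
Qed.

Let id_mfun : measurable_fun setT (idfun : T -> TK).
Proof. by move=> _ B mB; rewrite setTI; exact: measurable_cylinders. Qed.

Let idK : {mfun T >-> TK} := mfun_Sub (mem_set id_mfun : (idfun : T -> TK) \in mfun).

Let pair_mfun : measurable_fun setT (fun w : T => (w : TK, X i0 w)).
Proof. by apply: measurable_fun_pair => //; exact: id_mfun. Qed.

Let pairK : {mfun T >-> (TK * R)%type} :=
  mfun_Sub (mem_set pair_mfun : (fun w : T => (w : TK, X i0 w)) \in mfun).

(** Fubini's theorem in place of conditioning on the variables with index in [K]: with the smaller
    sigma-algebra of [TK] on [T], the law of the pair of [w] and [X i0 w] is a product, by
    uniqueness of product measures. *)
Lemma independent_xsection (E : set (TK * R)) : measurable E ->
  P [set w | E (w, X i0 w)] =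
  (\int[distribution P idK]_w distribution P (X i0) (xsection E w))%E.
Proof.
move=> mE.
have -> : P [set w | E (w, X i0 w)] = distribution P pairK E by [].
have -> : distribution P pairK E = (distribution P idK \x distribution P (X i0))%E E.
  apply/esym; apply: product_measure_unique => // A B mA mB.
  by rewrite /distribution /pushforward/=; exact: (independent_sigma indX Ki0).
by [].
Qed.

Lemma measurable_section_gt (D : set T) (W : T -> R) (u : R) :
  measurable (D : set TK) -> measurable_fun setT (W : TK -> R) ->
  measurable ([set z | D z.1 /\ u < W z.1 + z.2] : set (TK * R)).
Proof.
move=> mD mW.
have m1 : measurable ([set z | D z.1] : set (TK * R)).
  by have := @measurable_fst _ _ TK R measurableT _ mD; rewrite setTI.
have m2 : measurable ([set z | u < W z.1 + z.2] : set (TK * R)).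
  have mf : measurable_fun setT (fun z : TK * R => W z.1 + z.2).
    by apply: measurable_funD => //; apply: measurableT_comp.
  rewrite (_ : [set z | _] = setT `&` (fun z : TK * R => W z.1 + z.2) @^-1` `]u, +oo[%classic).
    exact: mf.
  by rewrite setTI; apply/seteqP; split => z /=; rewrite in_itv/= andbT.
by have := measurableI _ _ m1 m2.
Qed.

(** For [w] in [D] the section is the half-line beyond [t - W w], which is nonnegative because
    [W w <= s <= t]. Its probability [exp (- r * (t - W w))] is [exp (- r * (t - s))] times the one
    for [s], with a factor that does not depend on [w]. *)
Lemma memoryless (r s t : R) (D : set T) (W : T -> R) :
  (forall u, 0 <= u -> distribution P (X i0) `]u, +oo[%classic = (expR (- r * u))%:E) ->
  measurable (D : set TK) -> measurable_fun setT (W : TK -> R) ->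
  (forall w, D w -> W w <= s) -> s <= t ->
  P (D `&` [set w | t < W w + X i0 w]) =
  ((expR (- r * (t - s)))%:E * P (D `&` [set w | (s < W w + X i0 w)%R]))%E.
Proof.
move=> lawX mD mW Ws st.
pose E u : set (TK * R) := [set z | D z.1 /\ u < W z.1 + z.2].
have mE u : measurable (E u) by exact: measurable_section_gt.
have -> u : D `&` [set w | u < W w + X i0 w] = [set w | E u (w, X i0 w)] by [].
have HE u w : s <= u -> distribution P (X i0) (xsection (E u) w) =
    if w \in D then (expR (- r * (u - W w)))%:E else 0%E.
  move=> su; case: ifPn => Dw.
    rewrite -lawX; last by rewrite subr_ge0 (le_trans _ su)// Ws// -in_setE.
    congr (distribution P (X i0) _); apply/seteqP; split => x.
      by rewrite /xsection/= in_setE /E/= in_itv/= andbT => -[_]; rewrite ltrBlDl.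
    by rewrite /xsection/= in_setE /E/= in_itv/= andbT ltrBlDl => ?; split => //; rewrite -in_setE.
  rewrite (_ : xsection _ _ = set0) ?measure0//; apply/seteqP; split => x //.
  by rewrite /xsection/= in_setE /E/= => -[/mem_set]; rewrite (negbTE Dw).
rewrite (independent_xsection (mE t)) (independent_xsection (mE s)) -ge0_integralZl//; last exact: measurable_fun_xsection.
apply: eq_integral => w _ /=; rewrite !HE//; case: ifP => _; last by rewrite mule0.
by rewrite -EFinM -expRD; congr (expR _)%:E; ring.
Qed.

(** The section at [w] is the single point [W w], and the law of [X i0] has no atoms. *)
Lemma no_tie (W : T -> R) :
  (forall x, distribution P (X i0) [set x] = 0%E) ->
  measurable_fun setT (W : TK -> R) -> P [set w | W w = X i0 w] = 0%E.
Proof.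
move=> lawX mW.
pose E : set (TK * R) := [set z | W z.1 = z.2].
have mE : measurable E.
  have mf : measurable_fun setT (fun z : TK * R => W z.1 - z.2).
    by apply: measurable_funB => //; apply: measurableT_comp.
  rewrite (_ : E = setT `&` (fun z : TK * R => W z.1 - z.2) @^-1` [set 0]).
    exact: mf.
  rewrite setTI; apply/seteqP; split => z /=; first by rewrite /E/= => ->; rewrite subrr.
  by move/eqP; rewrite subr_eq0 => /eqP.
have -> : [set w | W w = X i0 w] = [set w | E (w, X i0 w)] by [].
rewrite independent_xsection//; apply: integral0_eq => w _.
rewrite (_ : xsection _ _ = [set W w])//; apply/seteqP; split => x.
  by rewrite /xsection/= in_setE /E/=.
by rewrite /xsection/= in_setE /E/=.
Qed.

End Sections.

Section ExponentialLaw.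
Context d (T : measurableType d) (R : realType) (P : probability T R).
Variables (r : R) (Y : {RV P >-> R}).
Hypothesis lawY : forall A : set R, measurable A ->
  distribution P Y A = exponential_prob r A.

Lemma exponential_set1 x : distribution P Y [set x] = 0%E.
Proof. by rewrite lawY// /exponential_prob integral_set1. Qed.

Lemma exponential_lt0 : distribution P Y `]-oo, 0[%classic = 0%E.
Proof.
rewrite lawY// /exponential_prob integral0_eq// => x /=; rewrite in_itv/= => x0.
by rewrite lt0_exponential_pdf.
Qed.

Lemma exponential_gt u : 0 <= u ->
  distribution P Y `]u, +oo[%classic = (expR (- r * u))%:E.
Proof.
move=> u0.
have H : distribution P Y `[0, u]%classic = (1 - expR (- r * u))%:E.
  move: u0; rewrite le_eqVlt => /predU1P[<-|u0].
    by rewrite mulr0 expR0 subrr set_itv1 exponential_set1.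
  by rewrite lawY// exponential_prob_itv0c.
have -> : `]u, +oo[%classic = ~` (`]-oo, 0[%classic `|` `[0, u]%classic) :> set R.
  apply/seteqP; split => x /=; rewrite !in_itv/= andbT.
    by move=> ux [|/andP[_]]; lra.
  move=> H'; rewrite ltNge; apply/negP => xu; apply: H'.
  by have [x0|x0] := ltP x 0; [left|right; rewrite xu].
rewrite probability_setC; last exact: measurableU.
rewrite measureU//; last first.
  by apply/seteqP; split => x //=; rewrite !in_itv/= => -[? /andP[]]; lra.
rewrite [X in (_ - (X + _))%E](_ : _ = 0%E); last exact: exponential_lt0.
rewrite add0e [X in (_ - X)%E](_ : _ = (1 - expR (- r * u))%:E); last exact: H.
by rewrite -EFinB; congr _%:E; lra.
Qed.

Lemma exponential_gt0 : P [set w | Y w <= 0] = 0%E.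
Proof.
have -> : [set w | Y w <= 0] = ~` (Y @^-1` `]0, +oo[%classic).
  by apply/seteqP; split => w /=; rewrite in_itv/= andbT leNgt => /negP.
rewrite probability_setC; last by rewrite -[_ @^-1` _]setTI; exact: measurable_funPT.
have := exponential_gt (lexx 0); rewrite mulr0 expR0 /distribution /pushforward => ->.
by rewrite subee.
Qed.

End ExponentialLaw.

Section UniformArc.
Context (R : realType).

Lemma measurable_circle_dist (x : R) : measurable_fun setT (circle_dist x).
Proof.
have mfl : measurable_fun setT (fun u : R => (Num.floor u)%:~R : R).
  by apply: nondecreasing_measurable => // u v uv; rewrite ler_int; exact: le_floor.
have mx : measurable_fun setT (fun c : R => x - c) by exact: measurable_funB.
have mz : measurable_fun setT (fun c : R => x - c - (Num.floor (x - c))%:~R).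
  by apply: measurable_funB => //; exact: measurableT_comp mfl mx.
by apply: measurable_minr => //; exact: measurable_funB.
Qed.

(** The last two alternatives are the parts of the arc that wrap around [0]. The floor is [0] for
    [c <= x] and [-1] for [c > x]; the value [c = 1] is included because the uniform law lives on
    the closed interval. *)
Lemma circle_dist_near (x c h : R) : 0 <= x < 1 -> 0 <= c <= 1 -> 0 < h <= 1 / 2 ->
  (circle_dist x c < h) = [|| x - h < c < x + h, c < x - (1 - h) | x + (1 - h) < c].
Proof.
move=> /andP[x0 x1] /andP[c0 c1] /andP[h0 h1].
rewrite /circle_dist; have [cx|xc] := leP c x.
  have -> : Num.floor (x - c) = 0 by apply: floor_def; rewrite mulr0z/=; lra.
  rewrite mulr0z subr0 gt_min.
  by apply/orP/or3P => [[H|H]|[H|H|H]]; [constructor 1|constructor 2|left|right|left]; lra.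
have -> : Num.floor (x - c) = -1 by apply: floor_def; rewrite mulrN1z/=; lra.
rewrite mulrN1z opprK gt_min.
by apply/orP/or3P => [[H|H]|[H|H|H]]; [constructor 3|constructor 1|right|left|left]; lra.
Qed.

Lemma uniform_prob01 (A : set R) : measurable A ->
  uniform_prob (@ltr01 R) A = lebesgue_measure (A `&` `[0, 1]%classic).
Proof.
move=> mA; rewrite /uniform_prob integral_uniform_pdf.
rewrite (eq_integral (fun=> 1%E)); last first.
  by move=> c; rewrite inE /uniform_pdf/= in_itv/= => -[_ ->]; rewrite subr0 invr1.
by rewrite integral_cst ?mul1e//; exact: measurableI.
Qed.

Lemma uniform_near (x h : R) : 0 <= x < 1 -> 0 < h <= 1 / 2 ->
  uniform_prob (@ltr01 R) [set c | circle_dist x c < h] = (2 * h)%:E.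
Proof.
move=> x01 h01; have mA : measurable [set c | circle_dist x c < h].
  have -> : [set c | circle_dist x c < h] = circle_dist x @^-1` `]-oo, h[%classic.
    by apply/seteqP; split => c /=; rewrite in_itv.
  by rewrite -[_ @^-1` _]setTI; exact: measurable_circle_dist.
rewrite uniform_prob01//.
have two (i j : interval R) : (forall c, 0 <= c <= 1 ->
      [|| x - h < c < x + h, c < x - (1 - h) | x + (1 - h) < c] = (c \in i) || (c \in j)) ->
    (forall c, c \in i -> 0 <= c <= 1) -> (forall c, c \in j -> 0 <= c <= 1) ->
    (forall c, c \in i -> c \in j -> False) ->
    lebesgue_measure ([set c | circle_dist x c < h] `&` `[0, 1]%classic) =
    (lebesgue_measure [set` i] + lebesgue_measure [set` j])%E.
  move=> ij i01 j01 dij; rewrite -measureU//; last first.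
    by apply/seteqP; split => c //= [/dij].
  congr (lebesgue_measure _); apply/seteqP; split => c /=.
    rewrite in_itv/= => -[cx c01]; move: cx; rewrite circle_dist_near// ij//.
    by move=> /orP[]; [left|right].
  move=> H; have c01 : 0 <= c <= 1 by case: H => [/i01|/j01].
  split; last by rewrite in_itv.
  by rewrite circle_dist_near// ij//; apply/orP.
move: x01 h01 => /andP[x0 x1] /andP[h0 h1].
have [xh|hx] := ltP x h.
  rewrite (two `[0, x + h[ `]x + (1 - h), 1]).
  - rewrite !lebesgue_measure_itv/= !lte_fin !ifT; [|lra|lra].
    by rewrite -!EFinB -EFinD; congr _%:E; lra.
  - move=> c c01; rewrite !in_itv/=.
    by apply/or3P/orP => [[H|H|H]|[H|H]]; [left|left|right|constructor 1|constructor 3]; lra.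
  - by move=> c; rewrite in_itv/=; lra.
  - by move=> c; rewrite in_itv/=; lra.
  - by move=> c; rewrite !in_itv/=; lra.
have [xh|hx1] := ltP (1 - h) x.
  rewrite (two `]x - h, 1] `[0, x - (1 - h)[).
  - rewrite !lebesgue_measure_itv/= !lte_fin !ifT; [|lra|lra].
    by rewrite -!EFinB -EFinD; congr _%:E; lra.
  - move=> c c01; rewrite !in_itv/=.
    by apply/or3P/orP => [[H|H|H]|[H|H]]; [left|right|left|constructor 1|constructor 2]; lra.
  - by move=> c; rewrite in_itv/=; lra.
  - by move=> c; rewrite in_itv/=; lra.
  - by move=> c; rewrite !in_itv/=; lra.
(* No wrap-around here: the second interval is empty. *)
rewrite (two `]x - h, x + h[ `]0, 0[).
- rewrite !lebesgue_measure_itv/= !lte_fin ltxx adde0 ifT; last lra.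
  by rewrite -!EFinB; congr _%:E; lra.
- move=> c c01; rewrite !in_itv/=.
  by apply/or3P/orP => [[H|H|H]|[H|H]]; [left| | |constructor 1|]; lra.
- by move=> c; rewrite in_itv/=; lra.
- by move=> c; rewrite in_itv/=; lra.
- by move=> c; rewrite !in_itv/=; lra.
Qed.

End UniformArc.

Section Measures.
Context d (T : measurableType d) (R : realType) (P : probability T R).
Local Open Scope ereal_scope.

(** Total probability over the number of jumps: a proportion [c] common to all pieces is the
    proportion for the union. *)
Lemma measure_bigcup_scale (c : R) (F G : (set T)^nat) :
  (forall n, measurable (F n)) -> (forall n, measurable (G n)) ->
  (forall n, F n `<=` G n) -> trivIset setT G ->
  (forall n, P (F n) = c%:E * P (G n)) ->
  P (\bigcup_n F n) = c%:E * P (\bigcup_n G n).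
Proof.
move=> mF mG FG tG H; rewrite !measure_bigcup//; last first.
  apply/trivIsetP => i j _ _ ij; apply/seteqP; split => w //= -[/FG Gi /FG Gj].
  by move/trivIsetP : tG => /(_ i j I I ij)/seteqP[+ _]; apply; split; [exact: Gi|].
by rewrite -nneseriesZl//; apply: eq_eseriesr => n _; exact: H.
Qed.

Lemma probability_setIr (A G : set T) : measurable A -> measurable G -> P (~` G) = 0 ->
  P (A `&` G) = P A.
Proof.
move=> mA mG G0; rewrite [RHS](measureDI P mA mG) addeC -[LHS]adde0; congr (_ + _).
apply/esym/eqP; rewrite -measure_le0 -G0 le_measure ?inE//; [exact: measurableD|exact: measurableC].
Qed.

End Measures.

(** * The Markov chain of one arc *)

Section Model.
Context d (T : measurableType d) (R : realType) (P : probability T R).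
Variables (l : nat -> R) (alpha : R) (C Y : nat -> nat -> {RV P >-> R}) (x : R).
Hypothesis l_gt0 : forall n, 0 < l n.
Hypothesis model : poisson_model alpha l C Y.
Hypothesis x_circle : circle x.

Local Notation X := (fun k : (nat * nat) + (nat * nat) =>
  match k with inl p => C p.1 p.2 | inr p => Y p.1 p.2 end).
Local Notation TK K := (g_sigma_algebraType (cylinders X K)).

Let indX : mutually_independent X := model_independent model.

Definition rate n := l n `^ (- alpha).

Lemma rateE n : rate n = l n `^ (- alpha). Proof. by []. Qed.

Definition jumps n j t : set T :=
  [set w | jump_time Y n j w <= t < jump_time Y n j.+1 w].

Definition far n j : set T := [set w | ~ (circle_dist x (C n j w) < l n / 2)].

(* On [good], this is the event that [x] is not in the [n]-th arc at time [t]
   (see [free_arc]); being free of [get], it is measurable everywhere. *)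
Definition free n t : set T := \bigcup_j (jumps n j t `&` far n j).

(** The second clause makes the jump times of each arc tend to infinity, so that every [t >= 0] lies
    in exactly one holding interval. *)
Definition good : set T := [set w | (forall i j, 0 < Y i j w) /\
  (forall i k0, exists2 k, (k0 <= k)%N & 1 <= Y i k w)].

Lemma jump_timeS n j w : jump_time Y n j.+1 w = jump_time Y n j w + Y n j w.
Proof. by rewrite /jump_time big_ord_recr. Qed.

Lemma jump_time0 n w : jump_time Y n 0 w = 0.
Proof. by rewrite /jump_time big_ord0. Qed.

Lemma sub_cylinders (K K' : set ((nat * nat) + (nat * nat))) (D : set T) :
  K `<=` K' -> measurable (D : set (TK K)) -> measurable (D : set (TK K')).
Proof.
move=> KK' mD.
suff : <<s cylinders X K >> `<=` <<s cylinders X K' >> by exact.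
apply: smallest_sub; first exact: smallest_sigma_algebra.
by move=> _ [i [B [/KK' Ki mB ->]]]; apply: sub_sigma_algebra; exists i, B.
Qed.

Lemma measurable_member (K : set ((nat * nat) + (nat * nat))) k :
  K k -> measurable_fun setT (X k : TK K -> R).
Proof. by move=> Kk _ B mB; rewrite setTI; apply: sub_sigma_algebra; exists k, B. Qed.

Lemma measurable_jump_time (K : set ((nat * nat) + (nat * nat))) n j :
  (forall i, (i < j)%N -> K (inr (n, i))) ->
  measurable_fun setT (jump_time Y n j : TK K -> R).
Proof.
move=> HK; rewrite (_ : jump_time Y n j = fun w => \sum_(k < j) Y n k w)//.
by apply: measurable_sum => k; apply: (@measurable_member K (inr (n, nat_of_ord k))); exact: HK.
Qed.

Lemma measurable_le (K : set ((nat * nat) + (nat * nat))) n j t :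
  (forall i, (i < j)%N -> K (inr (n, i))) ->
  measurable ([set w | jump_time Y n j w <= t] : set (TK K)).
Proof.
move=> HK; rewrite (_ : [set w | _] = setT `&` jump_time Y n j @^-1` `]-oo, t]%classic).
  exact: (measurable_jump_time HK).
by rewrite setTI; apply/seteqP; split => w /=; rewrite in_itv.
Qed.

Lemma measurable_jumps (K : set ((nat * nat) + (nat * nat))) n j t :
  (forall i, (i <= j)%N -> K (inr (n, i))) -> measurable (jumps n j t : set (TK K)).
Proof.
move=> HK; rewrite (_ : jumps n j t =
  [set w | jump_time Y n j w <= t] `&` ~` [set w | jump_time Y n j.+1 w <= t]).
  apply: measurableI; last apply: measurableC; apply: measurable_le => i ij; apply: HK => //.
  exact: ltnW.
by apply/seteqP; split => w; rewrite /jumps/= ltNge; [move=> /andP[-> /negP]|move=> [-> /negP]].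
Qed.

Lemma measurable_far (K : set ((nat * nat) + (nat * nat))) n j :
  K (inl (n, j)) -> measurable (far n j : set (TK K)).
Proof.
move=> HK; rewrite (_ : far n j =
    setT `&` C n j @^-1` (~` (setT `&` circle_dist x @^-1` `]-oo, (l n / 2)[%classic))).
  apply: (measurable_member HK) => //; apply: measurableC.
  exact: measurable_circle_dist.
by rewrite !setTI; apply/seteqP; split => w /=; rewrite in_itv.
Qed.

Lemma measurable_free (K : set ((nat * nat) + (nat * nat))) n t :
  (forall j, K (inl (n, j)) /\ K (inr (n, j))) -> measurable (free n t : set (TK K)).
Proof.
move=> HK; apply: bigcup_measurable => j _; apply: measurableI.
  by apply: measurable_jumps => i _; have [] := HK i.
by apply: measurable_far; have [] := HK j.
Qed.

Lemma measurable_ambient (K : set ((nat * nat) + (nat * nat))) (D : set T) :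
  measurable (D : set (TK K)) -> measurable D.
Proof. exact: measurable_cylinders. Qed.

Lemma ambient_jumps n j t : measurable (jumps n j t).
Proof. by apply: (@measurable_ambient setT); exact: measurable_jumps. Qed.

Lemma ambient_far n j : measurable (far n j).
Proof. by apply: (@measurable_ambient setT); exact: measurable_far. Qed.

Lemma ambient_free n t : measurable (free n t).
Proof. by apply: (@measurable_ambient setT); exact: measurable_free. Qed.

Lemma measurable_good : measurable good.
Proof.
rewrite (_ : good = (\bigcap_i \bigcap_j Y i j @^-1` `]0, +oo[%classic) `&`
  (\bigcap_i \bigcap_k0 \bigcup_(k in [set k | (k0 <= k)%N]) Y i k @^-1` `[1, +oo[%classic)).
  apply: measurableI.
    apply: bigcapT_measurable => i; apply: bigcapT_measurable => j.
    by rewrite -[_ @^-1` _]setTI; exact: measurable_funPT.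
  apply: bigcapT_measurable => i; apply: bigcapT_measurable => k0.
  apply: bigcup_measurable => k _.
  by rewrite -[_ @^-1` _]setTI; exact: measurable_funPT.
apply/seteqP; split => w /= [H1 H2]; split.
- by move=> i _ j _ /=; rewrite in_itv/= andbT.
- by move=> i _ k0 _ /=; have [k ? ?] := H2 i k0; exists k => //=; rewrite in_itv/= andbT.
- by move=> i j; have := H1 i I j I; rewrite /= in_itv/= andbT.
- by move=> i k0; have [k ?] := H2 i I k0 I; rewrite /= in_itv/= andbT; exists k.
Qed.

Lemma law_Y i j (A : set R) : measurable A ->
  distribution P (Y i j) A = exponential_prob (rate i) A.
Proof. exact: (holding_exponential model). Qed.

Lemma rate_gt0 n : 0 < rate n.
Proof. by rewrite powR_gt0. Qed.

Lemma probability_Y_lt1 i k :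
  (P (Y i k @^-1` `]-oo, 1%R[%classic) <= (1 - expR (- rate i))%:E)%E.
Proof.
have -> : (1 - expR (- rate i))%:E = (1 - P (Y i k @^-1` `]1%R, +oo[%classic))%E.
  have := exponential_gt (law_Y i k) ler01; rewrite mulr1 => H.
  by rewrite [X in (_ - X)%E](_ : _ = (expR (- rate i))%:E).
rewrite -probability_setC; last by rewrite -[_ @^-1` _]setTI; exact: measurable_funPT.
rewrite le_measure ?inE//.
- by rewrite -[_ @^-1` _]setTI; exact: measurable_funPT.
- by apply: measurableC; rewrite -[_ @^-1` _]setTI; exact: measurable_funPT.
- by move=> w /=; rewrite !in_itv/= andbT => ? ?; lra.
Qed.

Lemma probability_run_lt1 i k0 n :
  (P (\bigcap_(k in [set k | (k0 <= k < k0 + n)%N]) Y i k @^-1` `]-oo, 1%R[%classic) <=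
   ((1 - expR (- rate i)) ^+ n)%:E)%E.
Proof.
elim: n => [|n IH].
  rewrite expr0 (le_trans (probability_le1 _ _))//; apply: bigcap_measurableType.
  by move=> k _; rewrite -[_ @^-1` _]setTI; exact: measurable_funPT.
set B := \bigcap_(_ in _) _ in IH.
rewrite (_ : \bigcap_(k in _) _ = B `&` Y i (k0 + n)%N @^-1` `]-oo, 1%R[%classic); last first.
  apply/seteqP; split => w /=.
    move=> H; split; last by apply: H; rewrite /= addnS ltnSn leq_addr.
    by move=> k /= /andP[H1 H2]; apply: H; rewrite /= H1 addnS ltnS ltnW.
  move=> [H1 H2] k /=; rewrite addnS ltnS [(k <= _)%N]leq_eqVlt => /andP[H3].
  by move=> /predU1P[-> //|H4]; apply: H1; rewrite /= H3.
pose K : set ((nat * nat) + (nat * nat)) := fun k => exists2 j, (j < k0 + n)%N & k = inr (i, j).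
rewrite (@independent_sigma _ _ _ _ _ X indX K (inr (i, k0 + n)%N))//.
- rewrite exprSr EFinM; apply: lee_pmul => //; exact: probability_Y_lt1.
- by move=> [j jk [jE]]; rewrite jE ltnn in jk.
- have : measurable (B : set (TK K)) by
    apply: bigcap_measurableType => k /andP[_ kn]; rewrite -[_ @^-1` _]setTI;
    apply: (@measurable_member K (inr (i, k))) => //; exists k.
  exact.
Qed.

(** By independence a run of [n] holding times below [1] has probability at most
    [(1 - exp (- rate i)) ^+ n], so an infinite run is a null event. *)
Lemma probability_good : P (~` good) = 0%E.
Proof.
apply/negligibleP; first by apply: measurableC; exact: measurable_good.
have -> : ~` good = (\bigcup_i \bigcup_j [set w | Y i j w <= 0]) `|`
  (\bigcup_i \bigcup_k0 \bigcap_(k in [set k | (k0 <= k)%N]) Y i k @^-1` `]-oo, 1%R[%classic).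
  apply/seteqP; split => w /=.
    move=> /not_andP[/existsNP[i /existsNP[j /negP]]|/existsNP[i /existsNP[k0 H]]].
      by rewrite -leNgt => ?; left; exists i => //; exists j.
    right; exists i => //; exists k0 => // k /= k0k; rewrite in_itv/= ltNge; apply/negP => Yk.
    by apply: H; exists k.
  move=> [[i _ [j _ /= Yij]]|[i _ [k0 _ H]]] [G1 G2].
    by have := G1 i j; rewrite ltNge Yij.
  have [k k0k Yk] := G2 i k0; have := H _ k0k; rewrite /= in_itv/= ltNge => /negP; exact.
apply: negligibleU; apply: negligible_bigcup => i; apply: negligible_bigcup => j.
  apply/negligibleP; last exact: (exponential_gt0 (law_Y i j)).
  rewrite (_ : [set w | _] = Y i j @^-1` `]-oo, 0]%classic).
    by rewrite -[_ @^-1` _]setTI; exact: measurable_funPT.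
  by apply/seteqP; split => w /=; rewrite in_itv.
set F := \bigcap_(_ in _) _.
have mF : measurable F.
  apply: bigcap_measurableType => k _.
  by rewrite -[_ @^-1` _]setTI; exact: measurable_funPT.
apply/negligibleP => //.
have H n : (P F <= ((1 - expR (- rate i)) ^+ n)%:E)%E.
  apply: (le_trans _ (probability_run_lt1 i j n)); rewrite le_measure ?inE//.
    by apply: bigcap_measurableType => k _; rewrite -[_ @^-1` _]setTI; exact: measurable_funPT.
  by move=> w Fw k /= /andP[? _]; exact: Fw.
have Ff : P F \is a fin_num by rewrite fin_num_measure.
suff : fine (P F) <= 0.
  rewrite -lee_fin fineK// => F0; apply/eqP; rewrite eq_le; apply/andP; split; [exact: F0|exact: measure_ge0].
have cv : (fun n => (1 - expR (- rate i)) ^+ n : R) @ \oo --> (0 : R).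
  apply: cvg_expr; rewrite ger0_norm ?subr_ge0.
    by rewrite ltrBlDr ltrDl expR_gt0.
  by rewrite -expR0 ler_expR oppr_le0 ltW// rate_gt0.
rewrite -(cvg_lim (@Rhausdorff R) cv); apply: limr_ge; first by apply: cvgP cv.
by near=> n; rewrite -lee_fin fineK.
Unshelve. all: by end_near. Qed.

Lemma probability_goodI A : measurable A -> P (A `&` good) = P A.
Proof.
by move=> mA; apply: probability_setIr => //; [exact: measurable_good|exact: probability_good].
Qed.

Lemma probability_far n j : l n <= 1 -> P (far n j) = (1 - l n)%:E.
Proof.
move=> l1; have -> : far n j = ~` (C n j @^-1` [set c | circle_dist x c < l n / 2]) by [].
have mA : measurable [set c | circle_dist x c < l n / 2].
  rewrite (_ : [set c | _] = setT `&` circle_dist x @^-1` `]-oo, (l n / 2)[%classic).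
    exact: measurable_circle_dist.
  by rewrite setTI; apply/seteqP; split => c /=; rewrite in_itv.
rewrite probability_setC; last by rewrite -[_ @^-1` _]setTI; exact: measurable_funPT.
have := center_uniform model n j mA; rewrite uniform_near; last 2 first.
- by move: x_circle; rewrite /circle/= in_itv.
- by have := l_gt0 n; move: l1; lra.
rewrite /distribution /pushforward => ->; rewrite -EFinB; congr _%:E; lra.
Qed.

End Model.

Section Markov.
Context d (T : measurableType d) (R : realType) (P : probability T R).
Variables (l : nat -> R) (alpha : R) (C Y : nat -> nat -> {RV P >-> R}) (x : R).
Hypothesis l_gt0 : forall n, 0 < l n.
Hypothesis model : poisson_model alpha l C Y.
Hypothesis x_circle : circle x.

Local Notation X := (fun k : (nat * nat) + (nat * nat) =>
  match k with inl p => C p.1 p.2 | inr p => Y p.1 p.2 end).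
Local Notation TK K := (g_sigma_algebraType (cylinders X K)).
Local Notation rate := (rate l alpha).
Local Notation jumps := (jumps Y).
Local Notation far := (far l C x).
Local Notation free := (free l C Y x).
Local Notation good := (good Y).

Let mgood : measurable good := measurable_good Y.
Let goodI A : measurable A -> P (A `&` good) = P A := @probability_goodI _ _ _ _ _ _ _ _ l_gt0 model A.
Let indX : mutually_independent X := model_independent model.

Lemma jump_time_lt w n i j : good w -> (i < j)%N -> jump_time Y n i w < jump_time Y n j w.
Proof.
move=> [Y0 _]; elim: j => // j IH; rewrite ltnS leq_eqVlt jump_timeS => /predU1P[->|/IH H].
  by rewrite ltrDl.
by rewrite (lt_trans H)// ltrDl.
Qed.

Lemma jump_time_le w n i j : good w -> (i <= j)%N -> jump_time Y n i w <= jump_time Y n j w.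
Proof. by move=> gw; rewrite leq_eqVlt => /predU1P[->//|ij]; apply/ltW/jump_time_lt. Qed.

Lemma jump_time_unbounded w n M : good w -> exists j, M < jump_time Y n j w.
Proof.
move=> gw; have H m : exists j, m%:R <= jump_time Y n j w.
  elim: m => [|m [j IH]]; first by exists 0%N; rewrite jump_time0.
  have [k jk Yk] := gw.2 n j; exists k.+1; rewrite jump_timeS -natr1 lerD//.
  by rewrite (le_trans IH)// jump_time_le.
have [j Hj] := H (Num.truncn M).+1; exists j; apply: (lt_le_trans _ Hj).
by have := Num.Theory.truncnS_gt M.
Qed.

Lemma jumps_total w n t : good w -> 0 <= t -> exists j, jumps n j t w.
Proof.
move=> gw t0; have ex : exists j, t < jump_time Y n j w by exact: jump_time_unbounded.
have [[|j] tj minj] := ex_minnP ex; first by rewrite jump_time0 ltNge t0 in tj.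
exists j; rewrite /jumps/= tj andbT leNgt; apply/negP => /minj.
by rewrite ltnn.
Qed.

Lemma jumps_mono w n i j s t : good w -> s <= t -> jumps n i s w -> jumps n j t w -> (i <= j)%N.
Proof.
move=> gw st /andP[Hi _] /andP[_ Hj]; rewrite leqNgt; apply/negP => ji.
by have := jump_time_le n gw ji; lra.
Qed.

Lemma jumps_inj w n i j t : good w -> jumps n i t w -> jumps n j t w -> i = j.
Proof.
move=> gw Hi Hj; apply/eqP; rewrite eqn_leq.
by rewrite (jumps_mono gw (lexx t) Hi Hj) (jumps_mono gw (lexx t) Hj Hi).
Qed.

(** On [jumps n j s] the center number [j] is already in place while the holding time number [j] is
    still running: hence [<=] for the centers and [<] for the holding times. *)
Definition before n j : set ((nat * nat) + (nat * nat)) := fun k =>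
  match k with inl p => p.1 <> n \/ (p.2 <= j)%N | inr p => p.1 <> n \/ (p.2 < j)%N end.

(* The events that depend only on the [n]-th arc up to time [s], and on the
   other arcs at all times. *)
Definition past n s (D : set T) := measurable D /\ forall j,
  exists2 D' : set T, measurable (D' : set (TK (before n j))) &
    D `&` jumps n j s `&` good = D' `&` jumps n j s `&` good.

Lemma pastC n s D : past n s D -> past n s (~` D).
Proof.
move=> [mD H]; split=> [|j]; first exact: measurableC.
have [D' mD' E] := H j; exists (~` D'); first exact: measurableC.
apply/seteqP; split => w [[nD Jw] gw]; split => //; split => // Dw; apply: nD.
  by have : (D' `&` jumps n j s `&` good) w by []; rewrite -E => -[[]].
by have : (D `&` jumps n j s `&` good) w by []; rewrite E => -[[]].
Qed.

Lemma pastI n s D E : past n s D -> past n s E -> past n s (D `&` E).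
Proof.
move=> [mD HD] [mE HE]; split=> [|j]; first exact: measurableI.
have [D' mD' ED] := HD j; have [E' mE' EE] := HE j.
exists (D' `&` E'); first exact: measurableI.
apply/seteqP; split => w [[[Dw Ew] Jw] gw].
  have [[D'w _] _] : (D' `&` jumps n j s `&` good) w by rewrite -ED.
  by have [[E'w _] _] : (E' `&` jumps n j s `&` good) w by rewrite -EE.
have [[D'w _] _] : (D `&` jumps n j s `&` good) w by rewrite ED.
by have [[E'w _] _] : (E `&` jumps n j s `&` good) w by rewrite EE.
Qed.

Lemma past_setT n s : past n s setT.
Proof. by split=> // j; exists setT. Qed.

Lemma past_bigsetI n s (r : seq nat) (F : nat -> set T) :
  (forall i, i \in r -> past n s (F i)) -> past n s (\big[setI/setT]_(i <- r) F i).
Proof.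
elim: r => [|i r IH] H; first by rewrite big_nil; exact: past_setT.
rewrite big_cons; apply: pastI; first by apply: H; rewrite inE eqxx.
by apply: IH => j jr; apply: H; rewrite inE jr orbT.
Qed.

Lemma past_free_other n n' s t : n' <> n -> past n s (free n' t).
Proof.
move=> nn; split=> [|j]; first exact: ambient_free.
by exists (free n' t) => //; apply: measurable_free => j'; split; left.
Qed.

(** On [jumps n j s] the number [i] of jumps at the earlier time [u] is at most [j]. If [i < j], the
    event [jumps n i u] involves only completed holding times. If [i = j], its upper inequality
    follows from [u <= s], so the running holding time does not enter. *)
Lemma past_free n s u : u <= s -> past n s (free n u).
Proof.
move=> us; split=> [|j]; first exact: ambient_free.
exists ((\bigcup_(i in [set i | (i < j)%N]) (jumps n i u `&` far n i)) `|`
   ([set w | jump_time Y n j w <= u] `&` far n j)).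
  apply: measurableU.
    apply: bigcup_measurable => i /= ij; apply: measurableI.
      by apply: measurable_jumps => i' i'i; right; exact: leq_ltn_trans i'i ij.
    by apply: measurable_far; right; exact: ltnW.
  apply: measurableI; last by apply: measurable_far; right.
  by apply: measurable_le => i ij; right.
apply/seteqP; split => w [[Hw Jw] gw]; split => //; split => //.
  have [i _ [Ji fi]] := Hw; have := jumps_mono gw us Ji Jw.
  rewrite leq_eqVlt => /predU1P[ij|ij]; last by left; exists i.
  by right; rewrite -ij; split => //; have /andP[] := Ji.
case: Hw => [[i _ [Ji fi]]|[Hj fj]]; first by exists i.
exists j => //; split => //; rewrite /jumps/= Hj/=; have /andP[_] := Jw.
by apply: le_lt_trans.
Qed.

Lemma far_independent (n j : nat) (D : set T) : l n <= 1 ->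
  measurable (D : set (TK [set k | k <> inl (n, j)])) ->
  P (D `&` far n j) = ((1 - l n)%:E * P D)%E.
Proof.
move=> l1 mD.
rewrite -(probability_far l_gt0 model x_circle j l1) muleC.
have -> : far n j = C n j @^-1` (~` [set c | circle_dist x c < l n / 2]) by [].
apply: (@independent_sigma _ _ _ _ _ X indX _ (inl (n, j)) _ _ _ mD); first exact.
apply: measurableC; rewrite (_ : [set c | _] = setT `&` circle_dist x @^-1` `]-oo, (l n / 2)[%classic).
  exact: measurable_circle_dist.
by rewrite setTI; apply/seteqP; split => c /=; rewrite in_itv.
Qed.

(** Cut along the number [j] of jumps at [t]: neither the jump times of arc [n] nor [D] involve the
    center [C n j], so each piece is scaled by [1 - l n]. *)
Lemma free_independent n t D : l n <= 1 -> 0 <= t ->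
  measurable (D : set (TK [set k | match k with inl p => p.1 <> n | inr p => p.1 <> n end])) ->
  P (free n t `&` D) = ((1 - l n)%:E * P D)%E.
Proof.
move=> l1 t0 mD; have mD' := measurable_ambient mD.
rewrite -goodI//; last by apply: measurableI => //; exact: ambient_free.
rewrite -[P D]goodI//.
have -> : free n t `&` D `&` good = \bigcup_j (jumps n j t `&` far n j `&` D `&` good).
  by rewrite -!setI_bigcupl.
have -> : D `&` good = \bigcup_j (jumps n j t `&` D `&` good).
  apply/seteqP; split => w; last by move=> [j _ [[]]].
  by move=> [Dw gw]; have [j Jj] := jumps_total n gw t0; exists j.
have mJ := ambient_jumps C Y n; have mf := ambient_far l C Y x n.
apply: measure_bigcup_scale.
- by move=> j; apply: measurableI => //; apply: measurableI => //; apply: measurableI.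
- by move=> j; apply: measurableI => //; apply: measurableI.
- by move=> j w [[[]]].
- apply/trivIsetP => i j _ _ /eqP ij; apply/seteqP; split => w // [[[Ji _] gw] [[Jj _] _]].
  by apply: ij; exact: jumps_inj gw Ji Jj.
move=> j; rewrite !goodI//; last 2 first.
- exact: measurableI.
- by apply: measurableI => //; apply: measurableI.
rewrite setIAC; apply: far_independent => //.
apply: measurableI; first exact: measurable_jumps.
by apply: sub_cylinders mD => -[[a b]|[a b]]//= an [/an].
Qed.

(* The probability of being free at time [s + u], given the past up to time [s]
   and being free at time [s]. *)
Definition stay n u := 1 - l n + l n * expR (- rate n * u).

(** After [j] jumps by time [s], either the running holding time lasts beyond [t], with probability
    [exp (- rate n * (t - s))], and the arc has not moved; or the center at [t] was drawn after [s]
    and misses [x] with probability [1 - l n]. The two cases add up to [stay]. *)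
Lemma free_markov n s t D : l n <= 1 -> 0 <= s -> s <= t -> past n s D ->
  D `<=` free n s -> P (D `&` free n t) = ((stay n (t - s))%:E * P D)%E.
Proof.
move=> l1 s0 st [mD past_D] Dfree.
have mF := ambient_free l C Y x n t.
have mJ := ambient_jumps C Y n; have mf := ambient_far l C Y x n.
have /choice[D' D'P] : forall j, exists D' : set T, measurable (D' : set (TK (before n j))) /\
    D `&` jumps n j s `&` good = D' `&` jumps n j s `&` good.
  by move=> j; have [D' ? ?] := past_D j; exists D'.
(* [E j] leaves out the condition that the holding time [j] is still running at [s], and is
   therefore measurable for [before n j]; [B j] restores it. *)
pose E j := D' j `&` far n j `&` [set w | jump_time Y n j w <= s].
have mE j : measurable (E j : set (TK (before n j))).
  apply: measurableI; last by apply: measurable_le => i ij; right.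
  by apply: measurableI; [exact: (D'P j).1|apply: measurable_far; right].
pose B j := E j `&` [set w | s < jump_time Y n j.+1 w].
have BE j : B j = D' j `&` far n j `&` jumps n j s.
  apply/seteqP; split => w; rewrite /B /E /jumps/=.
    by move=> [[[? ?] H1] H2]; rewrite H1 H2.
  by move=> [[? ?] /andP[]].
have mB j : measurable (B j).
  rewrite BE; apply: measurableI => //; apply: measurableI => //.
  exact: (measurable_ambient (D'P j).1).
have DB : D `&` good = \bigcup_j (B j `&` good).
  apply/seteqP; split => w.
    move=> [Dw gw]; have [j _ [Jj fj]] := Dfree _ Dw.
    exists j => //; split => //; rewrite BE; split => //; split => //.
    by have : (D `&` jumps n j s `&` good) w by []; rewrite (D'P j).2 => -[[]].
  move=> [j _ [+ gw]]; rewrite BE => -[[D'w fw] Jw]; split => //.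
  by have : (D' j `&` jumps n j s `&` good) w by []; rewrite -(D'P j).2 => -[[]].
rewrite -goodI; last exact: measurableI.
rewrite -[P D]goodI// setIAC DB setI_bigcupl.
apply: measure_bigcup_scale.
- by move=> j; apply: measurableI => //; exact: measurableI.
- by move=> j; exact: measurableI.
- by move=> j w [].
- apply/trivIsetP => i j _ _ /eqP ij; apply/seteqP; split => w //.
  rewrite !BE => -[[[_ Ji] gw] [[_ Jj] _]].
  by apply: ij; exact: jumps_inj gw Ji Jj.
move=> j; rewrite -setIA [good `&` _]setIC setIA !goodI//; last exact: measurableI.
set S := [set w | jump_time Y n j.+1 w <= t].
have mS : measurable S by apply: (@measurable_ambient _ _ _ _ C Y setT); exact: measurable_le.
have SC : ~` S = [set w | t < jump_time Y n j.+1 w].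
  by apply/seteqP; split => w; rewrite /S/= ltNge => /negP.
have PBS : P (B j `\` S) = ((expR (- rate n * (t - s)))%:E * P (B j))%E.
  have -> : B j `\` S = E j `&` [set w | t < jump_time Y n j w + Y n j w].
    rewrite setDE SC /B; apply/seteqP; split => w /=; rewrite -!jump_timeS; first by move=> [[]].
    by move=> [? ?]; split => //; split => //; exact: le_lt_trans st _.
  rewrite (@memoryless _ _ _ _ _ X indX (before n j) (inr (n, j)) _ (rate n) s) //.
  - congr (_ * P _)%E; rewrite /B; congr (_ `&` _).
    by apply/seteqP; split => w /=; rewrite -jump_timeS.
  - by move=> /= -[//|]; rewrite ltnn.
  - by move=> u u0; exact: (exponential_gt (law_Y model n j)).
  - by apply: measurable_jump_time => i ij; right.
  - by move=> w [].
have PBj : P (B j) \is a fin_num by rewrite fin_num_measure.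
have PBS' : P (B j `&` S) = ((1 - expR (- rate n * (t - s)))%:E * P (B j))%E.
  have : P (B j) = (P (B j `\` S) + P (B j `&` S))%E := measureDI P (mB j) mS.
  have fS : P (B j `&` S) \is a fin_num by rewrite fin_num_measure//; exact: measurableI.
  rewrite PBS -(fineK fS) -(fineK PBj) -!EFinM -EFinD => -[H]; congr _%:E.
  by rewrite mulrBl mul1r; move: H; set u := _ * _; lra.
have -> : P (B j `&` free n t) = (P (B j `\` S) + P (B j `&` S `&` free n t))%E.
  rewrite -[LHS]goodI; last exact: measurableI.
  rewrite -[P (B j `\` S)]goodI; last exact: measurableD.
  rewrite -[P (B j `&` S `&` _)]goodI; last by do 2!apply: measurableI => //.
  rewrite -measureU; last 3 first.
  - by apply: measurableI => //; exact: measurableD.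
  - by do 3!apply: measurableI => //.
  - by apply/seteqP; split => w // [[[_ nS] _] [[[_ Sw] _] _]].
  congr (P _); apply/seteqP; split => w.
    move=> [[Bw Fw] gw]; have [Sw|nSw] := pselect (S w); [by right|by left].
  move=> [[[Bw nSw] gw]|[[[Bw Sw] Fw] gw]]; split => //; split => //.
  move: (Bw); rewrite BE => -[[_ fw] /andP[J1 J2]]; exists j => //; split => //.
  rewrite /jumps/= (le_trans J1 st)/=.
  by have : (~` S) w by []; rewrite SC.
have PBSF : P (B j `&` S `&` free n t) = ((1 - l n)%:E * P (B j `&` S))%E.
  rewrite -[LHS]goodI; last by do 2!apply: measurableI => //.
  rewrite -[P (B j `&` S)]goodI; last exact: measurableI.
  (* On [S] the number of jumps at [t] is some [j + 1 + k]; the center of that index occurs neither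
     in [before n j] nor in the jump times. *)
  have -> : B j `&` S `&` good = \bigcup_k (B j `&` jumps n (j.+1 + k)%N t `&` good).
    apply/seteqP; split => w.
      move=> [[Bw Sw] gw]; have [k Jk] := jumps_total n gw (le_trans s0 st).
      exists (k - j.+1)%N => //; rewrite subnKC//; rewrite ltnNge; apply/negP => kj.
      have /andP[_ Jk2] := Jk; have := jump_time_le n gw (_ : k.+1 <= j.+1)%N.
      by rewrite ltnS => /(_ kj); rewrite /S/= in Sw; lra.
    move=> [k _ [[Bw Jw] gw]]; split => //; split => //; rewrite /S/=.
    by have /andP[Jk _] := Jw; apply: le_trans Jk; apply: jump_time_le => //; exact: leq_addr.
  have -> : B j `&` S `&` free n t `&` good =
      \bigcup_k (B j `&` jumps n (j.+1 + k)%N t `&` good `&` far n (j.+1 + k)%N).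
    apply/seteqP; split => w.
      move=> [[[Bw Sw] [k _ [Jk fk]]] gw]; exists (k - j.+1)%N => //.
      suff jk : (j < k)%N by rewrite subnKC.
      rewrite ltnNge; apply/negP => kj.
      have /andP[_ Jk2] := Jk; have := jump_time_le n gw (_ : k.+1 <= j.+1)%N.
      by rewrite ltnS => /(_ kj); rewrite /S/= in Sw; lra.
    move=> [k _ [[[Bw Jw] gw] fw]]; split => //; split => //.
      split => //; rewrite /S/=.
      by have /andP[Jk _] := Jw; apply: le_trans Jk; apply: jump_time_le => //; exact: leq_addr.
    by exists (j.+1 + k)%N.
  apply: measure_bigcup_scale.
  - by move=> k; do 2!apply: measurableI => //; exact: measurableI.
  - by move=> k; apply: measurableI => //; exact: measurableI.
  - by move=> k w [].
  - apply/trivIsetP => i k _ _ /eqP ik; apply/seteqP; split => w // [[[_ Ji] gw] [[_ Jk] _]].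
    by apply: ik; apply/eqP; rewrite -(eqn_add2l j.+1); apply/eqP; exact: jumps_inj gw Ji Jk.
  move=> k; rewrite setIAC !goodI; last 2 first.
  - exact: measurableI.
  - by apply: measurableI => //; exact: measurableI.
  apply: far_independent => //; apply: measurableI; last exact: measurable_jumps.
  have bK : before n j `<=` [set k0 | k0 <> inl (n, (j.+1 + k)%N)].
    by move=> [[a b]|[a b]]//= [an [/an]//|bj [_ bE]]; move: bj; rewrite bE; lia.
  apply: measurableI; first exact: sub_cylinders bK _.
  have -> : [set w | s < jump_time Y n j.+1 w] = ~` [set w | jump_time Y n j.+1 w <= s].
    by apply/seteqP; split => w /=; rewrite ltNge => /negP.
  by apply: measurableC; exact: measurable_le.
rewrite PBS PBSF PBS' -(fineK PBj) -!EFinM -EFinD; congr _%:E.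
by rewrite /stay; ring.
Qed.

End Markov.

(** * First hitting times *)

Section RealProbability.
Context d (T : measurableType d) (R : realType) (P : probability T R).

Definition pr (A : set T) : R := fine (P A).

Lemma prE A : measurable A -> P A = (pr A)%:E.
Proof. by move=> mA; rewrite /pr fineK// fin_num_measure. Qed.

Lemma pr_ge0 A : 0 <= pr A.
Proof. by rewrite /pr fine_ge0. Qed.

Lemma pr_le A B : measurable A -> measurable B -> A `<=` B -> pr A <= pr B.
Proof.
by move=> mA mB AB; rewrite -lee_fin -!prE// le_measure ?inE.
Qed.

Lemma pr_setT : pr setT = 1.
Proof. by rewrite /pr probability_setT. Qed.

Lemma bigsetU_measurableT (F : (set T)^nat) n : (forall i, measurable (F i)) ->
  measurable (\big[setU/set0]_(i < n) F i).
Proof. by move=> mF; exact: bigsetU_measurable. Qed.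

Lemma pr_bigsetU (F : (set T)^nat) n : (forall i, measurable (F i)) -> trivIset setT F ->
  pr (\big[setU/set0]_(i < n) F i) = \sum_(i < n) pr (F i).
Proof.
move=> mF tF; apply: EFin_inj; rewrite -prE; last exact: bigsetU_measurableT.
rewrite -sumEFin; have := measure_bigsetU P mF tF n => ->.
by apply: eq_bigr => i _; rewrite -prE.
Qed.

Lemma pr_sum_le (F : (set T)^nat) n B : (forall i, measurable (F i)) -> measurable B ->
  trivIset setT F -> (forall i, F i `<=` B) -> \sum_(i < n) pr (F i) <= pr B.
Proof.
move=> mF mB tF FB; rewrite -pr_bigsetU//; apply: pr_le => //.
  exact: bigsetU_measurableT.
by rewrite -bigcup_mkord; apply: bigcup_sub => i _; exact: FB.
Qed.

End RealProbability.

Section FirstHit.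
Context d (T : measurableType d) (R : realType) (P : probability T R).
Variables (l : nat -> R) (alpha : R) (C Y : nat -> nat -> {RV P >-> R}) (x : R).
Hypothesis l_gt0 : forall n, 0 < l n.
Hypothesis model : poisson_model alpha l C Y.
Hypothesis x_circle : circle x.
Variables (m N : nat).
Hypothesis l_lt1 : forall n, (m <= n)%N -> l n < 1.

Local Notation rate := (rate l alpha).
Local Notation free := (free l C Y x).
Local Notation good := (good Y).
Local Notation past := (past C Y).
Local Notation pr := (pr P).

Definition all_free t : set T := \big[setI/setT]_(i <- index_iota m N) free i t.

(* The correlation [P(free at s and s + u) / P(free at s)^2]. *)
Definition ker u := \prod_(m <= n < N) (1 + l n / (1 - l n) * expR (- rate n * u)).

Definition mass := \prod_(m <= n < N) (1 - l n).

Lemma mass_gt0 : 0 < mass.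
Proof.
rewrite /mass big_seq; apply: prodr_gt0 => i; rewrite mem_index_iota => /andP[mi _].
by rewrite subr_gt0 l_lt1.
Qed.

Lemma ker_ge1 u : 1 <= ker u.
Proof.
rewrite /ker big_seq; apply: (big_ind (fun y => 1 <= y)) => //.
  by move=> y z y1 z1; rewrite -[1]mulr1 ler_pM.
move=> i; rewrite mem_index_iota => /andP[mi _].
by rewrite lerDl mulr_ge0 ?expR_ge0// divr_ge0 ?ltW// subr_gt0 l_lt1.
Qed.

Lemma ker0 : mass * ker 0 = 1.
Proof.
rewrite /ker /mass -big_split/= big_seq big1// => i; rewrite mem_index_iota => /andP[mi _].
rewrite mulr0 expR0 mulr1 mulrDr mulr1 mulrCA divff ?mulr1; first by rewrite subrK.
by rewrite subr_eq0 gt_eqF// l_lt1.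
Qed.

Lemma all_freeP t w : all_free t w <-> forall i, (m <= i < N)%N -> free i t w.
Proof.
rewrite /all_free -bigcap_seq; split => H i.
  by move=> mi; apply: H; rewrite /= mem_index_iota.
by rewrite /= mem_index_iota => /H.
Qed.

Lemma ambient_all_free t : measurable (all_free t).
Proof.
by rewrite /all_free -bigcap_seq; apply: bigcap_measurableType => i _; exact: ambient_free.
Qed.

Lemma past_all_free n s t : t <= s -> past n s (all_free t).
Proof.
move=> ts; apply: past_bigsetI => i _; have [->|/eqP ni] := eqVneq i n; first exact: past_free.
exact: past_free_other.
Qed.

(** The arcs are added one at a time. Since [past i s] allows the other arcs at all times, [D]
    together with the event that they are free at [t] is still a past event for arc [i], and
    [free_markov] contributes the factor [stay]. *)
Lemma all_free_markov s t D : 0 <= s -> s <= t ->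
  (forall n, (m <= n < N)%N -> past n s D) -> D `<=` all_free s ->
  pr (D `&` all_free t) = mass * ker (t - s) * pr D.
Proof.
move=> s0 st pD Ds.
have -> : mass * ker (t - s) = \prod_(m <= n < N) stay l alpha n (t - s).
  rewrite /mass /ker -big_split/= big_seq [RHS]big_seq; apply: eq_bigr => i.
  rewrite mem_index_iota => /andP[mi _]; rewrite /stay mulrDr mulr1 mulrCA mulrA divfK//.
  by rewrite subr_eq0 gt_eqF// l_lt1.
rewrite /all_free; have : {subset index_iota m N <= [pred n | (m <= n < N)%N]}.
  by move=> i; rewrite mem_index_iota.
have := iota_uniq m (N - m); rewrite -/(index_iota m N).
elim: (index_iota m N) => [|i r IH]; first by rewrite !big_nil setIT mul1r.
move=> /= /andP[ir ur] sub; rewrite !big_cons.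
have mir : (m <= i < N)%N by apply: sub; rewrite inE eqxx.
have subr : {subset r <= [pred n | (m <= n < N)%N]}.
  by move=> j jr; apply: sub; rewrite inE jr orbT.
rewrite -mulrA -(IH ur subr).
have pDr : past i s (D `&` \big[setI/setT]_(j <- r) free j t).
  apply: pastI; first exact: pD.
  apply: past_bigsetI => j jr; apply: past_free_other => ji.
  by rewrite -ji jr in ir.
have mDr : measurable (D `&` \big[setI/setT]_(j <- r) free j t) by case: pDr.
apply: EFin_inj; rewrite EFinM -!prE//; last first.
  rewrite [free i t `&` _]setIC setIA; apply: measurableI => //; exact: ambient_free.
rewrite [free i t `&` _]setIC setIA; apply: (free_markov l_gt0 model) => //.
  by apply/ltW/l_lt1; case/andP: mir.
by move=> w [/Ds + _]; rewrite all_freeP; apply.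
Qed.

Lemma pr_all_free t : 0 <= t -> pr (all_free t) = mass.
Proof.
move=> t0; rewrite /all_free /mass.
have : {subset index_iota m N <= [pred n | (m <= n < N)%N]}.
  by move=> i; rewrite mem_index_iota.
have := iota_uniq m (N - m); rewrite -/(index_iota m N).
elim: (index_iota m N) => [|i r IH]; first by rewrite !big_nil pr_setT.
move=> /= /andP[ir ur] sub; rewrite !big_cons.
have mir : (m <= i < N)%N by apply: sub; rewrite inE eqxx.
have subr : {subset r <= [pred n | (m <= n < N)%N]}.
  by move=> j jr; apply: sub; rewrite inE jr orbT.
rewrite -(IH ur subr).
set D := \big[_/_]_(_ <- _) _.
have mD : measurable D.
  by rewrite /D -bigcap_seq; apply: bigcap_measurableType => j _; exact: ambient_free.
apply: EFin_inj; rewrite EFinM -!prE//; last first.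
  by apply: measurableI => //; exact: ambient_free.
apply: (free_independent l_gt0 model) => //; first by apply/ltW/l_lt1; case/andP: mir.
rewrite /D big_seq; elim/big_ind : _ => //; first by move=> A B; exact: measurableI.
move=> j jr; apply: measurable_free => k; split => /= ji; rewrite ji in jr; exact: (negP ir jr).
Qed.

Lemma pr_all_free2 s t : 0 <= s -> s <= t ->
  pr (all_free s `&` all_free t) = mass ^+ 2 * ker (t - s).
Proof.
move=> s0 st; rewrite (all_free_markov s0 st)//; last by move=> n _; exact: past_all_free.
by rewrite pr_all_free//; ring.
Qed.

Lemma past_bigsetU n s (F : (set T)^nat) i : (forall j, (j < i)%N -> past n s (F j)) ->
  past n s (\big[setU/set0]_(j < i) F j).
Proof.
elim: i => [|i IH] H; first by rewrite big_ord0 -setCT; apply: pastC; exact: past_setT.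
rewrite big_ord_recr/= -[_ `|` _]setCK setCU; apply: pastC; apply: pastI; apply: pastC.
  by apply: IH => j ji; apply: H; exact: leqW.
exact: H.
Qed.

(* Once the first grid point at which [x] is uncovered has been reached, the
   expected number of later such points is governed by [ker]. *)
Lemma first_hit a delta G : 0 <= a -> 0 <= delta ->
  pr (\big[setU/set0]_(i < G) all_free (a + i%:R * delta)) *
    (\sum_(i < G) ker (i%:R * delta)) <= (G + G)%:R.
Proof.
move=> a0 delta0; pose F i := all_free (a + i%:R * delta).
have mF i : measurable (F i) by exact: ambient_all_free.
have mH i : measurable (seqDU F i) by exact: seqDU_measurable.
have tH := trivIset_seqDU F.
have posn i : 0 <= a + i%:R * delta by rewrite addr_ge0// mulr_ge0.
(* [seqDU F i] is the event that the grid point [i] is the first uncovered one. *)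
rewrite (_ : \big[setU/set0]_(i < G) _ = \big[setU/set0]_(i < G) seqDU F i); last first.
  by rewrite -bigsetU_seqDU.
rewrite pr_bigsetU// -(ler_pM2l mass_gt0).
have step i j : pr (seqDU F i `&` F (i + j)%N) = mass * ker (j%:R * delta) * pr (seqDU F i).
  rewrite (@all_free_markov (a + i%:R * delta)) //.
  - by congr (_ * ker _ * _); rewrite natrD; ring.
  - by rewrite lerD2l ler_wpM2r// ler_nat leq_addr.
  - move=> n _; rewrite /seqDU setDE; apply: pastI; first exact: past_all_free.
    apply: pastC; apply: past_bigsetU => j' j'i; apply: past_all_free.
    by rewrite lerD2l ler_wpM2r// ler_nat ltnW.
  - exact: subset_seqDU.
have -> : mass * ((\sum_(i < G) pr (seqDU F i)) * (\sum_(i < G) ker (i%:R * delta))) =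
    \sum_(i < G) \sum_(j < G) pr (seqDU F i `&` F (i + j)%N).
  rewrite mulr_suml mulr_sumr; apply: eq_bigr => i _.
  rewrite !mulr_sumr; apply: eq_bigr => j _; rewrite step; ring.
(* Shifting by [i < G] keeps the index [i + j] below [2 * G]; this is the source of the factor [2]
   in the hitting bound. *)
apply: (@le_trans _ _ (\sum_(i < G) \sum_(j < G + G) pr (seqDU F i `&` F j))).
  apply: ler_sum => i _.
  rewrite -(big_mkord xpredT (fun j => pr (seqDU F i `&` F (i + j)%N))).
  rewrite -(big_mkord xpredT (fun j => pr (seqDU F i `&` F j))).
  have le2 : (i <= i + G)%N by exact: leq_addr.
  have le3 : (i + G <= G + G)%N by rewrite leq_add2r ltnW.
  rewrite [leRHS](big_cat_nat (leq0n i) (leq_trans le2 le3))/= [in leRHS](big_cat_nat le2 le3)/=.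
  have -> : \sum_(i <= j < i + G) pr (seqDU F i `&` F j) =
      \sum_(0 <= j < G) pr (seqDU F i `&` F (i + j)%N).
    by rewrite -{1}[nat_of_ord i]add0n big_addn addKn; apply: eq_bigr => j _; rewrite addnC.
  by rewrite addrCA lerDl addr_ge0// sumr_ge0// => j _; exact: pr_ge0.
(* For fixed [j] the events [seqDU F i] are disjoint, so the sum over [i] is at most the probability
   of [F j], which is [mass]. *)
have -> : mass * (G + G)%:R = \sum_(j < G + G) mass by rewrite sumr_const card_ord mulr_natr.
rewrite exchange_big/=; apply: ler_sum => j _.
rewrite -(pr_all_free (posn j)); apply: (@pr_sum_le _ _ _ P (fun i => seqDU F i `&` F j)) => //.
- by move=> i; exact: measurableI.
- exact: mF.
- exact: trivIset_setIr.
Qed.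

Lemma bigsetU_all_free a h n : \big[setU/set0]_(i < n) all_free (a + i%:R * h) =
  \bigcup_(i < n) all_free (a + i%:R * h).
Proof. by rewrite bigcup_mkord. Qed.

(** Dyadic grids are nested, so a bound valid for each grid passes to their increasing union, which
    is measurable because it is countable. *)
Definition hit a eps : set T :=
  \bigcup_k \big[setU/set0]_(i < 2 ^ k) all_free (a + i%:R * (eps / (2 ^ k)%:R)).

Lemma measurable_hit a eps : measurable (hit a eps).
Proof.
by apply: bigcup_measurable => k _; apply: bigsetU_measurable => i _; exact: ambient_all_free.
Qed.

Lemma pr_hit a eps kappa : 0 <= a -> 0 <= eps -> 0 < kappa ->
  (forall G, (0 < G)%N -> kappa * G%:R <= \sum_(i < G) ker (i%:R * (eps / G%:R))) ->
  pr (hit a eps) <= 2 / kappa.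
Proof.
move=> a0 eps0 kappa0 H.
set U := fun k => \big[setU/set0]_(i < 2 ^ k) all_free (a + i%:R * (eps / (2 ^ k)%:R)).
have mU k : measurable (U k) by apply: bigsetU_measurable => i _; exact: ambient_all_free.
have ndU : {homo U : k k' / (k <= k')%N >-> (k <= k')%O}.
  apply/nondecreasing_seqP => k; apply/subsetPset; rewrite /U !bigsetU_all_free => w [i /= ik Fi].
  exists (i * 2)%N; first by rewrite /= expnS mulnC ltn_pmul2l.
  have -> : (i * 2)%:R * (eps / (2 ^ k.+1)%:R) = i%:R * (eps / (2 ^ k)%:R) => //.
  rewrite expnS !natrM invfM; set z := (2 ^ k)%:R^-1; by field.
have cv := @nondecreasing_cvg_mu _ _ _ P U mU (measurable_hit a eps) ndU.
have Hk k : (P (U k) <= (2 / kappa)%:E)%E.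
  have G0 : (0 < 2 ^ k)%N by rewrite expn_gt0.
  rewrite prE// lee_fin ler_pdivlMr//.
  have G0' : (0 : R) < (2 ^ k)%:R by rewrite ltr0n.
  rewrite -(ler_pM2r G0') -mulrA.
  apply: (le_trans (ler_wpM2l (pr_ge0 _ _) (H _ G0))).
  apply: le_trans (first_hit _ a0 _) _; first by rewrite divr_ge0.
  by rewrite natrD; lra.
rewrite -lee_fin -prE; last exact: measurable_hit.
rewrite -(cvg_lim _ cv)//; apply: lime_le; first by apply: cvgP cv.
by apply: nearW => k; exact: Hk.
Qed.

Lemma free_right n t w : free n t w ->
  exists2 e, 0 < e & forall t', t <= t' < t + e -> free n t' w.
Proof.
move=> [j _ [/andP[J1 J2] fj]]; exists (jump_time Y n j.+1 w - t); first by rewrite subr_gt0.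
by move=> t' /andP[tt' t'e]; exists j => //; split => //; rewrite /jumps/=; lra.
Qed.

Lemma all_free_right t w : all_free t w ->
  exists2 e, 0 < e & forall t', t <= t' < t + e -> all_free t' w.
Proof.
rewrite all_freeP => H.
suff [e e0 He] : exists2 e, 0 < e & forall t', t <= t' < t + e ->
    forall i, i \in index_iota m N -> free i t' w.
  by exists e => // t' /He H'; rewrite all_freeP => i mi; apply: H'; rewrite mem_index_iota.
have : forall i, i \in index_iota m N -> free i t w by move=> i; rewrite mem_index_iota => /H.
elim: (index_iota m N) => [|i r IH] Hr; first by exists 1.
have [e1 e10 He1] : exists2 e, 0 < e & forall t', t <= t' < t + e ->
    forall i, i \in r -> free i t' w.
  by apply: IH => j jr; apply: Hr; rewrite inE jr orbT.
have [e2 e20 He2] := free_right (Hr i (mem_head _ _)).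
exists (Num.min e1 e2); first by rewrite lt_min e10.
move=> t' /andP[tt' t'e] j; have te1 : t' < t + e1 by apply: (lt_le_trans t'e); rewrite lerD2l ge_min lexx.
have te2 : t' < t + e2 by apply: (lt_le_trans t'e); rewrite lerD2l ge_min lexx orbT.
by rewrite inE => /predU1P[->|jr]; [apply: He2|apply: He1]; rewrite ?tt'.
Qed.

(** By right-continuity [x] stays uncovered on some interval starting at [t]. A mesh smaller than
    its length and than the distance from [t] to [a + eps] puts a grid point into it. *)
Lemma hitP a eps t w : 0 < eps -> a <= t < a + eps -> all_free t w -> hit a eps w.
Proof.
move=> eps0 /andP[at_ ta] /all_free_right[e e0 He].
pose k := Num.bound (eps / Num.min e (a + eps - t)).
have mn0 : 0 < Num.min e (a + eps - t) by rewrite lt_min e0; lra.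
have G0 : (0 : R) < (2 ^ k)%:R by rewrite ltr0n expn_gt0.
have small : eps / (2 ^ k)%:R < Num.min e (a + eps - t).
  rewrite ltr_pdivrMr// mulrC -ltr_pdivrMr// natrX.
  by apply: upper_nthrootP.
set h := eps / (2 ^ k)%:R in small *.
have h0 : 0 < h by rewrite divr_gt0.
pose i := Num.Def.ceil ((t - a) / h).
have i0 : 0 <= i by rewrite -(ler_int R); apply: le_trans (ceil_ge _); rewrite divr_ge0//; lra.
have [j ij] : exists j : nat, i = j%:Z by exists `|i|%N; rewrite gez0_abs.
have jh1 : t - a <= j%:R * h.
  rewrite -ler_pdivrMr//; have := ceil_ge ((t - a) / h); rewrite -/i ij -pmulrn; exact.
have jh2 : j%:R * h < t - a + h.
  have : i%:~R - 1 < (t - a) / h.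
    by have := ceil_itv ((t - a) / h); rewrite -/i => /andP[+ _]; rewrite intrB.
  by rewrite ij ltr_pdivlMr// -pmulrn mulrBl mul1r; lra.
have small1 : h < e by apply: lt_le_trans small _; rewrite ge_min lexx.
have small2 : h < a + eps - t by apply: lt_le_trans small _; rewrite ge_min lexx orbT.
exists k => //; rewrite bigsetU_all_free; exists j; last first.
  by apply: He; rewrite -/h; lra.
rewrite /= -(ltr_nat R) -(ltr_pM2r h0) [X in _ < X](_ : _ = eps); first by lra.
by rewrite /h mulrC divfK// gt_eqF.
Qed.

End FirstHit.

(** * The correlation kernel and the covering series *)

Section PowerSums.
Context {R : realType}.
Implicit Types (a u v : R).

Lemma natrSS_le k : k.+2%:R <= 2 * k.+1%:R :> R.
Proof. by rewrite -natrM ler_nat; lia. Qed.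

Lemma powRE u a : 0 < u -> u `^ a = expR (a * ln u).
Proof. by move=> u0; rewrite /powR gt_eqF. Qed.

Lemma ln_sub_ge u v : 0 < u -> 0 < v -> (v - u) / v <= ln v - ln u.
Proof.
move=> u0 v0; have uv : -1 < u / v - 1 by have : 0 < u / v by [rewrite divr_gt0|]; lra.
have := le_ln1Dx uv; rewrite addrC subrK ln_div ?posrE//.
by rewrite mulrBl divff ?gt_eqF//; lra.
Qed.

Lemma powR_sub_ge a u v : 0 < a -> 0 < u -> 0 < v ->
  a * ((v - u) / v) * v `^ (- a) <= u `^ (- a) - v `^ (- a).
Proof.
move=> a0 u0 v0; have Huv := ln_sub_ge u0 v0.
have -> : u `^ (- a) = expR (a * (ln v - ln u)) * v `^ (- a).
  by rewrite !powRE// -expRD; congr expR; ring.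
have v0' := powR_gt0 (- a) v0.
have : 1 + a * (ln v - ln u) <= expR (a * (ln v - ln u)) by exact: expR_ge1Dx.
have : a * ((v - u) / v) <= a * (ln v - ln u) by rewrite ler_wpM2l// ltW.
move=> H1 H2; set E := expR _ in H2 *.
suff : a * ((v - u) / v) <= E - 1 by move=> /(ler_wpM2r (ltW v0')); set W := v `^ _; rewrite [X in _ <= X -> _]mulrBl mul1r.
lra.
Qed.

(** Telescoping: each term is at most [2^(1 + a) / a] times a difference of consecutive values of
    [k^(-a)], the power of [2] paying for the shift from [k + 1] to [k + 2]. *)
Lemma sum_powR_tail a n K : 0 < a ->
  \sum_(n <= k < K) k.+1%:R `^ (- 1 - a) <= 2 `^ (1 + a) / a * n.+1%:R `^ (- a).
Proof.
move=> a0.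
have step k : k.+1%:R `^ (- 1 - a) <=
    2 `^ (1 + a) / a * (k.+1%:R `^ (- a) - k.+2%:R `^ (- a)).
  have H := @powR_sub_ge a k.+1%:R k.+2%:R a0 (ltr0Sn _ _) (ltr0Sn _ _).
  have v0 : (0 : R) < k.+2%:R by rewrite ltr0Sn.
  have -> : k.+1%:R `^ (- 1 - a) = (2 * k.+1%:R) `^ (- 1 - a) * 2 `^ (1 + a) :> R.
    rewrite powRM// mulrAC -powRD; last by rewrite pnatr_eq0 implybT.
    by rewrite (_ : -1 - a + (1 + a) = 0) ?powRr0 ?mul1r//; ring.
  rewrite [leLHS]mulrC -mulrA; apply: ler_wpM2l; first exact: powR_ge0.
  rewrite ler_pdivlMl; last exact: a0.
  apply: le_trans H; rewrite (_ : k.+2%:R - k.+1%:R = 1); last by rewrite -natrB// subSn// subnn.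
  rewrite mul1r -mulrA ler_wpM2l ?(ltW a0)//.
  have -> : k.+2%:R^-1 * k.+2%:R `^ (- a) = k.+2%:R `^ (- 1 - a) :> R.
    by rewrite -powR_inv1 ?ler0n// -powRD//; rewrite pnatr_eq0 implybT.
  rewrite (_ : -1 - a = - (1 + a)); last by ring.
  have w0 : (0 : R) < 2 * k.+1%:R by rewrite mulr_gt0// ltr0Sn.
  rewrite !powRN lef_pV2 ?posrE ?powR_gt0//.
  apply: ge0_ler_powR; rewrite ?nnegrE ?ler0n ?(ltW w0)//; first by rewrite addr_ge0// ltW.
  exact: natrSS_le.
apply: (le_trans (ler_sum _ (fun k _ => step k))); rewrite -mulr_sumr.
apply: ler_wpM2l; first by rewrite divr_ge0 ?powR_ge0// ltW.
have [nK|Kn] := leqP n K; last by rewrite big_geq ?powR_ge0// ltnW.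
rewrite (eq_bigr (fun k => - (k.+2%:R `^ (- a)) - - (k.+1%:R `^ (- a)))); last by move=> k _; rewrite opprK addrC.
rewrite telescope_sumr//; first by have := powR_ge0 (K.+1%:R : R) (- a); lra.
Qed.

Lemma sum_powR_head a n : 0 < a ->
  \sum_(0 <= k < n) k.+1%:R `^ (a - 1) <= (1 + a) / a * n%:R `^ a.
Proof.
move=> a0.
have step k : k.+1%:R `^ (a - 1) <= (1 + a) / a * (k.+1%:R `^ a - k%:R `^ a).
  have v1 : (1 : R) <= k.+1%:R by rewrite ler1n.
  have v0 : (0 : R) < k.+1%:R by rewrite ltr0Sn.
  have -> : k.+1%:R `^ (a - 1) = k.+1%:R `^ a / k.+1%:R :> R.
    by rewrite powRB ?powRr1 ?ler0n// pnatr_eq0 implybT.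
  have aa : (1 + a) / a = 1 + a^-1 by rewrite mulrDl divff ?gt_eqF// mul1r addrC.
  have ai : 0 < a^-1 by rewrite invr_gt0.
  have vi : 0 < k.+1%:R^-1 :> R by rewrite invr_gt0.
  case: k v1 v0 vi => [|k] v1 v0 vi.
    by rewrite powR0 ?gt_eqF// powR1 subr0 aa; lra.
  have u0 : (0 : R) < k.+1%:R by rewrite ltr0Sn.
  have Huv := ln_sub_ge u0 v0.
  have -> : k.+1%:R `^ a = expR (- (a * (ln k.+2%:R - ln k.+1%:R))) * k.+2%:R `^ a :> R.
    by rewrite !powRE// -expRD; congr expR; ring.
  set y := a * (ln _ - ln _); set W := k.+2%:R `^ a.
  rewrite (_ : W - expR (- y) * W = (1 - expR (- y)) * W); last by ring.
  rewrite mulrA [leLHS]mulrC ler_wpM2r ?powR_ge0//.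
  rewrite (_ : k.+2%:R - k.+1%:R = 1) in Huv; last by rewrite -natrB// subSn// subnn.
  have Hy : a * k.+2%:R^-1 <= y by rewrite /y ler_wpM2l ?(ltW a0)// -[X in X <= _]mul1r.
  set z := a * k.+2%:R^-1 in Hy.
  have z0 : 0 < z by rewrite /z mulr_gt0.
  have Hz : expR (- y) * (1 + z) <= 1.
    rewrite expRN mulrC ler_pdivrMr ?expR_gt0// mul1r (le_trans _ (expR_ge1Dx y))//; lra.
  have za : z <= a by rewrite /z ger_pMr// invf_le1.
  have zi : k.+2%:R^-1 = a^-1 * z by rewrite /z mulKf// gt_eqF.
  rewrite zi aa; have e0 := expR_gt0 (- y).
  (* Since [exp (- y) <= 1 / (1 + z)] and [z <= a], [1 - exp (- y)] is at least [z / (1 + a)]; hence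
     the constant [(1 + a) / a]. *)
  suff : z <= (1 + a) * (1 - expR (- y)).
    move=> H; have -> : 1 + a^-1 = a^-1 * (1 + a) by rewrite mulrDr mulr1 mulVf ?gt_eqF// addrC.
    by rewrite -mulrA ler_wpM2l// ltW.
  nra.
apply: (le_trans (ler_sum _ (fun k _ => step k))); rewrite -mulr_sumr.
apply: ler_wpM2l; first by rewrite divr_ge0 ?ltW//; lra.
by rewrite telescope_sumr// powR0 ?subr0// gt_eqF.
Qed.

Lemma powR_divn (M e : R) k : 0 <= M -> (M / k.+1%:R) `^ e = M `^ e * k.+1%:R `^ (- e).
Proof.
by move=> M0; rewrite powRM ?invr_ge0 ?ler0n// -[k.+1%:R^-1]powR_inv1 ?ler0n// -powRrM mulN1r.
Qed.

End PowerSums.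

Section KernelBounds.
Context {R : realType}.
Variables (l : nat -> R) (M0 M1 alpha : R).
Hypothesis l_gt0 : forall n, 0 < l n.
Hypothesis M0_gt0 : 0 < M0.
Hypothesis l_bnd : forall n, M0 / n.+1%:R <= l n <= M1 / n.+1%:R.
Hypothesis alpha_gt0 : 0 < alpha.

Local Notation rate := (rate l alpha).
Local Notation S n := (\sum_(k < n) l k).

Let M1_gt0 : 0 < M1.
Proof. by have := l_bnd 0; rewrite !divr1 => /andP[_]; exact: lt_le_trans. Qed.

Lemma sum_split m n : (m <= n)%N -> S n = S m + \sum_(m <= k < n) l k.
Proof. by move=> mn; rewrite -!(big_mkord xpredT l) (big_cat_nat (leq0n m) mn). Qed.

Lemma rate_powR k : rate k = (l k `^ alpha)^-1.
Proof. by rewrite rateE powRN. Qed.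

Lemma l_rate k : l k * rate k <= M1 * M0 `^ (- alpha) * k.+1%:R `^ (alpha - 1).
Proof.
have k0 : (0 : R) < k.+1%:R by rewrite ltr0Sn.
have /andP[lb ub] := l_bnd k.
have H : rate k <= M0 `^ (- alpha) * k.+1%:R `^ alpha.
  have -> : M0 `^ (- alpha) * k.+1%:R `^ alpha = (M0 / k.+1%:R) `^ (- alpha).
    by rewrite powR_divn ?opprK// ltW.
  rewrite rateE !powRN lef_pV2 ?posrE ?powR_gt0 ?divr_gt0//.
  by apply: ge0_ler_powR; rewrite ?nnegrE //; apply: ltW => //; exact: divr_gt0.
have -> : M1 * M0 `^ (- alpha) * k.+1%:R `^ (alpha - 1) =
    (M1 / k.+1%:R) * (M0 `^ (- alpha) * k.+1%:R `^ alpha).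
  rewrite powRB ?powRr1 ?ltW//; last by rewrite pnatr_eq0 implybT.
  by ring.
by apply: ler_pM => //; rewrite ?powR_ge0 ?ltW.
Qed.

(** [exp (L * th) <= 1 / (1 - L * th)], and the denominator [1 - L] on the right absorbs the terms
    of second order. Lower bounds for [ker] thus lose nothing through squares of lengths. *)
Lemma one_plus_ge (L th : R) : 0 < L -> L < 1 -> 0 <= th -> th <= 1 ->
  expR (L * th) <= 1 + L / (1 - L) * th.
Proof.
move=> L0 L1 t0 t1; have Lt : L * th < 1 by rewrite (le_lt_trans _ L1)// ger_pMr.
apply: (@le_trans _ _ (1 - L * th)^-1).
  rewrite -[expR _]invrK lef_pV2 ?posrE ?invr_gt0 ?expR_gt0 ?subr_gt0// -expRN.
  by have := expR_ge1Dx (- (L * th)).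
have d0 : 0 < 1 - L by rewrite subr_gt0.
rewrite -[leLHS]div1r ler_pdivrMr ?subr_gt0//.
rewrite -(ler_pM2r d0) mul1r.
have -> : (1 + L / (1 - L) * th) * (1 - L * th) * (1 - L) = (1 - L + L * th) * (1 - L * th).
  by field; rewrite gt_eqF.
have : 0 <= (L * th) * (L - L * th) by apply: mulr_ge0; [rewrite mulr_ge0 ?(ltW L0)|rewrite subr_ge0 ger_pMr].
lra.
Qed.

(** By [exp (- r * t) >= 1 - r * t], a factor below [n] is at least
    [exp (l k - t * (l k * rate k))]; the factors from [n] on are at least [1]. *)
Lemma ker_ge (m N n : nat) (t : R) : (forall k, (m <= k)%N -> l k < 1) -> 0 <= t ->
  (m <= n)%N -> (n <= N)%N ->
  expR (S n - S m - t * \sum_(0 <= k < n) l k * rate k) <= ker l alpha m N t.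
Proof.
move=> l1 t0 mn nN.
have term k : (m <= k)%N -> expR (l k - t * (l k * rate k)) <= 1 + l k / (1 - l k) * expR (- rate k * t).
  move=> mk; have r0 : 0 < rate k by rewrite powR_gt0.
  apply: le_trans (one_plus_ge (l_gt0 k) (l1 k mk) (expR_ge0 _) _); last first.
    by rewrite -expR0 ler_expR mulNr oppr_le0 mulr_ge0// ltW.
  rewrite ler_expR; have := expR_ge1Dx (- rate k * t) => H.
  have -> : l k - t * (l k * rate k) = l k * (1 + - rate k * t) by ring.
  by rewrite ler_wpM2l// ltW.
have one k : (m <= k)%N -> 1 <= 1 + l k / (1 - l k) * expR (- rate k * t).
  by move=> mk; rewrite lerDl mulr_ge0 ?expR_ge0// divr_ge0 ?ltW// subr_gt0 l1.
rewrite /ker (big_cat_nat mn nN)/=.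
apply: (@le_trans _ _ (\prod_(m <= k < n) expR (l k - t * (l k * rate k)) * 1)).
  rewrite mulr1 -expR_sum ler_expR sumrB -mulr_sumr lerB//.
    by rewrite (sum_split mn) addrC addKr.
  rewrite ler_wpM2l// (big_cat_nat (leq0n m) mn)/= lerDr.
  by apply: sumr_ge0 => k _; rewrite mulr_ge0 ?ltW// powR_gt0.
apply: ler_pM => //.
- by apply: prodr_ge0 => k _; exact: expR_ge0.
- rewrite big_seq [leRHS]big_seq; apply: ler_prod => k; rewrite mem_index_iota => /andP[mk _].
  by rewrite expR_ge0 term.
- rewrite big_seq; apply: (big_ind (fun y => 1 <= y)) => //.
    by move=> y z y1 z1; rewrite -[1]mulr1 ler_pM.
  by move=> k; rewrite mem_index_iota => /andP[nk _]; apply: one; exact: leq_trans nk.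
Qed.

(** Up to time [n^(-alpha)] the first [n] chains hardly move: the sum of [l k * rate k] over [k < n]
    is of order [n^alpha], so the loss in [ker_ge] is at most a constant that depends on none of
    [m], [N], [n]. For [n < m] the left side is at most [1]. *)
Lemma ker_ge_unif : exists2 C1, 0 < C1 & forall m N n t,
  (forall k, (m <= k)%N -> l k < 1) -> (n <= N)%N ->
  0 <= t -> t <= n%:R `^ (- alpha) -> expR (- S m - C1) * expR (S n) <= ker l alpha m N t.
Proof.
have A0 : 0 < M1 * M0 `^ (- alpha) * ((1 + alpha) / alpha).
  by apply: mulr_gt0; [apply: mulr_gt0 => //; exact: powR_gt0|apply: divr_gt0 => //; exact: addr_gt0].
move: A0; set C1 := _ * _ => A0; exists C1 => //.
move=> m N n t l1 nN t0 tn; have [mn|nm] := leqP m n; last first.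
  apply: (@le_trans _ _ 1); last exact: ker_ge1.
  rewrite -expRD -expR0 ler_expR.
  suff : S n <= S m by lra.
  rewrite (sum_split (ltnW nm)) lerDl.
  by apply: sumr_ge0 => k _; exact: ltW.
apply: le_trans (ker_ge l1 t0 mn nN); rewrite -expRD ler_expR.
suff : t * (\sum_(0 <= k < n) l k * rate k) <= C1 by lra.
have [n0|n0] := posnP n; first by rewrite n0 big_geq// mulr0 ltW.
have H : \sum_(0 <= k < n) l k * rate k <= M1 * M0 `^ (- alpha) * ((1 + alpha) / alpha * n%:R `^ alpha).
  apply: (le_trans (ler_sum _ (fun k _ => l_rate k))); rewrite -mulr_sumr ler_wpM2l//.
    by rewrite mulr_ge0 ?powR_ge0// ltW.
  exact: sum_powR_head.
have nn : n%:R `^ (- alpha) * n%:R `^ alpha = 1 :> R.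
  by rewrite -powRD ?addNr ?powRr0// pnatr_eq0 -lt0n n0 implybT.
apply: (le_trans (ler_pM t0 _ tn H)).
  by apply: sumr_ge0 => k _; rewrite mulr_ge0 ?ltW// powR_gt0.
by rewrite -[leRHS]mulr1 -[X in _ <= _ * X]nn le_eqVlt; apply/orP; left; apply/eqP; rewrite /C1; ring.
Qed.

Lemma ker_expR_sum (m N : nat) (t : R) : (forall k, (m <= k)%N -> l k < 1) ->
  ker l alpha m N t <= expR (\sum_(m <= k < N) l k / (1 - l k) * expR (- rate k * t)).
Proof.
move=> l1; rewrite expR_sum /ker big_seq [leRHS]big_seq; apply: ler_prod => k.
rewrite mem_index_iota => /andP[mk _]; rewrite expR_ge1Dx andbT.
by rewrite addr_ge0// mulr_ge0 ?expR_ge0// divr_ge0 ?ltW// subr_gt0 l1.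
Qed.

Lemma tail_term k t : l k <= 1 / 2 -> 0 < t ->
  l k / (1 - l k) * expR (- rate k * t) <= 2 * M1 `^ (1 + alpha) / t * k.+1%:R `^ (- 1 - alpha).
Proof.
move=> lk t0; have k0 : (0 : R) < k.+1%:R by rewrite ltr0Sn.
have r0 : 0 < rate k by rewrite powR_gt0.
have rt : 0 < rate k * t by rewrite mulr_gt0.
have H1 : l k / (1 - l k) <= 2 * l k.
  rewrite ler_pdivrMr; last by have := l_gt0 k; lra.
  have := l_gt0 k; nra.
have H2 : expR (- rate k * t) <= (l k `^ alpha) / t.
  rewrite mulNr expRN -[l k `^ alpha]invrK -rate_powR -invfM lef_pV2 ?posrE ?expR_gt0//.
  by have := expR_ge1Dx (rate k * t); lra.
have H3 : l k * l k `^ alpha <= M1 `^ (1 + alpha) * k.+1%:R `^ (- 1 - alpha).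
  have -> : M1 `^ (1 + alpha) * k.+1%:R `^ (- 1 - alpha) = (M1 / k.+1%:R) `^ (1 + alpha).
    rewrite powR_divn ?(ltW M1_gt0)//; congr (_ * _ `^ _); ring.
  have -> : l k * l k `^ alpha = l k `^ (1 + alpha).
    by rewrite powRD ?powRr1 ?ltW// (gt_eqF (l_gt0 k)) implybT.
  have /andP[_ ub] := l_bnd k.
  by apply: ge0_ler_powR; rewrite ?nnegrE //; apply: ltW => //; [exact: addr_gt0|exact: divr_gt0].
apply: (@le_trans _ _ (2 * l k * (l k `^ alpha / t))).
  by apply: ler_pM => //; rewrite ?expR_ge0// divr_ge0 ?ltW//; have := l_gt0 k; lra.
have -> : 2 * l k * (l k `^ alpha / t) = 2 / t * (l k * l k `^ alpha) by ring.
have -> : 2 * M1 `^ (1 + alpha) / t * k.+1%:R `^ (- 1 - alpha) =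
  2 / t * (M1 `^ (1 + alpha) * k.+1%:R `^ (- 1 - alpha)) by ring.
by rewrite ler_wpM2l// divr_ge0// ltW.
Qed.

Let C3 := 2 * M1 `^ (1 + alpha) * (2 `^ (1 + alpha) / alpha).

Let C3_gt0 : 0 < C3.
Proof. by rewrite /C3 !mulr_gt0 ?powR_gt0 ?invr_gt0. Qed.

Lemma tail_sum (n K : nat) t : 0 < t -> (forall k, (n <= k)%N -> l k <= 1 / 2) ->
  \sum_(n <= k < K) l k / (1 - l k) * expR (- rate k * t) <= C3 / t * n.+1%:R `^ (- alpha).
Proof.
move=> t0 l2; apply: (@le_trans _ _ (\sum_(n <= k < K)
    2 * M1 `^ (1 + alpha) / t * k.+1%:R `^ (- 1 - alpha))).
  rewrite big_seq [leRHS]big_seq; apply: ler_sum => k; rewrite mem_index_iota => /andP[nk _].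
  by apply: tail_term => //; exact: l2.
rewrite -mulr_sumr; apply: le_trans (ler_wpM2l _ (sum_powR_tail n K alpha_gt0)) _.
  by rewrite divr_ge0 ?mulr_ge0 ?powR_ge0// ltW.
by rewrite le_eqVlt; apply/orP; left; apply/eqP; rewrite /C3; ring.
Qed.

(** Beyond [n] the chains have decorrelated by time [t]: [exp (- y) <= 1 / y] leaves a convergent
    tail, at most [C3]. Before [n] the exponentials are bounded by [1], and
    [l k / (1 - l k) <= l k + 2 * l k ^+ 2] costs a sum of squares, at most [A]. *)
Lemma ker_le : exists2 C2, 0 < C2 & forall m N n t,
  (forall k, (m <= k)%N -> l k <= 1 / 2) ->
  n.+1%:R `^ (- alpha) <= t -> ker l alpha m N t <= C2 * expR (S n).
Proof.
pose A := 2 * M1 ^+ 2 * (2 `^ (1 + 1) / 1).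
exists (expR (A + C3)); first exact: expR_gt0.
move=> m N n t l2 nt.
have n0 : (0 : R) < n.+1%:R `^ (- alpha) by rewrite powR_gt0.
have t0 : 0 < t by exact: lt_le_trans nt.
have l1 k : (m <= k)%N -> l k < 1 by move=> /l2; lra.
apply: (le_trans (ker_expR_sum _ _ l1)); rewrite -expRD ler_expR.
have pos k : (m <= k)%N -> 0 <= l k / (1 - l k) * expR (- rate k * t).
  by move=> mk; rewrite mulr_ge0 ?expR_ge0// divr_ge0 ?ltW// subr_gt0 l1.
have pos_sum a b : (m <= a)%N -> 0 <= \sum_(a <= k < b) l k / (1 - l k) * expR (- rate k * t).
  move=> ma; rewrite big_seq; apply: sumr_ge0 => k; rewrite mem_index_iota => /andP[ak _].
  by apply: pos; exact: leq_trans ak.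
(* The range is enlarged so that it contains the cut [maxn m n], whatever the order of [m], [n] and
   [N]. *)
apply: (@le_trans _ _ (\sum_(m <= k < m + n + N) l k / (1 - l k) * expR (- rate k * t))).
  have [mN|Nm] := leqP m N; last first.
    by rewrite (big_geq (ltnW Nm)); exact: pos_sum.
  have le3 : (N <= m + n + N)%N by rewrite leq_addl.
  by rewrite [leRHS](big_cat_nat mN le3)/= lerDl; exact: pos_sum.
have mid1 : (m <= maxn m n)%N by rewrite leq_maxl.
have mid2 : (maxn m n <= m + n + N)%N by rewrite geq_max; lia.
rewrite (big_cat_nat mid1 mid2)/= [leRHS]addrAC.
have H2 : \sum_(maxn m n <= k < m + n + N) l k / (1 - l k) * expR (- rate k * t) <= C3.
  apply: (le_trans (tail_sum _ t0 _)).
    by move=> k; rewrite geq_max => /andP[/l2].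
  rewrite mulrAC ler_pdivrMr// ler_wpM2l ?(ltW C3_gt0)//.
  apply: le_trans nt; rewrite !powRN lef_pV2 ?posrE ?powR_gt0// ?ltr0Sn//.
  by apply: ge0_ler_powR; rewrite ?nnegrE ?ler0n ?(ltW alpha_gt0)// ler_nat ltnS leq_maxr.
apply: lerD => //.
have H k : (m <= k)%N -> l k / (1 - l k) * expR (- rate k * t) <= l k + 2 * M1 ^+ 2 * k.+1%:R `^ (- 1 - 1).
  move=> mk; have k0 : (0 : R) < k.+1%:R by rewrite ltr0Sn.
  apply: (@le_trans _ _ (l k / (1 - l k))).
    rewrite ger_pMr ?divr_gt0// ?subr_gt0 ?l1// -expR0 ler_expR mulNr oppr_le0 mulr_ge0 ?ltW//.
    by rewrite powR_gt0.
  have -> : k.+1%:R `^ (-1 - 1) = (k.+1%:R^-1) ^+ 2 :> R.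
    by rewrite -opprD powRN (powR_mulrn 2) ?ler0n// exprVn.
  have /andP[_ ub] := l_bnd k.
  have : l k ^+ 2 <= M1 ^+ 2 * k.+1%:R^-1 ^+ 2 by rewrite -exprMn; apply: lerXn2r => //; rewrite nnegrE; apply: ltW => //; exact: divr_gt0.
  move=> Hsq; apply: (@le_trans _ _ (l k + 2 * l k ^+ 2)); last by rewrite lerD2l -mulrA ler_wpM2l.
  rewrite ler_pdivrMr ?subr_gt0 ?l1//; have := l_gt0 k; have := l2 k mk; nra.
apply: (@le_trans _ _ (\sum_(m <= k < maxn m n) (l k + 2 * M1 ^+ 2 * k.+1%:R `^ (- 1 - 1)))).
  by rewrite big_seq [leRHS]big_seq; apply: ler_sum => k; rewrite mem_index_iota => /andP[/H].
rewrite big_split/= addrC lerD//.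
  rewrite -mulr_sumr /A; apply: ler_wpM2l; first by apply: mulr_ge0 => //; exact: sqr_ge0.
  apply: (le_trans (sum_powR_tail _ _ ltr01)); rewrite ler_piMr ?divr_ge0 ?powR_ge0//.
  by rewrite powR_inv1 ?ler0n// invf_le1 ?ler1n ?ltr0Sn.
have [mn|nm] := leqP m n.
  rewrite (sum_split mn) lerDr.
  by apply: sumr_ge0 => k _; exact: ltW.
by rewrite big_geq// sumr_ge0// => k _; exact: ltW.
Qed.

(** For time gaps of at least [eta] the kernel tends to [1] as [m] grows, uniformly in [N], since
    the whole product is now a tail. *)
Lemma ker_le_tail : exists2 C3, 0 < C3 & forall m N t eta,
  (forall k, (m <= k)%N -> l k <= 1 / 2) -> 0 < eta -> eta <= t ->
  ker l alpha m N t <= expR (C3 / eta * m.+1%:R `^ (- alpha)).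
Proof.
exists C3 => // m N t eta l2 eta0 et; have t0 : 0 < t by exact: lt_le_trans et.
have l1 k : (m <= k)%N -> l k < 1 by move=> /l2; lra.
apply: (le_trans (ker_expR_sum _ _ l1)); rewrite ler_expR.
apply: (le_trans (tail_sum _ t0 l2)); apply: ler_wpM2r; first exact: powR_ge0.
apply: ler_wpM2l; first exact: ltW.
by rewrite lef_pV2.
Qed.

End KernelBounds.

Section LayerCake.
Context {R : realType}.

Lemma nneseries_lty (u : nat -> R) : (forall k, 0 <= u k) ->
  ((\sum_(0 <= k <oo) (u k)%:E < +oo)%E <->
   exists B, forall K, \sum_(0 <= k < K) u k <= B).
Proof.
move=> u0; have u0' k : (0 <= k)%N -> true -> (0%:E <= (u k)%:E)%E by move=> _ _; rewrite lee_fin.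
have s0 : (0 <= \sum_(0 <= k <oo) (u k)%:E)%E by apply: nneseries_ge0.
split=> [fin|[B HB]].
  exists (fine (\sum_(0 <= k <oo) (u k)%:E)%E) => K.
  rewrite -lee_fin fineK; last by rewrite ge0_fin_numE.
  by rewrite -sumEFin; exact: nneseries_lim_ge.
apply: (@le_lt_trans _ _ B%:E); last exact: ltry.
apply: lime_le; first exact: is_cvg_nneseries.
by apply: nearW => K; rewrite /= sumEFin lee_fin.
Qed.

(** Counting from [1] gives at most [z], and counting from [0], as in [count_ge], at least [z]: no
    rounding error enters the layer sums. *)
Lemma count_le (z : R) G : 0 <= z -> \sum_(1 <= d < G) (d%:R <= z)%R%:R <= z.
Proof.
move=> z0; suff : \sum_(1 <= d < G) (d%:R <= z)%R%:R <= z /\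
    \sum_(1 <= d < G) (d%:R <= z)%R%:R <= G.-1%:R :> R by case.
elim: G => [|[|G] [IH1 IH2]]; [by rewrite big_geq|by rewrite big_geq|].
rewrite big_nat_recr//=; have [Gz|Gz] := leP G.+1%:R z; last by rewrite addr0; split => //; rewrite (le_trans IH2)// ler_nat.
have : \sum_(1 <= d < G.+1) (d%:R <= z)%R%:R + 1 <= G.+1%:R :> R by rewrite -natr1 lerD2r.
by move=> H; split => //; exact: le_trans H Gz.
Qed.

Lemma count_ge (z : R) G : z <= G%:R -> z <= \sum_(0 <= d < G) (d%:R <= z)%R%:R.
Proof.
suff : Num.min z G%:R <= \sum_(0 <= d < G) (d%:R <= z)%R%:R.
  by move=> H /min_idPl zG; rewrite zG in H.
elim: G => [|G IH]; first by rewrite big_geq// ge_min lexx orbT.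
rewrite big_nat_recr//=; have [Gz|zG] := leP G%:R z.
  by rewrite (min_idPr Gz) in IH; rewrite ge_min -natr1 lerD2r IH orbT.
by rewrite (min_idPl (ltW zG)) in IH; rewrite ge_min addr0 IH.
Qed.

Variable alpha : R.
Hypothesis alpha_gt0 : 0 < alpha.

Local Notation y k := (k.+1%:R `^ (- alpha) : R).

Lemma y_gt0 k : 0 < y k. Proof. by rewrite powR_gt0. Qed.

Lemma y_le j k : (j <= k)%N -> y k <= y j.
Proof.
move=> jk; rewrite !powRN lef_pV2 ?posrE ?powR_gt0//.
by apply: ge0_ler_powR; rewrite ?nnegrE ?ler0n ?(ltW alpha_gt0)// ler_nat.
Qed.

Lemma y_small t : 0 < t -> exists k, y k < t.
Proof.
move=> t0; have p0 : 0 <= (t^-1) `^ (alpha^-1) by exact: powR_ge0.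
have [N HN] : exists N : nat, (t^-1) `^ (alpha^-1) < N.+1%:R.
  exists (Num.bound ((t^-1) `^ (alpha^-1))).
  by apply: (lt_trans (archi_boundP p0)); rewrite ltr_nat.
exists N; rewrite powRN -[t]invrK ltf_pV2 ?posrE ?invr_gt0 ?powR_gt0//.
have -> : t^-1 = ((t^-1) `^ (alpha^-1)) `^ alpha.
  by rewrite -powRrM mulVf ?gt_eqF// powRr1// invr_ge0 ltW.
have := gt0_ltr_powR alpha_gt0 => /(_ ((t^-1) `^ (alpha^-1)) N.+1%:R); apply => //.
by rewrite nnegrE.
Qed.

Lemma level t : 0 < t -> t <= 1 -> exists n, y n.+1 <= t /\ t <= y n.
Proof.
move=> t0 t1; have ex : exists k, y k.+1 <= t.
  by have [k yk] := y_small t0; exists k; rewrite (le_trans _ (ltW yk))// y_le.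
have [[|n] Hn minn] := ex_minnP ex; first by exists 0%N; rewrite powR1.
exists n.+1; split => //; rewrite leNgt; apply/negP => /ltW /minn.
by rewrite ltnn.
Qed.

(* [f] is dominated by the sum of the [hh k] over the [k] with [t <= y k], and at
   most [G * y k] points of the grid lie below [y k]. *)
Lemma layer_upper (f : R -> R) (hh : nat -> R) (B : R) :
  (forall k, 0 <= hh k) ->
  (forall K, \sum_(0 <= k < K) hh k * y k <= B) ->
  (forall t n, 0 < t -> t <= 1 -> y n.+1 <= t -> t <= y n -> f t <= \sum_(0 <= k < n.+1) hh k) ->
  forall G, \sum_(1 <= d < G) f (d%:R / G%:R) <= G%:R * B.
Proof.
move=> h0 hB fh G; have [G0|G0] := posnP G; first by rewrite G0 big_geq// mul0r.
have G0' : (0 : R) < G%:R by rewrite ltr0n.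
have [K yK] : exists K, y K < G%:R^-1 by apply: y_small; rewrite invr_gt0.
apply: (@le_trans _ _ (\sum_(1 <= d < G) \sum_(0 <= k < K) hh k * (d%:R <= G%:R * y k)%R%:R)).
  rewrite big_seq [leRHS]big_seq; apply: ler_sum => d; rewrite mem_index_iota => /andP[d1 dG].
  have t0 : 0 < d%:R / G%:R :> R by rewrite divr_gt0// ltr0n.
  have t1 : d%:R / G%:R <= 1 :> R by rewrite ler_pdivrMr// mul1r ler_nat ltnW.
  have [n [Hn1 Hn2]] := level t0 t1.
  apply: (le_trans (fh _ n t0 t1 Hn1 Hn2)).
  have nK : (n.+1 <= K)%N.
    rewrite ltnNge; apply/negP => Kn; have := y_le Kn.
    have : G%:R^-1 <= d%:R / G%:R :> R by rewrite -[leLHS]mul1r ler_wpM2r ?invr_ge0 ?ler1n// ltW.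
    lra.
  rewrite [leRHS](big_cat_nat (leq0n _) nK)/= -[leLHS]addr0; apply: lerD; last first.
    by apply: sumr_ge0 => k _; rewrite mulr_ge0// ler0n.
  rewrite big_seq [leRHS]big_seq; apply: ler_sum => k; rewrite mem_index_iota => /andP[_ kn].
  suff -> : (d%:R <= G%:R * y k) = true by rewrite mulr1.
  by rewrite mulrC -ler_pdivrMr// (le_trans Hn2)// y_le.
rewrite exchange_big/=; apply: le_trans (ler_wpM2l (ltW G0') (hB K)).
rewrite mulr_sumr; apply: ler_sum => k _; rewrite -mulr_sumr mulrCA ler_wpM2l//.
by apply: count_le; rewrite mulr_ge0 ?ler0n// ltW// y_gt0.
Qed.

(** The layers above the last [k < K] with [t <= y k] vanish at [t], and all those up to it sum to
    at most [f t]. The point [d = 0] is kept, so that at least [G * y k] grid points lie below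
    [y k]. *)
Lemma layer_lower (f : R -> R) (hh : nat -> R) K :
  (forall k, 0 <= hh k) -> (forall t, 0 <= f t) ->
  (forall t n, (n < K)%N -> 0 <= t -> t <= y n -> \sum_(0 <= k < n.+1) hh k <= f t) ->
  forall G, (0 < G)%N ->
  G%:R * (\sum_(0 <= k < K) hh k * y k) <= \sum_(0 <= d < G) f (d%:R / G%:R).
Proof.
move=> h0 f0 fh G G0; have G0' : (0 : R) < G%:R by rewrite ltr0n.
apply: (@le_trans _ _ (\sum_(0 <= d < G) \sum_(0 <= k < K) hh k * (d%:R <= G%:R * y k)%R%:R)).
  rewrite exchange_big/= mulr_sumr; apply: ler_sum => k _.
  rewrite -mulr_sumr mulrCA ler_wpM2l//; apply: count_ge.
  rewrite ger_pMr// -[leRHS](powRr0 k.+1%:R) powRr0 powRN invf_le1 ?powR_gt0//.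
  by rewrite -[leLHS](powRr0 k.+1%:R) ler_powR ?ler1n// ltW.
apply: ler_sum => d _.
have -> : \sum_(0 <= k < K) hh k * (d%:R <= G%:R * y k)%R%:R =
    \sum_(0 <= k < K) hh k * (d%:R / G%:R <= y k)%R%:R.
  by apply: eq_bigr => k _; rewrite ler_pdivrMr// [_ * G%:R]mulrC.
have t0 : 0 <= d%:R / G%:R :> R by rewrite divr_ge0.
elim: K fh => [|K IH] fh; first by rewrite big_geq.
have [tK|tK] := leP (d%:R / G%:R) (y K).
  apply: le_trans (fh _ K (ltnSn K) t0 tK); apply: ler_sum => k _.
  by rewrite ler_piMr// lern1 leq_b1.
rewrite big_nat_recr//= (lt_geF tK) mulr0 addr0; apply: IH => t n nK; apply: fh.
exact: ltnW.
Qed.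


Lemma harmonic_ge n K : (n <= K)%N -> ln K.+1%:R - ln n.+1%:R <= \sum_(n <= k < K) k.+1%:R^-1 :> R.
Proof.
move=> nK; rewrite -(telescope_sumr (fun k => ln k.+1%:R) nK); apply: ler_sum => k _.
have := @ln_sub_ge R k.+2%:R k.+1%:R (ltr0Sn _ _) (ltr0Sn _ _).
rewrite -[X in X / _]opprB mulNr (_ : k.+2%:R - k.+1%:R = 1); first by rewrite mul1r lerNl opprB.
by rewrite -natrB// subSn// subnn.
Qed.

Lemma harmonic_le n K : (n <= K)%N -> \sum_(n <= k < K) k.+2%:R^-1 <= ln K.+1%:R - ln n.+1%:R :> R.
Proof.
move=> nK; rewrite -(telescope_sumr (fun k => ln k.+1%:R) nK); apply: ler_sum => k _.
have := @ln_sub_ge R k.+1%:R k.+2%:R (ltr0Sn _ _) (ltr0Sn _ _).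
rewrite (_ : k.+2%:R - k.+1%:R = 1); first by rewrite mul1r.
by rewrite -natrB// subSn// subnn.
Qed.

Lemma harmonic_unbounded n (B : R) : exists2 K, (n <= K)%N & B < \sum_(n <= k < K) k.+1%:R^-1.
Proof.
pose x := expR (B + ln n.+1%:R); have x0 : 0 < x by exact: expR_gt0.
exists (maxn n (Num.bound x)); first exact: leq_maxl.
apply: lt_le_trans (harmonic_ge (leq_maxl _ _)); rewrite ltrBrDr.
rewrite -[B + _]expRK ltr_ln ?posrE ?ltr0Sn//.
apply: (lt_trans (archi_boundP (ltW x0))).
by rewrite ltr_nat ltnS leq_maxr.
Qed.

End LayerCake.

Section KernelSums.
Context {R : realType}.
Variables (l : nat -> R) (M0 M1 alpha : R).
Hypothesis l_gt0 : forall n, 0 < l n.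
Hypothesis M0_gt0 : 0 < M0.
Hypothesis l_bnd : forall n, M0 / n.+1%:R <= l n <= M1 / n.+1%:R.
Hypothesis alpha_gt0 : 0 < alpha.

Local Notation S n := (\sum_(k < n) l k).
Local Notation y k := (k.+1%:R `^ (- alpha) : R).

Let M1_gt0 : 0 < M1.
Proof. by have := l_bnd 0; rewrite !divr1 => /andP[_]; exact: lt_le_trans. Qed.

Definition covering_term b k := expR (S k.+1) / k.+1%:R `^ (1 + b).

Lemma covering_term_ge0 b k : 0 <= covering_term b k.
Proof. by rewrite /covering_term divr_ge0 ?expR_ge0 ?powR_ge0. Qed.

Lemma covering_seriesP b : (covering_series l b < +oo)%E <->
  exists B, forall K, \sum_(0 <= k < K) covering_term b k <= B.
Proof. exact: nneseries_lty (covering_term_ge0 b). Qed.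

Lemma covering_series_mono b b' : b <= b' ->
  (covering_series l b < +oo)%E -> (covering_series l b' < +oo)%E.
Proof.
move=> bb' /covering_seriesP[B HB]; apply/covering_seriesP; exists B => K.
apply: le_trans (HB K); apply: ler_sum => k _; rewrite /covering_term.
rewrite ler_wpM2l ?expR_ge0// lef_pV2 ?posrE ?powR_gt0//.
by rewrite ler_powR ?ler1n// lerD2l.
Qed.

(** With [a = alpha * s], the order of magnitude of [u^(-s) * ker u] at [u = (k + 1)^(-alpha)]; its
    increments are the layer heights. *)
Definition weight (a : R) k := expR (S k.+1) * k.+1%:R `^ a.

Definition increment (a : R) k := if k is k'.+1 then weight a k'.+1 - weight a k' else weight a 0.

Lemma sum_increment a n : \sum_(0 <= k < n.+1) increment a k = weight a n.
Proof.
elim: n => [|n IH]; first by rewrite big_nat1.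
by rewrite big_nat_recr//= IH addrC subrK.
Qed.

Lemma weight_ge0 a k : 0 <= weight a k.
Proof. by rewrite mulr_ge0 ?expR_ge0 ?powR_ge0. Qed.

Lemma increment_ge0 a k : 0 <= a -> 0 <= increment a k.
Proof.
move=> a0; case: k => [|k] /=; first exact: weight_ge0.
rewrite subr_ge0 /weight; apply: ler_pM; rewrite ?expR_ge0 ?powR_ge0//.
  by rewrite ler_expR [leRHS]big_ord_recr/= lerDl ltW.
by apply: ge0_ler_powR; rewrite ?nnegrE ?ler0n// ler_nat.
Qed.

(** A discrete derivative: the increment is [1 - exp (- z)] times [weight a k], with [z] at most
    [(M1 + 2 * a) / (k + 1)]. Times [y k], this is the covering term of exponent [alpha - a]. The
    extra [1] in the constant serves [k = 0], where the increment is the whole weight. *)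
Lemma increment_le a k : 0 <= a ->
  increment a k * y k <= (M1 + 2 * a + 1) * covering_term (alpha - a) k.
Proof.
move=> a0; have k0 : (0 : R) < k.+1%:R by rewrite ltr0Sn.
suff H : increment a k <= (M1 + 2 * a + 1) / k.+1%:R * weight a k.
  apply: (le_trans (ler_wpM2r (powR_ge0 _ _) H)).
  rewrite le_eqVlt; apply/orP; left; apply/eqP.
  rewrite /covering_term /weight -powRN.
  rewrite (_ : - (1 + (alpha - a)) = -1 + (a + - alpha)); last by ring.
  rewrite !powRD ?(gt_eqF k0) ?implybT// powR_inv1 ?ler0n//.
  by ring.
case: k k0 => [|k] k0 /=.
  by rewrite divr1 ler_peMl ?weight_ge0//; have := M1_gt0; lra.
have k0' : (0 : R) < k.+1%:R by rewrite ltr0Sn.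
set W := weight a k.+1; have W0 : 0 <= W by exact: weight_ge0.
have -> : weight a k = expR (- (l k.+1 + a * (ln k.+2%:R - ln k.+1%:R))) * W.
  rewrite /W /weight !powRE// mulrCA -!expRD [in RHS]big_ord_recr/=.
  by congr expR; ring.
set z := l k.+1 + _.
have -> : W - expR (- z) * W = (1 - expR (- z)) * W by ring.
rewrite ler_wpM2r//.
have Hz : 1 - expR (- z) <= z by have := expR_ge1Dx (- z); lra.
apply: (le_trans Hz).
have Hl : l k.+1 <= M1 / k.+2%:R by have /andP[] := l_bnd k.+1.
have Hln : ln k.+2%:R - ln k.+1%:R <= k.+1%:R^-1 :> R.
  have := @harmonic_ge R k k.+1 (leqnSn k); by rewrite big_nat1.
have Hk : k.+1%:R^-1 <= 2 / k.+2%:R :> R.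
  by rewrite ler_pdivlMr// mulrC ler_pdivrMr// natrSS_le.
have H1 : a * (ln k.+2%:R - ln k.+1%:R) <= a * (2 / k.+2%:R).
  by rewrite ler_wpM2l// (le_trans Hln).
have H2 : 0 < k.+2%:R^-1 :> R by rewrite invr_gt0.
rewrite /z; move: Hl H1 H2; set v := k.+2%:R^-1; set u := a * (ln _ - _) => Hl H1 H2; lra.
Qed.

Lemma ker_pow_sum s : 0 <= s -> (covering_series l (alpha * (1 - s)) < +oo)%E ->
  exists B, forall m N G, (forall k, (m <= k)%N -> l k <= 1 / 2) ->
    \sum_(1 <= d < G) (d%:R / G%:R) `^ (- s) * ker l alpha m N (d%:R / G%:R) <= G%:R * B.
Proof.
move=> s0 /covering_seriesP[B0 HB0].
have [C2 C20 HC2] := @ker_le R l M0 M1 alpha l_gt0 M0_gt0 l_bnd alpha_gt0.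
pose a := alpha * s; have a0 : 0 <= a by rewrite mulr_ge0// ltW.
(* [2^a] pays for the variation of [t^(-s)] between [y n.+1] and [y n]. *)
pose D := C2 * 2 `^ a.
have D0 : 0 <= D by rewrite mulr_ge0 ?powR_ge0// ltW.
exists (D * ((M1 + 2 * a + 1) * B0)) => m N G l2.
have ker1 t : 1 <= ker l alpha m N t by apply: ker_ge1 => // k /l2; lra.
apply: (@layer_upper R alpha alpha_gt0 (fun t => t `^ (- s) * ker l alpha m N t)
  (fun k => D * increment a k)).
- by move=> k; rewrite mulr_ge0// increment_ge0.
- move=> K; rewrite (eq_bigr (fun k => D * (increment a k * y k))); last by move=> k _; rewrite mulrA.
  rewrite -mulr_sumr ler_wpM2l//.
  apply: (@le_trans _ _ (\sum_(0 <= k < K) (M1 + 2 * a + 1) * covering_term (alpha - a) k)).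
    by apply: ler_sum => k _; exact: increment_le.
  rewrite -mulr_sumr ler_wpM2l//; first by have := M1_gt0; lra.
  by have := HB0 K; rewrite mulrBr mulr1.
- move=> t n t0 t1 tn1 tn; rewrite -mulr_sumr sum_increment.
  have H1 : ker l alpha m N t <= C2 * expR (S n.+1) by exact: HC2.
  have H2 : t `^ (- s) <= 2 `^ a * n.+1%:R `^ a.
    have p1 : (0 : R) < 2 * n.+1%:R by rewrite mulr_gt0.
    have -> : 2 `^ a * n.+1%:R `^ a = ((2 * n.+1%:R) `^ (- a))^-1 :> R.
      by rewrite powRN invrK powRM ?ler0n.
    rewrite [t `^ _]powRN lef_pV2 ?posrE ?powR_gt0//.
    apply: (@le_trans _ _ ((n.+2%:R `^ (- alpha)) `^ s)); last first.
      by apply: ge0_ler_powR => //; rewrite ?nnegrE ?powR_ge0// ltW.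
    rewrite -powRrM mulNr -/a !powRN lef_pV2 ?posrE ?powR_gt0//.
    apply: ge0_ler_powR => //; rewrite ?nnegrE ?ler0n ?(ltW p1)//.
    exact: natrSS_le.
  rewrite /D /weight.
  have -> : C2 * 2 `^ a * (expR (S n.+1) * n.+1%:R `^ a) =
    (2 `^ a * n.+1%:R `^ a) * (C2 * expR (S n.+1)) by ring.
  by apply: ler_pM => //; [exact: powR_ge0|exact: le_trans ler01 (ker1 t)].
Qed.

Lemma bounded_sum_tail (u : nat -> R) B e : (forall k, 0 <= u k) ->
  (forall K, \sum_(0 <= k < K) u k <= B) -> 0 < e ->
  exists n, forall n' K, (n <= n')%N -> \sum_(n' <= k < K) u k <= e.
Proof.
move=> u0 uB e0; apply: contrapT => /forallNP H.
have step n : exists2 n', (n <= n')%N & \sum_(0 <= k < n) u k + e < \sum_(0 <= k < n') u k.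
  have /existsNP[n' /existsNP[K /not_implyP[nn' /negP]]] := H n.
  rewrite -ltNge => eK; have [n'K|Kn'] := leqP n' K; last first.
    by rewrite big_geq ?(ltnW Kn')// in eK; move: eK; lra.
  exists K; first exact: leq_trans n'K.
  rewrite [ltRHS](big_cat_nat (leq0n n') n'K)/= [X in _ < X + _](big_cat_nat (leq0n n) nn')/=.
  have : 0 <= \sum_(n <= k < n') u k by exact: sumr_ge0.
  by lra.
have iterate j : exists n, j%:R * e <= \sum_(0 <= k < n) u k.
  elim: j => [|j [n IH]]; first by exists 0%N; rewrite mul0r big_geq.
  have [n' _ Hn'] := step n; exists n'; rewrite -natr1 mulrDl mul1r.
  by apply: ltW; apply: le_lt_trans Hn'; rewrite lerD2r.
have [n Hn] := iterate (Num.bound (B / e)).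
have B0 : 0 <= B / e by rewrite divr_ge0 ?(ltW e0)//; have := uB 0; rewrite big_geq.
have := archi_boundP B0; rewrite ltr_pdivrMr// => H'.
by have := uB n; lra.
Qed.

(** This makes the variance small. For short gaps [ker <= C2 * exp (S n)], and the layers beyond
    [n0] are a tail of the convergent series. For longer gaps [ker_le_tail] applies. Neither [C2]
    nor [n0] depends on [m], so [m0] can be chosen last. *)
Lemma ker_sub1_sum e : (covering_series l alpha < +oo)%E -> 0 < e ->
  exists m0, forall m N G, (m0 <= m)%N -> (forall k, (m <= k)%N -> l k <= 1 / 2) ->
    \sum_(1 <= d < G) (ker l alpha m N (d%:R / G%:R) - 1) <= G%:R * e.
Proof.
move=> /covering_seriesP[B0 HB0] e0.
have [C2 C20 HC2] := @ker_le R l M0 M1 alpha l_gt0 M0_gt0 l_bnd alpha_gt0.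
have [C3 C30 HC3] := @ker_le_tail R l M0 M1 alpha l_gt0 l_bnd alpha_gt0.
have inc0 k : 0 <= C2 * (increment 0 k * y k).
  by rewrite !mulr_ge0 ?increment_ge0 ?powR_ge0// ltW.
have [n1 Hn1] : exists n, forall n' K, (n <= n')%N -> \sum_(n' <= k < K) C2 * (increment 0 k * y k) <= e / 4.
  apply: (@bounded_sum_tail _ (C2 * ((M1 + 1) * B0))) => //; last by rewrite divr_gt0.
  move=> K; rewrite -mulr_sumr ler_wpM2l ?(ltW C20)//.
  apply: (@le_trans _ _ (\sum_(0 <= k < K) (M1 + 1) * covering_term alpha k)).
    apply: ler_sum => k _; have := @increment_le 0 k (lexx 0).
    by rewrite mulr0 addr0 subr0.
  by rewrite -mulr_sumr ler_wpM2l//; have := M1_gt0; lra.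
(* Otherwise the covering terms would eventually exceed a multiple of [1 / (k + 1)], and their
   series would diverge. *)
have [n0 n10 Hn0] : exists2 n0, (n1 <= n0)%N & C2 * weight 0 n0 * y n0 <= e / 4.
  apply: contrapT => /forall2NP H.
  have H' k : (n1 <= k)%N -> e / 4 / C2 * k.+1%:R^-1 <= covering_term alpha k.
    move=> nk; have [//|/negP] := H k; rewrite -ltNge => Hk.
    have k0 : (0 : R) < k.+1%:R by rewrite ltr0Sn.
    rewrite ler_pdivrMr// ler_pdivrMr// (le_trans (ltW Hk))// le_eqVlt; apply/orP; left; apply/eqP.
    rewrite /weight /covering_term powRr0 mulr1 powRD ?(gt_eqF k0) ?implybT// powRr1 ?ler0n// powRN.
    by field; rewrite !gt_eqF// powR_gt0.
  have [K nK HK] := @harmonic_unbounded R n1 (B0 / (e / 4 / C2)).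
  have ee : 0 < e / 4 / C2 by rewrite !divr_gt0.
  move: HK; rewrite ltr_pdivrMr// mulrC mulr_sumr => HK.
  suff : \sum_(n1 <= k < K) e / 4 / C2 * k.+1%:R^-1 <= B0 by lra.
  apply: le_trans (HB0 K); rewrite [leRHS](big_cat_nat (leq0n n1) nK)/= -[leLHS]add0r.
  apply: lerD; first by apply: sumr_ge0 => k _; exact: covering_term_ge0.
  by rewrite big_seq [leRHS]big_seq; apply: ler_sum => k; rewrite mem_index_iota => /andP[/H'].
pose eta := y n0; have eta0 : 0 < eta by rewrite powR_gt0.
have [m0 Hm0] : exists m0, forall m, (m0 <= m)%N -> C3 / eta * y m <= ln (1 + e / 2).
  have ln0 : 0 < ln (1 + e / 2) by rewrite ln_gt0; lra.
  have Q0 : 0 < ln (1 + e / 2) / (C3 / eta) by rewrite !divr_gt0.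
  have [m0 Hm0] := @y_small R alpha alpha_gt0 _ Q0; exists m0 => m mm0.
  rewrite mulrC -ler_pdivlMr ?divr_gt0// (le_trans _ (ltW Hm0))//.
  exact: y_le.
exists m0 => m N G mm0 l2.
have ker1 t : 1 <= ker l alpha m N t by apply: ker_ge1 => // k /l2; lra.
pose f t := if t < eta then ker l alpha m N t - 1 else 0.
(* All layers up to [n0] are merged into one of height [C2 * weight 0 n0] at level [y n0 = eta],
   from which on [f] vanishes. *)
pose hh k := if (k < n0)%N then 0 else if k == n0 then C2 * weight 0 n0 else C2 * increment 0 k.
have hsum n : (n0 <= n)%N -> \sum_(0 <= k < n.+1) hh k = C2 * weight 0 n.
  elim: n => [|n IH].
    by rewrite leqn0 => /eqP n00; rewrite big_nat1 /hh n00.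
  rewrite leq_eqVlt => /predU1P[<-|nn]; rewrite big_nat_recr//=.
    rewrite /hh ltnn eqxx big_seq big1 ?add0r// => k; rewrite mem_index_iota => /andP[_ ->] //.
  rewrite IH// /hh ltnNge (ltnW nn)/= gtn_eqF//= -mulrDr; congr (_ * _).
  by rewrite addrC subrK.
have hh0 k : 0 <= hh k.
  rewrite /hh; case: ifP => // _; case: ifP => _; rewrite mulr_ge0 ?(ltW C20) ?weight_ge0//.
  exact: increment_ge0.
have part1 : \sum_(1 <= d < G) f (d%:R / G%:R) <= G%:R * (e / 2).
  apply: (@layer_upper R alpha alpha_gt0 f hh) => //.
  - move=> K; have -> : e / 2 = e / 4 + e / 4 by lra.
    have pos k : 0 <= hh k * y k by rewrite mulr_ge0 ?powR_ge0.
    apply: (@le_trans _ _ (\sum_(0 <= k < n0.+1 + K) hh k * y k)).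
      have le1 : (K <= n0.+1 + K)%N by rewrite leq_addl.
      by rewrite [leRHS](big_cat_nat (leq0n K) le1)/= lerDl sumr_ge0.
    have le2 : (n0.+1 <= n0.+1 + K)%N by rewrite leq_addr.
    rewrite (big_cat_nat (leq0n _) le2)/=; apply: lerD.
      rewrite big_nat_recr//= big_seq big1 ?add0r; last first.
        by move=> k; rewrite mem_index_iota => /andP[_ kn]; rewrite /hh kn mul0r.
      by rewrite /hh ltnn eqxx.
    apply: le_trans (Hn1 n0.+1 (n0.+1 + K)%N _); last exact: leqW.
    rewrite big_seq [leRHS]big_seq; apply: ler_sum => k; rewrite mem_index_iota => /andP[nk _].
    by rewrite /hh ltnNge (ltnW nk)/= gtn_eqF// mulrA.
  - move=> t n t0 t1 tn1 tn; rewrite /f; case: ifP => te; last by apply: sumr_ge0.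
    have nn : (n0 <= n)%N.
      rewrite leqNgt; apply/negP => nn; have := @y_le R alpha alpha_gt0 _ _ nn.
      by rewrite -/eta; lra.
    rewrite hsum// /weight powRr0 mulr1; have := HC2 m N n.+1 t l2 tn1; lra.
apply: (@le_trans _ _ (\sum_(1 <= d < G) (f (d%:R / G%:R) + e / 2))).
  apply: ler_sum => d _; rewrite /f; case: ifP => te; first by lra.
  have := HC3 m N (d%:R / G%:R) eta l2 eta0; rewrite leNgt te => /(_ isT) H.
  rewrite add0r lerBlDr; apply: (le_trans H).
  have -> : e / 2 + 1 = expR (ln (1 + e / 2)) by rewrite lnK ?posrE; lra.
  by rewrite ler_expR Hm0.
rewrite big_split/= sumr_const_nat.
have : (e / 2) *+ (G - 1) <= G%:R * (e / 2).
  by rewrite -mulr_natl ler_wpM2r ?ler_nat ?leq_subr// divr_ge0// ltW.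
lra.
Qed.

Lemma ker_sum_unbounded m kappa : ~ (covering_series l alpha < +oo)%E ->
  (forall k, (m <= k)%N -> l k < 1) ->
  exists N, forall G, (0 < G)%N -> kappa * G%:R <= \sum_(d < G) ker l alpha m N (d%:R / G%:R).
Proof.
move=> /covering_seriesP div l1.
have [C1 C10 HC1] := @ker_ge_unif R l M0 M1 alpha l_gt0 M0_gt0 l_bnd alpha_gt0.
pose c := expR (- S m - C1); have c0 : 0 < c by exact: expR_gt0.
(* [M0 / (1 + M1)] comes from [1 - exp (- l k) >= l k / (1 + l k)], where [l k] is at least
   [M0 / (k + 1)] above and at most [M1] below the bar. *)
pose c' := c * (M0 / (1 + M1)); have c'0 : 0 < c' by rewrite mulr_gt0// divr_gt0//; have := M1_gt0; lra.
have [N HN] : exists N, kappa / c' < \sum_(0 <= k < N) covering_term alpha k.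
  apply: contrapT => /forallNP H; apply: div; exists (kappa / c') => K.
  by have /negP := H K; rewrite -leNgt.
exists N => G G0.
pose hh k := c * (expR (S k.+1) - expR (S k)).
have hh0 k : 0 <= hh k.
  by rewrite mulr_ge0 ?(ltW c0)// subr_ge0 ler_expR [leRHS]big_ord_recr/= lerDl ltW.
have ker0 t : 0 <= ker l alpha m N t by apply: le_trans ler01 _; exact: ker_ge1.
rewrite -(big_mkord xpredT (fun d => ker l alpha m N (d%:R / G%:R))).
apply: le_trans (@layer_lower R alpha alpha_gt0 (ker l alpha m N) hh N hh0 ker0 _ G G0).
  rewrite mulrC ler_wpM2l//.
  apply: (@le_trans _ _ (\sum_(0 <= k < N) c' * covering_term alpha k)).
    by rewrite -mulr_sumr mulrC -ler_pdivrMr// ltW.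
  apply: ler_sum => k _; rewrite /hh /c' -!mulrA ler_wpM2l ?(ltW c0)//.
  have k0 : (0 : R) < k.+1%:R by rewrite ltr0Sn.
  have -> : expR (S k.+1) - expR (S k) = expR (S k.+1) * (1 - expR (- l k)).
    by rewrite mulrBr mulr1 -expRD [in X in _ = _ - expR (X + _)]big_ord_recr/= addrK.
  rewrite /covering_term powRD ?(gt_eqF k0) ?implybT// powRr1 ?ler0n// powRN invfM.
  have -> : M0 * ((1 + M1)^-1 * (expR (S k.+1) * (k.+1%:R^-1 * (k.+1%:R `^ alpha)^-1))) =
    expR (S k.+1) * (M0 / k.+1%:R / (1 + M1)) * (k.+1%:R `^ alpha)^-1 by ring.
  apply: ler_wpM2r; first by rewrite invr_ge0 powR_ge0.
  apply: ler_wpM2l; first exact: expR_ge0.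
  have /andP[lb ub] := l_bnd k; have lk := l_gt0 k.
  have lM : l k <= M1.
    apply: (le_trans ub); rewrite ler_pdivrMr// ler_peMr ?ler1n// ltW//.
  rewrite ler_pdivrMr; last by lra.
  have e1 : expR (- l k) * (1 + l k) <= 1.
    by rewrite expRN mulrC ler_pdivrMr ?expR_gt0// mul1r expR_ge1Dx.
  have e2 : 0 < expR (- l k) by exact: expR_gt0.
  have e3 : expR (- l k) <= 1 by rewrite -expR0 ler_expR; lra.
  apply: (le_trans lb); nra.
move=> t n nN t0 tn; rewrite -mulr_sumr.
have -> : \sum_(0 <= k < n.+1) (expR (S k.+1) - expR (S k)) = expR (S n.+1) - expR (S 0).
  exact: (telescope_sumr (fun k => expR (S k))).
have := HC1 m N n.+1 t l1 nN t0 tn; rewrite -/c => H.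
by apply: le_trans H; rewrite ler_wpM2l ?(ltW c0)// lerBlDr lerDl expR_ge0.
Qed.

(** If [exp (S k)] were eventually at most [C * k^b], the terms at [b'] would be at most of order
    [k^(-1 - (b' - b))], which is summable. Divergence thus supplies arbitrarily large favourable
    scales [N], though not all large [N]. *)
Lemma growth b b' C n1 : b < b' -> ~ (covering_series l b' < +oo)%E ->
  exists2 N, (n1 <= N)%N & C * N.+1%:R `^ b < expR (S N.+1).
Proof.
move=> bb' /covering_seriesP div; apply: contrapT => /forall2NP H; apply: div.
have H' k : (n1 <= k)%N -> covering_term b' k <= `|C| * k.+1%:R `^ (- 1 - (b' - b)).
  move=> nk; have [//|/negP] := H k; rewrite -leNgt => Hk.
  have k0 : (0 : R) < k.+1%:R by rewrite ltr0Sn.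
  rewrite (_ : -1 - (b' - b) = b + - (1 + b')); last by ring.
  rewrite powRD ?(gt_eqF k0) ?implybT// mulrA /covering_term powRN ler_wpM2r ?invr_ge0 ?powR_ge0//.
  by apply: (le_trans Hk); rewrite ler_wpM2r ?powR_ge0// ler_norm.
exists (\sum_(0 <= k < n1) covering_term b' k + `|C| * (2 `^ (1 + (b' - b)) / (b' - b) * n1.+1%:R `^ (- (b' - b)))).
move=> K; apply: (@le_trans _ _ (\sum_(0 <= k < n1 + K) covering_term b' k)).
  have le1 : (K <= n1 + K)%N by rewrite leq_addl.
  rewrite [leRHS](big_cat_nat (leq0n K) le1)/= lerDl; apply: sumr_ge0 => k _; exact: covering_term_ge0.
have le2 : (n1 <= n1 + K)%N by rewrite leq_addr.
rewrite (big_cat_nat (leq0n _) le2)/= lerD2l.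
apply: (@le_trans _ _ (\sum_(n1 <= k < n1 + K) `|C| * k.+1%:R `^ (- 1 - (b' - b)))).
  by rewrite big_seq [leRHS]big_seq; apply: ler_sum => k; rewrite mem_index_iota => /andP[/H'].
by rewrite -mulr_sumr ler_wpM2l// sum_powR_tail// subr_gt0.
Qed.

End KernelSums.

(** * Second moments and energy *)

Section FiniteMoments.
Context d (T : measurableType d) (R : realType) (P : probability T R).
Local Notation pr := (pr P).

Lemma integral_linear_indic (r : seq (R * set T)) : (forall p, List.In p r -> measurable p.2) ->
  P.-integrable setT (EFin \o (fun w => \sum_(p <- r) p.1 * \1_(p.2) w)) /\
  (\int[P]_w (\sum_(p <- r) p.1 * \1_(p.2) w)%:E = (\sum_(p <- r) p.1 * pr p.2)%:E)%E.
Proof.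
elim: r => [|[c E] r IH] mr.
  split; last by rewrite big_nil (eq_integral (fun=> 0%E)) ?integral0// => w _; rewrite big_nil.
  by apply: (eq_integrable _ (cst 0%E)) => //; [move=> w _ /=; rewrite big_nil|exact: integrable0].
have [IH1 IH2] : _ /\ _ := IH (fun p pr => mr p (or_intror pr)).
have mE : measurable E by exact: (mr (c, E) (or_introl erefl)).
have i1 : P.-integrable setT (fun w => (\1_E w)%:E).
  by apply: integrable_indic => //; rewrite (le_lt_trans (probability_le1 P mE))// ltry.
have i2 : P.-integrable setT (fun w => c%:E * (\1_E w)%:E)%E by exact: integrableZl.
have e w : ((\sum_(p <- (c, E) :: r) p.1 * \1_(p.2) w)%:E =
    c%:E * (\1_E w)%:E + (\sum_(p <- r) p.1 * \1_(p.2) w)%:E)%E by rewrite big_cons EFinD EFinM.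
split.
  apply: (eq_integrable _ (fun w => c%:E * (\1_E w)%:E + (\sum_(p <- r) p.1 * \1_(p.2) w)%:E)%E) => //.
    by move=> w _ /=; rewrite e.
  exact: integrableD.
rewrite (eq_integral (fun w => c%:E * (\1_E w)%:E + (\sum_(p <- r) p.1 * \1_(p.2) w)%:E)%E)//.
rewrite integralD// IH2 integralZl// integral_indic// setIT big_cons EFinD EFinM/=.
by rewrite -prE.
Qed.

(** Both moment inequalities are pointwise inequalities between finite linear combinations of
    indicators, integrated termwise; a pair [(c, E)] stands for [c] times the indicator of [E]. *)
Lemma pr_linear_le (u : R) E (r : seq (R * set T)) : measurable E ->
  (forall p, List.In p r -> measurable p.2) ->
  (forall w, u * \1_E w <= \sum_(p <- r) p.1 * \1_(p.2) w) ->
  u * pr E <= \sum_(p <- r) p.1 * pr p.2.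
Proof.
move=> mE mr H.
have m1 p : List.In p [:: (u, E)] -> measurable p.2 by move=> [<-|].
have [i1 e1] := integral_linear_indic m1; have [i2 e2] := integral_linear_indic mr.
rewrite big_seq1 in e1; rewrite -lee_fin -e1 -e2.
apply: le_integral => //= w _; by rewrite lee_fin big_seq1.
Qed.

Variables (A : nat -> set T) (n : nat).
Hypothesis mA : forall i, measurable (A i).

Local Notation Z w := (\sum_(i < n) \1_(A i) w : R).

Lemma In_mapE (I J : Type) (f : I -> J) s q : List.In q (map f s) -> exists i, q = f i.
Proof. by elim: s => //= i s IH [<-|/IH//]; exists i. Qed.

Let quad (phi : 'I_n -> 'I_n -> R) : seq (R * set T) :=
  [seq (phi p.1 p.2, A p.1 `&` A p.2) | p : 'I_n * 'I_n].

Let quad_measurable phi p : List.In p (quad phi) -> measurable p.2.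
Proof.
by move=> H; have [q ->] := In_mapE H; exact: measurableI.
Qed.

Let quad_sum phi (g : set T -> R) :
  \sum_(p <- quad phi) p.1 * g p.2 = \sum_(i < n) \sum_(j < n) phi i j * g (A i `&` A j).
Proof. by rewrite big_map big_enum/= pair_bigA. Qed.

Lemma quadratic_markov phi (E : set T) u : measurable E ->
  (forall w, E w -> u <= \sum_(i < n) \sum_(j < n) phi i j * (\1_(A i) w * \1_(A j) w)) ->
  (forall i j, 0 <= phi i j) ->
  u * pr E <= \sum_(i < n) \sum_(j < n) phi i j * pr (A i `&` A j).
Proof.
move=> mE HE phi0; rewrite -(quad_sum phi pr); apply: pr_linear_le => //.
  exact: quad_measurable.
move=> w; rewrite (quad_sum phi (fun B => \1_B w)).
have -> : \sum_(i < n) \sum_(j < n) phi i j * \1_(A i `&` A j) w =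
    \sum_(i < n) \sum_(j < n) phi i j * (\1_(A i) w * \1_(A j) w) :> R.
  by do 2!apply: eq_bigr => ? _; rewrite indicI.
have [Ew|Ew] := pselect (E w); first by rewrite indicE mem_set// mulr1; exact: HE.
rewrite indicE memNset// mulr0; do 2!apply: sumr_ge0 => ? _.
by rewrite mulr_ge0// mulr_ge0.
Qed.

(** Chebyshev's inequality: on [E] the square of [Z - M] is at least [M ^+ 2 / 4]. The list [r] in
    the proof is its expansion into indicators. *)
Lemma second_moment (E : set T) M : measurable E ->
  (forall w, E w -> Z w <= M / 2) -> 0 < M -> \sum_(i < n) pr (A i) = M ->
  M ^+ 2 / 4 * pr E <= \sum_(i < n) \sum_(j < n) pr (A i `&` A j) - M ^+ 2.
Proof.
move=> mE HE M0 HM.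
pose lin : seq (R * set T) := [seq (- (2 * M), A i) | i : 'I_n].
have lin_sum (g : set T -> R) : \sum_(p <- lin) p.1 * g p.2 = \sum_(i < n) - (2 * M) * g (A i).
  by rewrite big_map big_enum.
pose r := quad (fun _ _ => 1) ++ lin ++ [:: (M ^+ 2, setT)].
have -> : \sum_(i < n) \sum_(j < n) pr (A i `&` A j) - M ^+ 2 = \sum_(p <- r) p.1 * pr p.2.
  rewrite /r !big_cat/= big_seq1 lin_sum (quad_sum _ pr) -mulr_sumr HM/= pr_setT mulr1.
  have -> : \sum_(i < n) \sum_(j < n) 1 * pr (A i `&` A j) = \sum_(i < n) \sum_(j < n) pr (A i `&` A j).
    by do 2!apply: eq_bigr => ? _; rewrite mul1r.
  by ring.
apply: pr_linear_le => //.
  move=> p pr_; have [H|H] := List.in_app_or _ _ _ pr_; first exact: quad_measurable H.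
  have [{}H|[<-|//]] := List.in_app_or _ _ _ H; last exact: measurableT.
  by have [i ->] := In_mapE H; exact: mA.
move=> w; rewrite /r !big_cat/= big_seq1 (lin_sum (fun B => \1_B w)) (quad_sum _ (fun B => \1_B w)).
rewrite -mulr_sumr/= indicT mulr1.
have -> : \sum_(i < n) \sum_(j < n) 1 * \1_(A i `&` A j) w = (Z w) ^+ 2 :> R.
  rewrite expr2 mulr_suml; apply: eq_bigr => i _; rewrite mulr_sumr; apply: eq_bigr => j _.
  by rewrite mul1r indicI.
have := HE w; set z := Z w => Hz.
have [Ew|Ew] := pselect (E w); last by rewrite indicE memNset// mulr0; have := sqr_ge0 (z - M); lra.
rewrite indicE mem_set// mulr1; have := Hz Ew => {}Hz.
have : 0 <= (M - z - M / 2) * (M - z + M / 2) by rewrite mulr_ge0//; lra.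
lra.
Qed.

End FiniteMoments.

Section GridSums.
Context {R : realType}.

(** In each row a difference [k >= 1] occurs at most twice, once on either side of the diagonal. *)
Lemma sum_symmetric (g : nat -> R) (D : R) G : (forall k, 0 <= g k) ->
  \sum_(i < G) \sum_(j < G) (if i == j then D else g `|i - j|%N) <=
  G%:R * D + 2 * G%:R * \sum_(1 <= k < G) g k.
Proof.
move=> g0; have -> : G%:R * D + 2 * G%:R * \sum_(1 <= k < G) g k =
    \sum_(i < G) (D + 2 * \sum_(1 <= k < G) g k).
  by rewrite sumr_const card_ord -[RHS]mulr_natl; ring.
apply: ler_sum => i _; rewrite (bigD1 i)//= eqxx lerD2l.
rewrite (bigID (fun j : 'I_G => (j < i)%N))/= mulr2n mulrDl mul1r; apply: lerD.
  apply: (@le_trans _ _ (\sum_(0 <= j < i) g (i - j)%N)).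
    rewrite big_mkord (big_ord_widen_cond G xpredT (fun j => g (i - j)%N)) ?(ltnW (ltn_ord i))//=.
    rewrite big_mkcond [leRHS]big_mkcond/=; apply: ler_sum => j _.
    case: ifP => [/andP[ji jlt]|]; last by case: ifP.
    rewrite jlt eq_sym (negbTE ji); suff -> : `|i - j|%N = (i - j)%N by [].
    by rewrite distnEl// ltnW.
  rewrite big_nat_rev/= add0n.
  rewrite (eq_big_nat _ _ (F2 := fun j => g j.+1)); last first.
    by move=> j /andP[_ ji]; rewrite subKn.
  have -> : \sum_(0 <= j < i) g j.+1 = \sum_(1 <= j < i.+1) g j by rewrite big_add1.
  by rewrite [leRHS](big_cat_nat (ltn0Sn i) (ltn_ord i))//= lerDl sumr_ge0.
apply: (@le_trans _ _ (\sum_(i.+1 <= j < G) g (j - i)%N)).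
  rewrite -(big_mkord (fun j => (j != i :> nat) && ~~ (j < i)%N) (fun j => if i == j :> nat then D else g `|i - j|%N)).
  rewrite (big_cat_nat (n := i.+1) _ (ltn_ord i))//= big_nat_cond big_pred0 ?add0r; last first.
    move=> j; rewrite ltnS; apply/negP => /andP[/andP[_ ji] /andP[jNi]]; rewrite -leqNgt => ij.
    by move: jNi; rewrite eqn_leq ji ij.
  rewrite big_mkcond/=; rewrite big_seq [leRHS]big_seq; apply: ler_sum => j.
  rewrite mem_index_iota => /andP[ij _]; rewrite gtn_eqF// (ltnNge j) (ltnW ij)/= ltn_eqF//.
  by rewrite distnEr// ltnW.
have -> : \sum_(i.+1 <= j < G) g (j - i)%N = \sum_(1 <= j < G - i) g j.
  by rewrite -(add1n i) big_addn; apply: eq_bigr => j _; rewrite addnK.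
have le1 : (G - i <= G)%N by exact: leq_subr.
have le2 : (1 <= G - i)%N by rewrite subn_gt0.
by rewrite [leRHS](big_cat_nat le2 le1)/= lerDl sumr_ge0.
Qed.

End GridSums.

Section EnergyMethod.
Context {R : realType}.

(* Cauchy-Schwarz against a cover, in the form [2 z <= theta r + z^2 / (theta r)] *)
Lemma energy_cover (G K : nat) (a : 'I_G -> R) (phi : 'I_G -> 'I_G -> R)
    (kap : 'I_G -> nat) (r : nat -> R) (M L : R) :
  0 < M -> 0 < L -> (forall i, 0 <= a i) -> (forall i j, 0 <= phi i j) ->
  (forall i, a i != 0 -> (kap i < K)%N) ->
  (forall k, (k < K)%N -> 0 < r k) ->
  (forall i j, a i != 0 -> a j != 0 -> kap i = kap j -> (r (kap i))^-1 <= phi i j) ->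
  M / 2 <= \sum_i a i ->
  \sum_i \sum_j phi i j * (a i * a j) <= L * M ^+ 2 ->
  (4 * L)^-1 <= \sum_(0 <= k < K) r k.
Proof.
move=> M0 L0 a0 phi0 kapK r0 rphi HZ HE.
pose z k := \sum_i a i * (kap i == k)%:R.
have sel (u : nat -> R) p : (p < K)%N -> \sum_(0 <= k < K) u k * (p == k)%:R = u p.
  move=> pK; rewrite big_mkord (bigD1 (Ordinal pK))//= eqxx mulr1 big1 ?addr0// => k.
  by rewrite -val_eqE/= eq_sym => /negbTE->; rewrite mulr0.
have zE : \sum_i a i = \sum_(0 <= k < K) z k.
  rewrite exchange_big/=; apply: eq_bigr => i _.
  have [ai|ai] := eqVneq (a i) 0; last by rewrite (sel (fun=> a i))// kapK.
  by rewrite ai big1// => k _; rewrite mul0r.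
have zz : \sum_(0 <= k < K) (r k)^-1 * z k ^+ 2 <= L * M ^+ 2.
  apply: le_trans HE.
  have -> : \sum_(0 <= k < K) (r k)^-1 * z k ^+ 2 =
      \sum_i \sum_j \sum_(0 <= k < K) (r k)^-1 * ((kap i == k)%:R * (kap j == k)%:R) * (a i * a j).
    under [RHS]eq_bigr => i _ do rewrite exchange_big/=.
    rewrite exchange_big/=; apply: eq_bigr => k _.
    rewrite expr2 mulrA mulrC mulr_suml; apply: eq_bigr => i _.
    rewrite !mulr_sumr; apply: eq_bigr => j _; ring.
  apply: ler_sum => i _; apply: ler_sum => j _; rewrite -mulr_suml.
  have [->|ai] := eqVneq (a i) 0; first by rewrite mul0r !mulr0.
  have [->|aj] := eqVneq (a j) 0; first by rewrite !mulr0.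
  rewrite ler_wpM2r ?mulr_ge0//.
  have [kij|kij] := eqVneq (kap i) (kap j); last first.
    rewrite big1// => k _; have [ik|_] := eqVneq (kap i) k; last by rewrite mul0r mulr0.
    by rewrite -ik eq_sym (negbTE kij) mulr0 mulr0.
  rewrite (eq_bigr (fun k => (r k)^-1 * (kap i == k)%:R)); last first.
    by move=> k _; rewrite -kij; case: eqP => _; rewrite ?mulr1 ?mulr0.
  by rewrite sel ?kapK// rphi.
(* With this parameter the energy term [L * M ^+ 2 / th] is [M / 2], half of the lower bound [M] for
   the left side; the other half is left for the cost. *)
pose th := 2 * L * M; have th0 : 0 < th by rewrite !mulr_gt0.
have amgm : 2 * \sum_i a i <= th * \sum_(0 <= k < K) r k + L * M ^+ 2 / th.
  apply: (@le_trans _ _ (th * (\sum_(0 <= k < K) r k) + (\sum_(0 <= k < K) (r k)^-1 * z k ^+ 2) / th)); last first.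
    by rewrite lerD2l ler_wpM2r ?invr_ge0 ?(ltW th0).
  rewrite zE !mulr_sumr mulr_suml -big_split/= big_seq [leRHS]big_seq; apply: ler_sum => k.
  rewrite mem_index_iota => /andP[_ kK]; have rk := r0 k kK.
  rewrite -subr_ge0 [leRHS](_ : _ = (th * r k - z k) ^+ 2 / (th * r k)).
    by rewrite divr_ge0 ?sqr_ge0// mulr_ge0// ltW.
  by field; rewrite !gt_eqF.
have e1 : L * M ^+ 2 / th = M / 2 by rewrite /th; field; rewrite !gt_eqF.
rewrite e1 in amgm; have H : M / 2 <= th * \sum_(0 <= k < K) r k by lra.
have L40 : 0 < 4 * L by rewrite mulr_gt0.
rewrite -[leLHS]mul1r ler_pdivrMr// mulrC -(ler_pM2l M0) mulr1.
have -> : M * (4 * L * \sum_(0 <= k < K) r k) = 2 * (th * \sum_(0 <= k < K) r k).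
  by rewrite /th; ring.
lra.
Qed.

End EnergyMethod.

Section LowerEvent.
Context d (T : measurableType d) (R : realType) (P : probability T R).
Variables (l : nat -> R) (M0 M1 alpha : R) (C Y : nat -> nat -> {RV P >-> R}) (x : R).
Hypothesis l_gt0 : forall n, 0 < l n.
Hypothesis M0_gt0 : 0 < M0.
Hypothesis l_bnd : forall n, M0 / n.+1%:R <= l n <= M1 / n.+1%:R.
Hypothesis alpha_gt0 : 0 < alpha.
Hypothesis model : poisson_model alpha l C Y.
Hypothesis x_circle : circle x.

Local Notation pr := (pr P).
Local Notation all_free := (all_free l C Y x).
Local Notation mass := (mass l).
Local Notation ker := (ker l alpha).

Lemma l_eventually_small e : 0 < e -> exists m, forall k, (m <= k)%N -> l k <= e.
Proof.
move=> e0; exists (Num.bound (M1 / e)) => k mk; have /andP[_ ub] := l_bnd k.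
have M1e : 0 <= M1 / e.
  have /andP[] := l_bnd 0; rewrite !divr1 => H1 H2.
  by rewrite divr_ge0 ?ltW// (lt_le_trans M0_gt0)// (le_trans H1).
apply: (le_trans ub); rewrite ler_pdivrMr ?ltr0Sn// mulrC -ler_pdivrMr//.
by rewrite (le_trans (ltW (archi_boundP M1e)))// ler_nat ltnW.
Qed.

Lemma sum_const2 (c : R) n : \sum_(i < n) \sum_(j < n) c = n%:R ^+ 2 * c.
Proof. by rewrite !sumr_const card_ord -natrX mulr_natl -mulnn mulrnA. Qed.

Lemma natr_distn (i j : nat) : (`|i - j|%N)%:R = `|i%:R - j%:R| :> R.
Proof.
wlog ij : i j / (i <= j)%N.
  by move=> H; have [/H//|/ltnW/H] := leqP i j; rewrite distnC distrC.
by rewrite distnEr// distrC -natrB// normr_nat.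
Qed.

Lemma pr_grid2 m N G (i j : 'I_G) : (forall k, (m <= k)%N -> l k < 1) ->
  pr (all_free m N (i%:R / G%:R) `&` all_free m N (j%:R / G%:R)) =
  if i == j then mass m N else mass m N ^+ 2 * ker m N (`|i - j|%N%:R / G%:R).
Proof.
move=> l1; have G0 : (0 < G)%N by exact: leq_ltn_trans (leq0n i) (ltn_ord i).
have G0' : (0 : R) < G%:R by rewrite ltr0n.
have [->|ij] := eqVneq i j.
  by rewrite setIid (pr_all_free l_gt0 model x_circle)// divr_ge0.
wlog ltij : i j ij / (i < j)%N.
  move=> H; have [|ji|/val_inj ije] := ltngtP i j; first exact: H.
    by rewrite setIC H 1?eq_sym// distnC.
  by rewrite ije eqxx in ij.
have t0 : 0 <= i%:R / G%:R :> R by rewrite divr_ge0.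
have st : i%:R / G%:R <= j%:R / G%:R :> R by rewrite ler_wpM2r ?invr_ge0 ?ler_nat// ltnW.
rewrite (pr_all_free2 l_gt0 model x_circle)//.
by rewrite -mulrBl distnEr ?(ltnW ltij)// natrB// ltnW.
Qed.

(* The bound on [rho k `^ (- s)] excludes the sets that are too small for the
   resolution of the [N]-th approximation. *)
Definition cover_cost m (s L : R) N (w : T) :=
  forall K (V : nat -> set R) (rho : nat -> R),
  (forall k, (k < K)%N -> [/\ 0 < rho k, rho k `^ (- s) <= N.+1%:R &
     forall u v, V k u -> V k v -> `|u - v| <= rho k]) ->
  (forall t, 0 <= t <= 1 -> all_free m N t w -> exists2 k, (k < K)%N & V k t) ->
  (4 * L)^-1 <= \sum_(0 <= k < K) rho k `^ s.

(** Two events of probability at most [eta / 2] are discarded: fewer than about half of the expected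
    number of grid points are uncovered (Chebyshev), or the energy is too large (Markov). On the
    rest [energy_cover] applies. Both [m] and [L] are chosen before [N]. *)
Lemma lower_event (s eta : R) : 0 <= s ->
  (covering_series l (alpha * (1 - s)) < +oo)%E -> 0 < eta ->
  exists m L (W : nat -> set T), [/\ 0 < L, forall N, measurable (W N),
    forall N, 1 - eta <= pr (W N) & forall N w, W N w -> cover_cost m s L N w].
Proof.
move=> s0 ser eta0.
have ser_alpha : (covering_series l alpha < +oo)%E.
  apply: covering_series_mono ser; rewrite ger_pMr//; lra.
have [m1 Hm1] : exists m, forall k, (m <= k)%N -> l k <= 1 / 2 by exact: l_eventually_small.
have eps0 : 0 < eta / 32 by rewrite divr_gt0.
have [m0 Hm0] := ker_sub1_sum l_gt0 M0_gt0 l_bnd alpha_gt0 ser_alpha eps0.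
have [B HB] := ker_pow_sum l_gt0 M0_gt0 l_bnd alpha_gt0 s0 ser.
pose m := maxn m0 m1.
have l2 k : (m <= k)%N -> l k <= 1 / 2 by rewrite geq_max => /andP[_ /Hm1].
have l1 k : (m <= k)%N -> l k < 1 by move=> /l2; lra.
have mm0 : (m0 <= m)%N by exact: leq_maxl.
have mass0 N : 0 < mass m N by exact: mass_gt0.
have ker1 N t : 1 <= ker m N t by exact: ker_ge1.
have B0 : 0 <= B.
  by have := HB m 0%N 1%N l2; rewrite big_geq// mul1r.
(* The mean energy is at most [(1 + 2 * B) * Mq N ^+ 2], so Markov's inequality at level [L] gives
   [eta / 2]. *)
pose L := 2 * (1 + 2 * B) / eta; have L0 : 0 < L by rewrite divr_gt0//; lra.
(* The expected number [G * mass] of uncovered grid points has to beat the diagonal terms: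
   [16 / eta] in the variance, [N + 1] in the energy. *)
have /choice[G HG] : forall N, exists G : nat, (0 < G)%N /\ N.+1%:R + 16 / eta <= G%:R * mass m N.
  move=> N; have q0 : 0 <= (N.+1%:R + 16 / eta) / mass m N.
    by rewrite divr_ge0 ?(ltW (mass0 N))// addr_ge0// divr_ge0// ltW.
  exists (Num.bound ((N.+1%:R + 16 / eta) / mass m N)).+1; split => //.
  rewrite -ler_pdivrMr//; apply: ltW; apply: (lt_trans (archi_boundP q0)).
  by rewrite ltr_nat.
pose A N i := all_free m N (i%:R / (G N)%:R).
have mA N i : measurable (A N i) by exact: ambient_all_free.
pose Mq N := (G N)%:R * mass m N.
have eta16 : 0 < 16 / eta by rewrite divr_gt0.
have Mq0 N : 0 < Mq N.
  by apply: (lt_le_trans _ (HG N).2); rewrite addr_gt0// ltr0Sn.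
pose Z N w : R := \sum_(i < G N) \1_(A N i) w.
(* The Riesz kernel [|u - v|^(-s)] on the grid, with its diagonal replaced by [N + 1], the bound
   that [cover_cost] puts on [rho k^(-s)]. *)
pose phi N (i j : 'I_(G N)) : R := if i == j then N.+1%:R else (`|i - j|%N%:R / (G N)%:R) `^ (- s).
have phi0 N i j : 0 <= phi N i j by rewrite /phi; case: ifP => _; [exact: ler0n|exact: powR_ge0].
pose En N w := \sum_(i < G N) \sum_(j < G N) phi N i j * (\1_(A N i) w * \1_(A N j) w).
have mZ N : measurable_fun setT (Z N).
  by apply: measurable_sum => i; exact: measurable_indic.
have mEn N : measurable_fun setT (En N).
  apply: measurable_sum => i; apply: measurable_sum => j; apply: measurable_funM => //.
  by apply: measurable_funM; exact: measurable_indic.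
pose E1 N := Z N @^-1` `]-oo, (Mq N / 2)]%classic.
pose E2 N := En N @^-1` `]L * Mq N ^+ 2, +oo[%classic.
have mE1 N : measurable (E1 N) by rewrite -[E1 N]setTI; exact: mZ.
have mE2 N : measurable (E2 N) by rewrite -[E2 N]setTI; exact: mEn.
have pE1 N : pr (E1 N) <= eta / 2.
  have G0 := (HG N).1; have G0' : (0 : R) < (G N)%:R by rewrite ltr0n.
  have HE w : E1 N w -> Z N w <= Mq N / 2 by rewrite /E1/= in_itv.
  have Hs : \sum_(i < G N) pr (A N i) = Mq N.
    rewrite (eq_bigr (fun=> mass m N)); last first.
      by move=> i _; rewrite (pr_all_free l_gt0 model x_circle)// divr_ge0.
    by rewrite sumr_const card_ord /Mq mulr_natl.
  have := second_moment (mA N) (mE1 N) HE (Mq0 N) Hs.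
  have Hq : \sum_(i < G N) \sum_(j < G N) pr (A N i `&` A N j) - Mq N ^+ 2 <=
      Mq N + 2 * Mq N ^+ 2 * (eta / 32).
    have -> : Mq N ^+ 2 = \sum_(i < G N) \sum_(j < G N) mass m N ^+ 2.
      by rewrite sum_const2 /Mq exprMn.
    rewrite -sumrB; under eq_bigr => i _ do rewrite -sumrB.
    apply: (@le_trans _ _ (\sum_(i < G N) \sum_(j < G N)
       (if i == j then mass m N else mass m N ^+ 2 * (ker m N (`|i - j|%N%:R / (G N)%:R) - 1)))).
      apply: ler_sum => i _; apply: ler_sum => j _; rewrite pr_grid2//; case: ifP => _.
        by rewrite gerBl sqr_ge0.
      by rewrite mulrBr mulr1.
    apply: le_trans (sum_symmetric (g := fun k => mass m N ^+ 2 * (ker m N (k%:R / (G N)%:R) - 1)) _ _ _) _.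
      by move=> k; rewrite mulr_ge0 ?sqr_ge0// subr_ge0.
    rewrite lerD2l -mulr_sumr.
    have := Hm0 m N (G N) mm0 l2; set Su := \sum_(_ <= _ < _) _ => HSu.
    have -> : \sum_(i < G N) \sum_(j < G N) mass m N ^+ 2 = Mq N ^+ 2.
      by rewrite sum_const2 /Mq exprMn.
    have -> : 2 * Mq N ^+ 2 * (eta / 32) = 2 * (G N)%:R * (mass m N ^+ 2 * ((G N)%:R * (eta / 32))).
      by rewrite /Mq; ring.
    rewrite ler_wpM2l ?mulr_ge0// ler_wpM2l ?sqr_ge0//.
  move=> H; have {}H := le_trans H Hq.
  have M2 : 0 < Mq N ^+ 2 by rewrite exprn_gt0.
  rewrite -(ler_pM2l M2).
  have HM : 16 / eta <= Mq N by apply: le_trans (HG N).2; rewrite lerDr.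
  have : Mq N <= Mq N ^+ 2 * (eta / 16).
    rewrite expr2 -mulrA ler_peMr ?(ltW (Mq0 N))//.
    by move: HM; rewrite ler_pdivrMr// mulrA ler_pdivlMr// mul1r.
  by move: H; set q := Mq N ^+ 2; lra.
have pE2 N : pr (E2 N) <= eta / 2.
  have G0 := (HG N).1; have G0' : (0 : R) < (G N)%:R by rewrite ltr0n.
  have HE w : E2 N w -> L * Mq N ^+ 2 <= \sum_(i < G N) \sum_(j < G N) phi N i j * (\1_(A N i) w * \1_(A N j) w).
    by rewrite /E2/= in_itv/= andbT => /ltW.
  have H1 := quadratic_markov P (mA N) (mE2 N) HE (phi0 N).
  have M2 : 0 < Mq N ^+ 2 by rewrite exprn_gt0.
  have H2 : \sum_(i < G N) \sum_(j < G N) phi N i j * pr (A N i `&` A N j) <= Mq N ^+ 2 * (1 + 2 * B).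
    apply: (@le_trans _ _ (\sum_(i < G N) \sum_(j < G N)
       (if i == j then N.+1%:R * mass m N else mass m N ^+ 2 *
         ((`|i - j|%N%:R / (G N)%:R) `^ (- s) * ker m N (`|i - j|%N%:R / (G N)%:R))))).
      apply: ler_sum => i _; apply: ler_sum => j _; rewrite pr_grid2// /phi; case: ifP => _//.
      by rewrite mulrCA.
    apply: le_trans (sum_symmetric (g := fun k => mass m N ^+ 2 *
         ((k%:R / (G N)%:R) `^ (- s) * ker m N (k%:R / (G N)%:R))) _ _ _) _.
      move=> k; apply: mulr_ge0; first exact: sqr_ge0.
      by apply: mulr_ge0; [exact: powR_ge0|exact: le_trans ler01 (ker1 _ _)].
    rewrite -mulr_sumr mulrDr mulr1; apply: lerD.
      rewrite mulrCA -/(Mq N) expr2 ler_wpM2r ?(ltW (Mq0 N))//.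
      by apply: le_trans (HG N).2; rewrite lerDl ltW.
    have := HB m N (G N) l2; set Su := \sum_(_ <= _ < _) _ => HSu.
    have -> : Mq N ^+ 2 * (2 * B) = 2 * (G N)%:R * (mass m N ^+ 2 * ((G N)%:R * B)).
      by rewrite /Mq; ring.
    by rewrite ler_wpM2l ?mulr_ge0// ler_wpM2l ?sqr_ge0.
  rewrite -(ler_pM2l M2) -(ler_pM2l L0) mulrA; apply: (le_trans H1); apply: (le_trans H2).
  rewrite le_eqVlt; apply/orP; left; apply/eqP; rewrite /L; field.
  by rewrite gt_eqF.
exists m, L, (fun N => ~` (E1 N `|` E2 N)); split => //.
- by move=> N; apply: measurableC; exact: measurableU.
- move=> N; have mU : measurable (E1 N `|` E2 N) by exact: measurableU.
  have : (P (E1 N `|` E2 N) <= P (E1 N) + P (E2 N))%E by exact: measureU2.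
  rewrite !prE// -EFinD lee_fin => HU.
  have : P (~` (E1 N `|` E2 N)) = (1 - P (E1 N `|` E2 N))%E by exact: probability_setC.
  rewrite !prE//; last exact: measurableC.
  by rewrite -EFinB => -[->]; have := pE1 N; have := pE2 N; lra.
move=> N w /not_orP[nE1 nE2] K V rho HV Hcov.
have G0 := (HG N).1; have G0' : (0 : R) < (G N)%:R by rewrite ltr0n.
have Hsel (i : 'I_(G N)) : exists k, \1_(A N i) w != 0 :> R -> (k < K)%N /\ V k (i%:R / (G N)%:R).
  have [Aw|Aw] := pselect (A N i w); last by exists 0%N; rewrite indicE memNset// eqxx.
  have t01 : 0 <= (i%:R / (G N)%:R : R) <= 1.
    by rewrite divr_ge0//= ler_pdivrMr// mul1r ler_nat ltnW.
  by have [k kK Vk] := Hcov _ t01 Aw; exists k.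
have [kap Hkap] := choice Hsel.
apply: (@energy_cover R (G N) K (fun i => \1_(A N i) w) (phi N) kap (fun k => rho k `^ s) (Mq N) L) => //.
- by move=> i ai; have [] := Hkap i ai.
- by move=> k kK; have [r0 _ _] := HV k kK; rewrite powR_gt0.
- move=> i j ai aj kij; have [iK Vi] := Hkap i ai; have [jK Vj] := Hkap j aj.
  have [r0 rN Vr] := HV _ iK; rewrite -powRN /phi; case: ifP => // /negbT ij.
  rewrite !powRN lef_pV2 ?posrE ?powR_gt0//; last first.
    rewrite divr_gt0// ltr0n lt0n distn_eq0; exact: contra ij.
  apply: ge0_ler_powR; rewrite ?nnegrE ?divr_ge0 ?(ltW r0)//.
  rewrite -kij in Vj; have := Vr _ _ Vi Vj.
  by rewrite -mulrBl normrM [X in _ * X]ger0_norm ?invr_ge0// -natr_distn.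
- apply/ltW; rewrite ltNge; apply/negP => HZ; apply: nE1.
  by rewrite /E1/= in_itv.
- rewrite leNgt; apply/negP => HE; apply: nE2.
  by rewrite /E2/= in_itv/= andbT.
Qed.

End LowerEvent.

(** * Limits of uncovered times *)

Section Paths.
Context d (T : measurableType d) (R : realType) (P : probability T R).
Variables (l : nat -> R) (M0 M1 alpha : R) (C Y : nat -> nat -> {RV P >-> R}) (x : R).
Hypothesis l_gt0 : forall n, 0 < l n.
Hypothesis M0_gt0 : 0 < M0.
Hypothesis l_bnd : forall n, M0 / n.+1%:R <= l n <= M1 / n.+1%:R.
Hypothesis alpha_gt0 : 0 < alpha.
Hypothesis model : poisson_model alpha l C Y.
Hypothesis x_circle : circle x.

Local Notation pr := (pr P).
Local Notation free := (free l C Y x).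
Local Notation all_free := (all_free l C Y x).
Local Notation good := (good Y).
Local Notation jumps := (jumps Y).
Local Notation X := (fun k : (nat * nat) + (nat * nat) =>
  match k with inl p => C p.1 p.2 | inr p => Y p.1 p.2 end).

Definition no_ties : set T := [set w | forall n n' j j', n <> n' ->
  jump_time Y n j.+1 w <> jump_time Y n' j'.+1 w].

(** A tie says that [Y n j] equals a difference of jump times in which [Y n j] does not occur, and
    the exponential law has no atoms. *)
Lemma ae_no_ties : {ae P, forall w, no_ties w}.
Proof.
suff H n n' j j' : n <> n' ->
    P.-negligible [set w | jump_time Y n j.+1 w = jump_time Y n' j'.+1 w].
  apply: (@negligibleS _ _ _ _ (\bigcup_n \bigcup_n' \bigcup_j \bigcup_j'
      [set w | n <> n' /\ jump_time Y n j.+1 w = jump_time Y n' j'.+1 w])).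
    move=> w /= /existsNP[n /existsNP[n' /existsNP[j /existsNP[j' /not_implyP[nn' /contrapT e]]]]].
    by exists n => //; exists n' => //; exists j => //; exists j'.
  apply: negligible_bigcup => n; apply: negligible_bigcup => n'.
  apply: negligible_bigcup => j; apply: negligible_bigcup => j'.
  have [nn'|nn'] := pselect (n <> n'); last first.
    by apply: (negligibleS _ (negligible_set0 _)) => w /= [].
  by apply: negligibleS (H _ _ j j' nn') => w /= [].
move=> nn'; pose K : set ((nat * nat) + (nat * nat)) := fun k => k <> inr (n, j).
pose W w := jump_time Y n' j'.+1 w - jump_time Y n j w.
have mW : measurable_fun setT (W : g_sigma_algebraType (cylinders X K) -> R).
  apply: measurable_funB; apply: measurable_jump_time => i ij.
    by move=> [/esym].
  by move=> [ij']; rewrite ij' ltnn in ij.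
have P0 : P [set w | W w = Y n j w] = 0%E.
  apply: (@no_tie _ _ _ _ _ X (model_independent model) K (inr (n, j))) => //.
  by move=> y; exact: (exponential_set1 (law_Y model n j)).
have -> : [set w | jump_time Y n j.+1 w = jump_time Y n' j'.+1 w] = [set w | W w = Y n j w].
  apply/seteqP; split => w /=; rewrite jump_timeS /W.
    by move=> <-; rewrite addrC addKr.
  by move=> <-; rewrite addrC subrK.
apply/negligibleP => //.
have mf : measurable_fun setT (fun w => W w - Y n j w).
  apply: measurable_funB => //; exact: (measurable_fun_cylinders mW).
rewrite (_ : [set w | _] = setT `&` (fun w => W w - Y n j w) @^-1` [set 0]); first exact: mf.
rewrite setTI; apply/seteqP; split => w /=; first by move=> ->; rewrite subrr.
by move/eqP; rewrite subr_eq0 => /eqP.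
Qed.

Lemma ae_good : {ae P, forall w, good w}.
Proof.
exists (~` good); split => //; first by apply: measurableC; exact: measurable_good.
exact: (probability_good l_gt0 model).
Qed.

Lemma arc_center_jumps n j t w : good w -> jumps n j t w -> arc_center C Y n t w = C n j w.
Proof.
move=> gw Jj; rewrite /arc_center.
have : jumps n (get [set j : nat | jump_time Y n j w <= t < jump_time Y n j.+1 w]) t w.
  by apply: (@getPex _ [set j : nat | jump_time Y n j w <= t < jump_time Y n j.+1 w]); exists j.
by move=> Jg; rewrite (jumps_inj gw Jg Jj).
Qed.

Lemma free_arc n t w : good w -> 0 <= t -> free n t w <-> ~ Defs.arc l C Y n t w x.
Proof.
move=> gw t0; have [j Jj] := jumps_total n gw t0; rewrite /Defs.arc /open_arc/= (arc_center_jumps gw Jj).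
split=> [[k _ [Jk fk]] [_]|H]; first by rewrite (jumps_inj gw Jj Jk).
by exists j => //; split => // H'; apply: H.
Qed.

Lemma exceptionalP t w : good w -> 0 <= t -> uncovered l C Y t w x <->
  exists m, forall n, (m <= n)%N -> free n t w.
Proof.
move=> gw t0; split=> [[_ ncov]|[m Hm]].
  apply: contrapT => /forallNP H; apply: ncov => m _.
  have /existsNP[n /not_implyP[mn nf]] := H m; exists n => //.
  by apply: contrapT => na; apply: nf; apply/free_arc.
split=> // cov; have [n /= mn an] := cov m I.
by have /free_arc := Hm n mn; apply.
Qed.

Lemma free_locally n t w : good w -> 0 <= t -> (forall j, t <> jump_time Y n j.+1 w) ->
  exists2 e, 0 < e & forall t', 0 <= t' -> `|t' - t| < e -> free n t' w -> free n t w.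
Proof.
move=> gw t0 nj; have [j Jj] := jumps_total n gw t0.
suff [e e0 He] : exists2 e, 0 < e & forall t', 0 <= t' -> `|t' - t| < e -> jumps n j t' w.
  exists e => // t' t'0 t'e [k _ [Jk fk]]; exists j => //; split => //.
  by rewrite (jumps_inj gw (He _ t'0 t'e) Jk).
move: (Jj); rewrite /jumps/= => /andP[]; case: j {Jj} => [|j]; last first.
  rewrite le_eqVlt => /predU1P[e|]; first by have := nj j; rewrite e.
  move=> H1 H2; exists (Num.min (t - jump_time Y n j.+1 w) (jump_time Y n j.+2 w - t)).
    by rewrite lt_min !subr_gt0 H1.
  by move=> t' _; rewrite lt_min !ltr_norml => /andP[/andP[a b] /andP[c e]]; lra.
rewrite jump_time0 => _ H2; exists (jump_time Y n 1 w - t); first by rewrite subr_gt0.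
by move=> t' t'0; rewrite ltr_norml => /andP[a b]; rewrite t'0/=; lra.
Qed.

Lemma cluster_unit_interval (t : nat -> R) : (forall N, 0 <= t N <= 1) ->
  exists2 s, 0 <= s <= 1 & forall e N0, 0 < e -> exists2 N, (N0 <= N)%N & `|t N - s| < e.
Proof.
move=> t01; have F01 : (t @ \oo) `[0, 1]%classic.
  by exists 0%N => // N _ /=; rewrite in_itv/=; exact: t01.
have [s [s01 cl]] := @segment_compact R 0 1 (t @ \oo) _ F01.
exists s; first by rewrite /= in_itv in s01.
move=> e N0 e0.
have FA : (t @ \oo) (t @` [set N | (N0 <= N)%N]) by exists N0 => // N /= N0N; exists N.
have [_ [[N N0N <-] sN]] := cl _ _ FA (nbhsx_ballx s e e0).
by exists N => //; rewrite distrC.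
Qed.

Lemma all_free_le m N N' t w : (N <= N')%N -> all_free m N' t w -> all_free m N t w.
Proof.
move=> NN'; rewrite !all_freeP => H i /andP[mi iN]; apply: H.
by rewrite mi (leq_trans iN).
Qed.

(* At the limit point at most one process jumps, and the others are locally
   constant there. *)
Lemma cluster_exceptional m w (t : nat -> R) : good w -> no_ties w ->
  (forall N, 0 <= t N <= 1) -> (forall N, all_free m N (t N) w) ->
  exists s, [/\ 0 <= s <= 1, uncovered l C Y s w x &
    forall e N0, 0 < e -> exists2 N, (N0 <= N)%N & `|t N - s| < e].
Proof.
move=> gw tw t01 ft; have [s s01 Hs] := cluster_unit_interval t01.
have s0 : 0 <= s by case/andP: s01.
exists s; split => //; apply/exceptionalP => //.
(* [no_ties] leaves at most one arc that jumps at [s]; if there is none, [0] is the default. *)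
have [n0 Hn0] : exists n0, forall n, n <> n0 -> forall j, s <> jump_time Y n j.+1 w.
  have [[n0 [j0 sj]]|H] := pselect (exists n0 j0, s = jump_time Y n0 j0.+1 w).
    by exists n0 => n nn0 j sj'; apply: (tw _ _ j j0 nn0); rewrite -sj -sj'.
  by exists 0%N => n _ j sj; apply: H; exists n, j.
exists (maxn m n0.+1) => n; rewrite geq_max => /andP[mn n0n].
have nn0 : n <> n0 by move=> e; rewrite e ltnn in n0n.
have [e e0 He] := free_locally gw s0 (Hn0 n nn0).
have [N nN tN] := Hs e n.+1 e0; apply: (He (t N)) => //; first by case/andP: (t01 N).
by have := ft N; rewrite all_freeP; apply; rewrite mn.
Qed.

(** Fatou's lemma for events, by continuity along the decreasing tails. *)
Lemma pr_limsup (W : nat -> set T) c : (forall N, measurable (W N)) ->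
  (forall N, c <= pr (W N)) -> c <= pr (\bigcap_n \bigcup_(k in [set k | (n <= k)%N]) W k).
Proof.
move=> mW cW; pose U n := \bigcup_(k in [set k | (n <= k)%N]) W k.
have mU n : measurable (U n) by apply: bigcup_measurable.
have mI : measurable (\bigcap_n U n) by apply: bigcapT_measurable.
have ni : {homo U : n m / (n <= m)%N >-> (m <= n)%O}.
  by move=> n m nm; apply/subsetPset => w [k /= mk Wk]; exists k => //=; exact: leq_trans nm mk.
have U0 : (P (U 0%N) < +oo)%E by rewrite (le_lt_trans (probability_le1 P (mU 0%N)))// ltry.
have cv := nonincreasing_cvg_mu U0 mU mI ni.
rewrite -lee_fin -prE// -(cvg_lim _ cv)//; apply: lime_ge; first by apply: cvgP cv.
apply: nearW => n; rewrite /= prE// lee_fin (le_trans (cW n))//.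
by apply: pr_le => // w Wn; exists n => //=.
Qed.

(** With [eta = 1 / (j + 1)] the bound holds at infinitely many levels [N] with probability at least
    [1 - eta]. Letting [j] grow exhausts the space; as [m] and [L] depend on [j], they become
    functions of [w]. *)
Lemma ae_cover_cost s : 0 <= s -> (covering_series l (alpha * (1 - s)) < +oo)%E ->
  {ae P, forall w, exists m L, 0 < L /\
    forall N0, exists2 N, (N0 <= N)%N & cover_cost l C Y x m s L N w}.
Proof.
move=> s0 ser.
have /choice[m /choice[L /choice[W HW]]] : forall j : nat, exists m L (W : nat -> set T),
   [/\ 0 < L, forall N, measurable (W N), forall N, 1 - j.+1%:R^-1 <= pr (W N) &
       forall N w, W N w -> cover_cost l C Y x m s L N w].
  by move=> j; apply: (lower_event l_gt0 M0_gt0 l_bnd alpha_gt0 model x_circle s0 ser); rewrite invr_gt0.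
pose V j := \bigcap_n \bigcup_(k in [set k | (n <= k)%N]) W j k.
have mV j : measurable (V j).
  by apply: bigcapT_measurable => n; apply: bigcup_measurable => k _; have [] := HW j.
have mVV : measurable (\bigcap_j ~` V j) by apply: bigcapT_measurable => j; exact: measurableC.
exists (\bigcap_j ~` V j); split => //.
  apply/eqP; rewrite prE// eqe eq_le pr_ge0 andbT leNgt; apply/negP => p0.
  pose j := Num.bound (pr (\bigcap_j ~` V j))^-1.
  have : (pr (\bigcap_j ~` V j))^-1 < j.+1%:R.
    by apply: (lt_trans (archi_boundP _)); [rewrite invr_ge0 ltW|rewrite ltr_nat].
  rewrite -[X in _ < X]invrK ltf_pV2 ?posrE ?invr_gt0// ltNge => /negP; apply.
  have H1 : 1 - j.+1%:R^-1 <= pr (V j) by apply: pr_limsup; have [] := HW j.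
  have : pr (\bigcap_j ~` V j) <= pr (~` V j).
    by apply: pr_le => //; [exact: measurableC|move=> w; apply].
  have : P (~` V j) = (1 - P (V j))%E by exact: probability_setC.
  rewrite !prE//; last exact: measurableC.
  rewrite -EFinB => -[->] H2; apply: (le_trans H2); move: H1; set q := _^-1; lra.
move=> w /= H j _ Vw; apply: H; exists (m j), (L j); have [L0 _ _ Hc] := HW j.
split => // N0; have [N N0N WN] := Vw N0 I; exists N => //; exact: Hc.
Qed.

(** If no time were uncovered at some level, the empty cover, of cost [0], would contradict the
    bound [1 / (4 * L)]. Infinitely many levels are enough, because uncovered times decrease with
    the level. *)
Lemma ae_exceptional_exists : (covering_series l alpha < +oo)%E ->
  {ae P, forall w, exists t : R, 0 <= t <= 1 /\ uncovered l C Y t w x}.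
Proof.
move=> ser; have ser' : (covering_series l (alpha * (1 - 0)) < +oo)%E by rewrite subr0 mulr1.
apply: filterS3 (ae_cover_cost (lexx 0) ser') ae_good ae_no_ties => w [m [L [L0 HL]]] gw tw.
have /choice[t Ht] : forall N, exists t, 0 <= t <= 1 /\ all_free m N t w.
  move=> N; have [N' NN' cN'] := HL N; apply: contrapT => /forallNP H.
  have c1 (k : nat) : (k < 0)%N -> [/\ (0 : R) < 1, (1 : R) `^ (- 0) <= N'.+1%:R &
     forall u v : R, set0 u -> set0 v -> `|u - v| <= 1] by [].
  have c2 t : 0 <= t <= 1 -> all_free m N' t w -> exists2 k : nat, (k < 0)%N & (set0 : set R) t.
    by move=> t01 /(all_free_le NN') ft; have := H t; case.
  have := cN' 0%N (fun=> set0) (fun=> 1) c1 c2; rewrite big_geq// leNgt.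
  by rewrite invr_gt0 mulr_gt0.
have [|N|s [s01 us _]] := @cluster_exceptional m w t gw tw; [by move=> N; case: (Ht N)|by case: (Ht N)|].
by exists s.
Qed.

(** Finitely many [V k] already cover the uncovered times of some level: otherwise uncovered times
    of level [K] outside the first [K] sets would cluster at an exceptional time, which lies in some
    open [V k]. *)
Lemma open_cover_bound s m L w (V : nat -> set R) (rho : nat -> R) : good w -> no_ties w ->
  0 < L -> (forall N0, exists2 N, (N0 <= N)%N & cover_cost l C Y x m s L N w) ->
  (forall k, [/\ 0 < rho k, open (V k) & forall u v, V k u -> V k v -> `|u - v| <= rho k]) ->
  exceptional_times l C Y x w `<=` \bigcup_k V k ->
  exists K, (4 * L)^-1 <= \sum_(0 <= k < K) rho k `^ s.
Proof.
move=> gw tw L0 HL HV cov.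
have [K HK] : exists K, forall t, 0 <= t <= 1 -> all_free m K t w -> exists2 k, (k < K)%N & V k t.
  apply: contrapT => /forallNP H.
  have /choice[t Ht] : forall K, exists t, [/\ 0 <= t <= 1, all_free m K t w &
      forall k, (k < K)%N -> ~ V k t].
    move=> K; have /existsNP[t /not_implyP[t01 /not_implyP[ft nV]]] := H K.
    by exists t; split => // k kK Vk; apply: nV; exists k.
  have [|N|s0 [s01 us Hs]] := @cluster_exceptional m w t gw tw; [by move=> N; case: (Ht N)|by case: (Ht N)|].
  have [k _ Vks] : (\bigcup_k V k) s0 by apply: cov; split.
  have [_ oV _] := HV k; have /nbhs_ballP[e /= e0 He] : nbhs s0 (V k) by apply: open_nbhs_nbhs.
  have [N kN tN] := Hs e k.+1 e0; have [_ _ /(_ k kN)] := Ht N; apply.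
  by apply: He; rewrite /ball/= distrC.
(* Finitely many sets remain, so a large level resolves all of them. *)
have [B HB] : exists B : nat, forall k, (k < K)%N -> rho k `^ (- s) <= B%:R.
  elim: (K) => [|K' [B HB]]; first by exists 0%N.
  have p0 := powR_ge0 (rho K') (- s).
  exists (maxn B (Num.bound (rho K' `^ (- s)))) => k; rewrite ltnS leq_eqVlt => /predU1P[->|kK].
    by rewrite (le_trans (ltW (archi_boundP p0)))// ler_nat leq_maxr.
  by rewrite (le_trans (HB k kK))// ler_nat leq_maxl.
have [N BN cN] := HL (maxn K B); exists K; apply: (cN K V rho).
  move=> k kK; have [r0 _ Vr] := HV k; split => //.
  by rewrite (le_trans (HB k kK))// ler_nat ltnW// ltnS (leq_trans _ BN)// leq_maxr.
move=> t t01 ft; apply: HK => //; apply: all_free_le ft.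
by rewrite (leq_trans _ BN)// leq_maxl.
Qed.

End Paths.

(** * Hausdorff measures and dimension *)

Section HausdorffCovers.
Context {R : realType}.
Implicit Types (A V : set R) (s r e : R).

Lemma diam_le A r : (forall u v, A u -> A v -> `|u - v| <= r) -> (diam A <= r%:E)%E.
Proof.
move=> H; apply/ereal_supP => _ [[u v] /= [Au Av] <-]; rewrite lee_fin; exact: H.
Qed.

Lemma le_diam A u v : A u -> A v -> ((`|u - v|)%:E <= diam A)%E.
Proof. by move=> Au Av; apply: ereal_sup_ubound; exists (u, v). Qed.

Lemma diam_ge0 A u : A u -> (0 <= diam A)%E.
Proof. by move=> Au; have := le_diam Au Au; rewrite subrr normr0. Qed.

Lemma diam_pow_ge0 s A : (0 <= diam_pow s A)%E.
Proof. by rewrite /diam_pow; case: ifP => // _; exact: poweR_ge0. Qed.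

Lemma diam_pow_set0 s : diam_pow s (set0 : set R) = 0%E.
Proof. by rewrite /diam_pow asboolT. Qed.

Lemma diam_powE s A u r : A u -> diam A = r%:E -> diam_pow s A = (r `^ s)%:E.
Proof.
move=> Au dA; rewrite /diam_pow asboolF; last by move=> A0; rewrite A0 in Au.
by rewrite dA poweR_EFin.
Qed.

Lemma diam_fin A u r : A u -> (diam A <= r%:E)%E -> exists2 q, diam A = q%:E & 0 <= q <= r.
Proof.
move=> Au; have := diam_ge0 Au; case: (diam A) => [q| |]//.
by rewrite !lee_fin => q0 qr; exists q => //; rewrite q0.
Qed.

Lemma diam_pow_le s A r : 0 <= s -> 0 <= r -> (forall u v, A u -> A v -> `|u - v| <= r) ->
  (diam_pow s A <= (r `^ s)%:E)%E.
Proof.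
move=> s0 r0 H; have [[u Au]|nA] := pselect (exists u, A u); last first.
  rewrite (_ : A = set0) ?diam_pow_set0 ?lee_fin ?powR_ge0//.
  by apply/seteqP; split => // u Au; apply: nA; exists u.
have [q dq /andP[q0 qr]] := diam_fin Au (diam_le H).
by rewrite (diam_powE s Au dq) lee_fin ge0_ler_powR.
Qed.

Definition has_small_covers s A := forall e, 0 < e -> exists V : nat -> set R,
  [/\ A `<=` \bigcup_k V k, forall k, (diam (V k) <= e%:E)%E &
      (\sum_(0 <= k <oo) diam_pow s (V k) <= e%:E)%E].

Lemma premeasure_ge0 s delta A : (0 <= hausdorff_premeasure s delta A)%E.
Proof.
apply/ereal_infP => _ [V _ <-]; apply: nneseries_ge0 => k _ _; exact: diam_pow_ge0.
Qed.

Lemma hausdorff_measure_eq0 s A : hausdorff_measure s A = 0%E <-> has_small_covers s A.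
Proof.
split=> [H e e0|H].
  have p0 : hausdorff_premeasure s e A = 0%E.
    apply/eqP; rewrite eq_le premeasure_ge0 andbT -H; apply: ereal_sup_ubound.
    by exists e.
  have pf : hausdorff_premeasure s e A \is a fin_num by rewrite p0.
  have [_ [V [AV dV] <-]] := lb_ereal_inf_adherent e0 pf.
  rewrite -/(hausdorff_premeasure s e A) p0 add0e => /ltW sV.
  by exists V.
apply/eqP; rewrite eq_le; apply/andP; split.
  apply/ereal_supP => _ [delta delta0 <-].
  apply/lee_addgt0Pr => e e0; rewrite add0e.
  have m0 : 0 < Num.min e delta by rewrite lt_min e0.
  have [V [AV dV sV]] := H _ m0.
  apply: (@le_trans _ _ (\sum_(0 <= k <oo) diam_pow s (V k))%E).
    apply: ereal_inf_lbound; exists V => //; split => // k.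
    by rewrite (le_trans (dV k))// lee_fin ge_min lexx orbT.
  by rewrite (le_trans sV)// lee_fin ge_min lexx.
apply: le_ereal_sup_tmp; exists (hausdorff_premeasure s 1 A); last exact: premeasure_ge0.
by exists 1 => //=.
Qed.

Lemma hausdorff_null_mono s s' A : 0 <= s' -> s' <= s ->
  hausdorff_measure s' A = 0%E -> hausdorff_measure s A = 0%E.
Proof.
move=> s'0 ss' /hausdorff_measure_eq0 H; apply/hausdorff_measure_eq0 => e e0.
have m0 : 0 < Num.min e 1 by rewrite lt_min e0 ltr01.
have [V [AV dV sV]] := H _ m0.
exists V; split => //.
  by move=> k; rewrite (le_trans (dV k))// lee_fin ge_min lexx.
apply: (@le_trans _ _ (\sum_(0 <= k <oo) diam_pow s' (V k))%E); last first.
  by rewrite (le_trans sV)// lee_fin ge_min lexx.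
apply: lee_nneseries => k *; first exact: diam_pow_ge0.
have [[u Vu]|nV] := pselect (exists u, V k u); last first.
  rewrite (_ : V k = set0) ?diam_pow_set0//.
  by apply/seteqP; split => // u Vu; apply: nV; exists u.
have [q dq /andP[q0]] := diam_fin Vu (dV k); rewrite le_min => /andP[_ q1].
rewrite !(diam_powE _ Vu dq) lee_fin.
move: q0; rewrite le_eqVlt => /predU1P[q0|q0]; last by apply: ger_powR => //; rewrite q0 q1.
(* Since [0^0 = 1], sets of diameter [0] are treated apart: [s = 0] forces [s' = 0]. *)
rewrite -q0; have [s0|s0] := eqVneq s 0; last by rewrite powR0// powR_ge0.
by have -> : s' = s by apply/eqP; rewrite eq_le ss' s0.
Qed.

Lemma hausdorff_null_bigcup s (A : nat -> set R) :
  (forall i, hausdorff_measure s (A i) = 0%E) -> hausdorff_measure s (\bigcup_i A i) = 0%E.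
Proof.
move=> H; apply/hausdorff_measure_eq0 => e e0.
have ei i : 0 < e / (2 ^ i.+1)%:R by rewrite divr_gt0// ltr0n expn_gt0.
have /choice[V HV] : forall i, exists V : nat -> set R,
  [/\ A i `<=` \bigcup_k V k, forall k, (diam (V k) <= (e / (2 ^ i.+1)%:R)%:E)%E &
      (\sum_(0 <= k <oo) diam_pow s (V k) <= (e / (2 ^ i.+1)%:R)%:E)%E].
  by move=> i; have /hausdorff_measure_eq0 := H i; apply.
have /card_esym/ppcard_eqP[f] := card_nat2.
exists (fun n => V (f n).1 (f n).2); split.
- move=> u [i _ /(let: And3 h _ _ := HV i in h u) [k _ Vu]].
  by exists (f^-1%FUN (i, k)) => //=; rewrite invK ?inE.
- move=> n; have [_ + _] := HV (f n).1 => /(_ (f n).2) /le_trans; apply.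
  by rewrite lee_fin ler_pdivrMr ?ltr0n ?expn_gt0// ler_peMr ?(ltW e0)// ler1n expn_gt0.
pose g (p : nat * nat) := diam_pow s (V p.1 p.2).
have g0 p : (0 <= g p)%E by exact: diam_pow_ge0.
have -> : (\sum_(0 <= n <oo) diam_pow s (V (f n).1 (f n).2) =
    \sum_(0 <= i <oo) \sum_(0 <= k <oo) g (i, k))%E.
  rewrite nneseries_esumT; last by move=> n; exact: diam_pow_ge0.
  rewrite -(@reindex_esum _ _ _ setT setT f g)//.
  rewrite [RHS]nneseries_esumT; last by move=> i; apply: nneseries_ge0 => *; exact: g0.
  rewrite (eq_esum (fun i _ => nneseries_esumT (fun k => g0 (i, k)))).
  rewrite esum_esum//= (_ : [set: nat] `*`` _ = setT); last by apply/seteqP; split.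
  by apply: eq_esum => -[].
apply: (@le_trans _ _ (\sum_(0 <= i <oo) (0 + (e / (2 ^ i.+1)%:R)%:E))%E).
  apply: lee_nneseries => i *; first by apply: nneseries_ge0 => *; exact: g0.
  by rewrite add0e; have [] := HV i.
apply: le_trans (epsilon_trick xpredT (fun=> lexx 0%E) (ltW e0)) _.
by rewrite eseries0// add0e.
Qed.

Lemma hausdorff_dim_le A s : 0 <= s -> hausdorff_measure s A = 0%E -> (hausdorff_dim A <= s%:E)%E.
Proof. by move=> s0 H; apply: ereal_inf_lbound; exists s. Qed.

Lemma hausdorff_dim_ge A D : (forall s, 0 <= s -> s < D -> hausdorff_measure s A <> 0%E) ->
  (D%:E <= hausdorff_dim A)%E.
Proof.
move=> H; apply/ereal_infP => _ [s [s0 Hs] <-]; rewrite lee_fin leNgt; apply/negP => sD.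
exact: H sD Hs.
Qed.

(** By monotonicity countably many exponents determine the dimension, so almost sure statements for
    each of them can be combined. The denominator [q.+2] keeps the lower exponents positive. *)
Lemma hausdorff_dim_eq A D : 0 <= D ->
  (forall q : nat, hausdorff_measure (D + q.+1%:R^-1) A = 0%E) ->
  (0 < D -> forall q : nat, hausdorff_measure (D - D / q.+2%:R) A <> 0%E) ->
  hausdorff_dim A = D%:E.
Proof.
move=> D0 Hup Hlow; apply/eqP; rewrite eq_le; apply/andP; split.
  apply/lee_addgt0Pr => e e0.
  have e0' : 0 <= e^-1 by rewrite invr_ge0 ltW.
  pose q := Num.bound e^-1.
  have qe : q.+1%:R^-1 <= e.
    rewrite invf_ple ?posrE// (le_trans (ltW (archi_boundP e0')))// ler_nat//.
  apply: le_trans (hausdorff_dim_le _ (Hup q)) _; first by rewrite addr_ge0// invr_ge0.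
  by rewrite lee_fin lerD2l.
apply: hausdorff_dim_ge => s s0 sD Hs.
have Dp : 0 < D by exact: le_lt_trans sD.
have q0 : 0 <= D / (D - s) by rewrite divr_ge0// subr_ge0 ltW.
pose q := Num.bound (D / (D - s)).
apply: (Hlow Dp q); apply: hausdorff_null_mono Hs => //.
rewrite lerBrDl -lerBrDr ler_pdivrMr ?ltr0Sn// mulrC -ler_pdivrMr ?subr_gt0//.
by rewrite (le_trans (ltW (archi_boundP q0)))// ler_nat ltnW// ltnS.
Qed.

Lemma geometric_half_le (K : nat) : \sum_(0 <= k < K) (2 ^ k.+1)%:R^-1 <= 1 :> R.
Proof.
suff -> : \sum_(0 <= k < K) (2 ^ k.+1)%:R^-1 = 1 - (2 ^ K)%:R^-1 :> R.
  by rewrite gerBl invr_ge0.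
elim: K => [|K IH]; first by rewrite big_geq// expn0 invr1 subrr.
rewrite big_nat_recr//= IH !expnS !natrM; field.
by rewrite pnatr_eq0 expn_eq0.
Qed.

(** An arbitrary cover of cost at most [c / 4] is thickened to an open one of cost at most [c / 2],
    which the hypothesis excludes. *)
Lemma not_hausdorff_null A s c : 0 < s -> 0 < c ->
  (forall (V : nat -> set R) (rho : nat -> R),
    (forall k, [/\ 0 < rho k, open (V k) & forall u v, V k u -> V k v -> `|u - v| <= rho k]) ->
    A `<=` \bigcup_k V k -> exists K, c <= \sum_(0 <= k < K) rho k `^ s) ->
  hausdorff_measure s A <> 0%E.
Proof.
move=> s0 c0 H /hausdorff_measure_eq0 small.
have c4 : 0 < c / 4 by rewrite divr_gt0.
have [V [AV dV sV]] := small _ c4.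
have dfin k : diam_pow s (V k) \is a fin_num.
  rewrite ge0_fin_numE; last exact: diam_pow_ge0.
  apply: (@le_lt_trans _ _ ((c / 4) `^ s)%:E); last exact: ltry.
  apply: diam_pow_le; [exact: ltW|exact: ltW|move=> u v Vu Vv].
  by rewrite -lee_fin (le_trans (le_diam Vu Vv)).
pose r k := fine (diam_pow s (V k)).
have r0 k : 0 <= r k by rewrite fine_ge0// diam_pow_ge0.
pose D k := r k `^ s^-1.
have VD k u v : V k u -> V k v -> `|u - v| <= D k.
  move=> Vu Vv; have [q dq /andP[q0 _]] := diam_fin Vu (dV k).
  have := le_diam Vu Vv; rewrite dq lee_fin => /le_trans; apply.
  rewrite /D /r (diam_powE s Vu dq)/= -powRrM divff ?gt_eqF// powRr1//.
(* The cost of the [k]-th set is raised by a geometric share of [c / 4]; since [s > 0], its root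
   [rho k] exceeds the diameter and leaves room for an open neighbourhood. *)
pose t k := r k + c / 4 * (2 ^ k.+1)%:R^-1.
have rt k : r k < t k by rewrite ltrDl mulr_gt0// invr_gt0 ltr0n expn_gt0.
pose rho k := t k `^ s^-1.
have t0 k : 0 < t k by exact: le_lt_trans (rt k).
have Drho k : D k < rho k.
  have := gt0_ltr_powR (_ : 0 < s^-1) => /(_ _ (r k) (t k)); apply; rewrite ?nnegrE ?invr_gt0//.
  exact: ltW.
have rhos k : rho k `^ s = t k by rewrite /rho -powRrM mulVf ?gt_eqF// powRr1// ltW.
pose U k := \bigcup_(v in V k) ball v ((rho k - D k) / 2).
have eta0 k : 0 < (rho k - D k) / 2 by rewrite divr_gt0// subr_gt0.
have HU k : [/\ 0 < rho k, open (U k) & forall u v, U k u -> U k v -> `|u - v| <= rho k].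
  split; first exact: powR_gt0.
    by apply: bigcup_open => v _; exact: ball_open.
  move=> u v [u' Vu' uu'] [v' Vv' vv']; have := VD k _ _ Vu' Vv'.
  move: uu' vv'; rewrite /ball/= => h1 h2 h3.
  have -> : u - v = (u - u') + (u' - v') + (v' - v) by ring.
  rewrite distrC in h1.
  apply: le_trans (ler_normD _ _) _; apply: (@le_trans _ _ (`|u - u'| + `|u' - v'| + `|v' - v|)).
    by rewrite lerD2r ler_normD.
  by lra.
have AU : A `<=` \bigcup_k U k.
  by move=> u /AV[k _ Vu]; exists k => //; exists u => //; exact: ballxx.
have [K HK] := H U rho HU AU.
have : \sum_(0 <= k < K) rho k `^ s <= c / 4 + c / 4.
  rewrite (eq_bigr t); last by move=> k _; exact: rhos.
  rewrite big_split/=; apply: lerD; last first.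
    by rewrite -mulr_sumr -[leRHS]mulr1 ler_wpM2l ?(ltW c4)// geometric_half_le.
  rewrite -lee_fin (le_trans _ sV)// -sumEFin.
  rewrite (eq_bigr (fun k => diam_pow s (V k))); last by move=> k _; rewrite /r fineK.
  by apply: nneseries_lim_ge => k _ _; exact: diam_pow_ge0.
lra.
Qed.

End HausdorffCovers.

(** * The convergence exponent of the covering series *)

Section CoveringIndex.
Context {R : realType}.
Variables (l : nat -> R) (M0 M1 alpha : R).
Hypothesis l_gt0 : forall n, 0 < l n.
Hypothesis M0_gt0 : 0 < M0.
Hypothesis l_bnd : forall n, M0 / n.+1%:R <= l n <= M1 / n.+1%:R.

Local Notation S n := (\sum_(k < n) l k).

Lemma harmonic_sum_le n : \sum_(0 <= k < n.+1) k.+1%:R^-1 <= 1 + ln n.+1%:R :> R.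
Proof.
rewrite big_nat_recl//= invr1 lerD2l.
by have := @harmonic_le R 0 n (leq0n n); rewrite ln1 subr0.
Qed.

Lemma expR_sum_le c n : 0 <= c -> (forall k, l k <= c / k.+1%:R) ->
  expR (S n.+1) <= expR c * n.+1%:R `^ c.
Proof.
move=> c0 lc; rewrite powRE ?ltr0Sn// -expRD ler_expR -[X in X + _]mulr1 -mulrDr.
apply: le_trans (ler_wpM2l c0 (harmonic_sum_le n)).
by rewrite -(big_mkord xpredT l) mulr_sumr; apply: ler_sum.
Qed.

Lemma covering_series_gt c b : 0 <= c -> (forall k, l k <= c / k.+1%:R) -> c < b ->
  (covering_series l b < +oo)%E.
Proof.
move=> c0 lc cb; apply/covering_seriesP.
exists (expR c * (2 `^ (1 + (b - c)) / (b - c) * 1%:R `^ (- (b - c)))) => K.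
apply: (@le_trans _ _ (\sum_(0 <= k < K) expR c * k.+1%:R `^ (- 1 - (b - c)))).
  apply: ler_sum => k _; have k0 : (0 : R) < k.+1%:R by rewrite ltr0Sn.
  rewrite (_ : - 1 - (b - c) = c + - (1 + b)); last by ring.
  rewrite powRD ?(gt_eqF k0) ?implybT// mulrA /covering_term powRN.
  by rewrite ler_wpM2r ?invr_ge0 ?powR_ge0// expR_sum_le.
by rewrite -mulr_sumr ler_wpM2l ?expR_ge0// sum_powR_tail// subr_gt0.
Qed.

(** [exp (S (k + 1)) >= (k + 1)^c], so for [b <= c] the terms dominate the harmonic series. The
    boundary [b = c] is included, whence the strict inequality in the harmonic case. *)
Lemma not_covering_series c b : (forall k, c / k.+1%:R <= l k) -> 0 <= c -> b <= c ->
  ~ (covering_series l b < +oo)%E.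
Proof.
move=> lc c0 bc /covering_seriesP[B HB]; have [K _ HK] := @harmonic_unbounded R 0 B.
have : \sum_(0 <= k < K) k.+1%:R^-1 <= \sum_(0 <= k < K) covering_term l b k.
  apply: ler_sum => k _; have k0 : (0 : R) < k.+1%:R by rewrite ltr0Sn.
  rewrite /covering_term powRD ?(gt_eqF k0) ?implybT// powRr1 ?ler0n//.
  rewrite invfM mulrCA -[leLHS]mulr1 ler_wpM2l ?invr_ge0 ?ler0n//.
  rewrite ler_pdivlMr ?powR_gt0// mul1r powRE// ler_expR.
  apply: (@le_trans _ _ (c * ln k.+1%:R)); first by rewrite ler_wpM2r// ln_ge0// ler1n.
  have H := @harmonic_ge R 0 k.+1 (leq0n _); rewrite ln1 subr0 in H.
  apply: (@le_trans _ _ (c * \sum_(0 <= j < k.+1) j.+1%:R^-1)).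
    rewrite ler_wpM2l// (le_trans _ H)// ler_ln ?posrE ?ltr0Sn// ler_nat//.
  by rewrite -(big_mkord xpredT l) mulr_sumr; apply: ler_sum.
by have := HB K; lra.
Qed.

Let M1_gt0 : 0 < M1.
Proof. by have := l_bnd 0; rewrite !divr1 => /andP[_]; exact: lt_le_trans. Qed.

Let has_inf_series : has_inf [set b : R | (covering_series l b < +oo)%E].
Proof.
split.
  exists (M1 + 1); apply: (@covering_series_gt M1); rewrite ?(ltW M1_gt0)//.
    by move=> k; have /andP[] := l_bnd k.
  by rewrite ltrDl.
exists M0 => b /= sb; rewrite leNgt; apply/negP => bM0.
apply: (@not_covering_series M0 b) sb; [|exact: ltW|exact: ltW].
by move=> k; have /andP[] := l_bnd k.
Qed.

Lemma gt_beta0 b : beta0 l < b -> (covering_series l b < +oo)%E.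
Proof.
rewrite -subr_gt0 => b0; have [b' /= sb'] := inf_adherent b0 has_inf_series.
rewrite -/(beta0 l) addrC subrK => /ltW bb'.
exact: covering_series_mono bb' sb'.
Qed.

Lemma lt_beta0 b : b < beta0 l -> ~ (covering_series l b < +oo)%E.
Proof.
move=> bb sb; have := ge_inf (has_inf_series).2 sb; rewrite -/(beta0 l).
by rewrite leNgt bb.
Qed.

Lemma beta0_harmonic c : 0 < c -> (forall n, l n = c / n.+1%:R) -> beta0 l = c.
Proof.
move=> c0 lc; apply/eqP; rewrite eq_le; apply/andP; split; rewrite leNgt; apply/negP => H.
  have H1 : c < (c + beta0 l) / 2 by lra.
  have H2 : (c + beta0 l) / 2 < beta0 l by lra.
  apply: (lt_beta0 H2); apply: covering_series_gt H1; first exact: ltW.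
  by move=> k; rewrite lc.
have H1 : (c + beta0 l) / 2 <= c by lra.
have H2 : beta0 l < (c + beta0 l) / 2 by lra.
apply: not_covering_series (gt_beta0 H2); [|exact: ltW c0|exact: H1].
by move=> k; rewrite lc.
Qed.

Lemma covering_series_harmonic c b : 0 < c -> (forall n, l n = c / n.+1%:R) ->
  (covering_series l b < +oo)%E <-> c < b.
Proof.
move=> c0 lc; split=> [sb|cb].
  rewrite ltNge; apply/negP => bc; apply: not_covering_series sb; [|exact: ltW c0|exact: bc].
  by move=> k; rewrite lc.
by apply: covering_series_gt cb; [exact: ltW|move=> k; rewrite lc].
Qed.

End CoveringIndex.

(** * Upper bounds, the dimension and the theorem *)

Section UpperBound.
Context d (T : measurableType d) (R : realType) (P : probability T R).
Variables (l : nat -> R) (M0 M1 alpha : R) (C Y : nat -> nat -> {RV P >-> R}) (x : R).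
Hypothesis l_gt0 : forall n, 0 < l n.
Hypothesis M0_gt0 : 0 < M0.
Hypothesis l_bnd : forall n, M0 / n.+1%:R <= l n <= M1 / n.+1%:R.
Hypothesis alpha_gt0 : 0 < alpha.
Hypothesis model : poisson_model alpha l C Y.
Hypothesis x_circle : circle x.

Local Notation pr := (pr P).
Local Notation free := (free l C Y x).
Local Notation all_free := (all_free l C Y x).
Local Notation hit := (hit l C Y x).
Local Notation good := (good Y).
Local Notation ker := (ker l alpha).
Local Notation S n := (\sum_(k < n) l k).

Definition free_times m w : set R := [set t | 0 <= t <= 1 /\ forall n, (m <= n)%N -> free n t w].

Lemma free_times_all_free m N t w : free_times m w t -> all_free m N t w.
Proof. by move=> [_ H]; rewrite all_freeP => i /andP[mi _]; exact: H. Qed.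

Lemma exceptional_times_bigcup m1 w : good w ->
  exceptional_times l C Y x w = \bigcup_m free_times (m1 + m) w.
Proof.
move=> gw; apply/seteqP; split => t.
  move=> [t01 H]; have t0 : 0 <= t by case/andP: t01.
  have [m Hm] := (exceptionalP l C x_circle gw t0).1 H; exists m => //; split => // n mn; apply: Hm.
  exact: leq_trans (leq_addl _ _) mn.
move=> [m _ [t01 H]]; split => //; have t0 : 0 <= t by case/andP: t01.
by apply/(exceptionalP l C x_circle gw t0); exists (m1 + m)%N.
Qed.

Lemma negligible_small (S : set T) :
  (forall e, 0 < e -> exists B, [/\ measurable B, S `<=` B & pr B <= e]) -> P.-negligible S.
Proof.
move=> H; have /choice[B HB] : forall j : nat, exists B, [/\ measurable B, S `<=` B & pr B <= j.+1%:R^-1].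
  by move=> j; apply: H; rewrite invr_gt0.
have mI : measurable (\bigcap_j B j) by apply: bigcapT_measurable => j; have [] := HB j.
exists (\bigcap_j B j); split => //; last by move=> w Sw j _; have [_ SB _] := HB j; exact: SB.
apply/eqP; rewrite prE// eqe eq_le pr_ge0 andbT leNgt; apply/negP => p0.
pose j := Num.bound (pr (\bigcap_j B j))^-1.
have : (pr (\bigcap_j B j))^-1 < j.+1%:R.
  by apply: (lt_trans (archi_boundP _)); [rewrite invr_ge0 ltW|rewrite ltr_nat].
rewrite -[X in _ < X]invrK ltf_pV2 ?posrE ?invr_gt0// ltNge => /negP; apply.
have [mB _ Bj] := HB j; apply: le_trans Bj; apply: pr_le => //.
by move=> w; apply.
Qed.

Lemma negligible_free_times m : ~ (covering_series l alpha < +oo)%E ->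
  (forall k, (m <= k)%N -> l k < 1) -> P.-negligible [set w | free_times m w !=set0].
Proof.
move=> div l1; apply: negligible_small => e e0.
have k0 : 0 < 4 / e by rewrite divr_gt0.
have [N HN] := @ker_sum_unbounded R l M0 M1 alpha l_gt0 M0_gt0 l_bnd alpha_gt0 m (4 / e) div l1.
have HN' G : (0 < G)%N -> 4 / e * G%:R <= \sum_(i < G) ker m N (i%:R * (1 / G%:R)).
  move=> G0; apply: (le_trans (HN G G0)); rewrite le_eqVlt; apply/orP; left; apply/eqP.
  by apply: eq_bigr => i _; rewrite mul1r.
(* The windows are half-open, so the time [1] falls into the second one; each has probability at
   most [2 / (4 / e) = e / 2]. *)
exists (hit m N 0 1 `|` hit m N 1 1); split.
- by apply: measurableU; exact: measurable_hit.
- move=> w [t [/andP[t0 t1] Ht]]; have Hf := free_times_all_free N (conj (introT andP (conj t0 t1)) Ht).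
  move: t1; rewrite le_eqVlt => /predU1P[t1|t1].
    by right; apply: hitP Hf => //; rewrite t1 lexx/= ltrDl.
  by left; apply: hitP Hf => //; rewrite t0 add0r.
have h0 := pr_hit l_gt0 model x_circle l1 (lexx 0) ler01 k0 HN'.
have h1 := pr_hit l_gt0 model x_circle l1 ler01 ler01 k0 HN'.
have : (P (hit m N 0 1 `|` hit m N 1 1) <= P (hit m N 0 1) + P (hit m N 1 1))%E.
  by apply: measureU2; exact: measurable_hit.
rewrite !prE; [|exact: measurable_hit|exact: measurable_hit|by apply: measurableU; exact: measurable_hit].
rewrite -EFinD lee_fin => H; apply: (le_trans H); apply: (le_trans (lerD h0 h1)).
by rewrite invf_div le_eqVlt; apply/orP; left; apply/eqP; field.
Qed.

Lemma ae_no_exceptional : ~ (covering_series l alpha < +oo)%E ->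
  {ae P, forall w, exceptional_times l C Y x w = set0}.
Proof.
move=> div; have [m1 Hm1] := l_eventually_small M0_gt0 l_bnd (ltr01 : (0 : R) < 1).
have [m2 Hm2] : exists m, forall k, (m <= k)%N -> l k < 1.
  have h2 : (0 : R) < 1 / 2 by rewrite divr_gt0.
  have [m2 Hm2] := l_eventually_small M0_gt0 l_bnd h2.
  by exists m2 => k /Hm2; lra.
have H : {ae P, forall w, forall m, free_times (m2 + m) w = set0}.
  apply: ae_foralln => m.
  have : P.-negligible [set w | free_times (m2 + m) w !=set0].
    by apply: negligible_free_times => // k mk; apply: Hm2; exact: leq_trans (leq_addr _ _) mk.
  by apply: negligibleS => w /= /eqP/set0P.
apply: filterS2 H (ae_good l_gt0 model) => w H gw.
by rewrite (exceptional_times_bigcup m2 gw) bigcup0// => m _; exact: H.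
Qed.

Lemma nneseries_le (u : nat -> R) B : (forall k, 0 <= u k) ->
  (forall K, \sum_(0 <= k < K) u k <= B) -> (\sum_(0 <= k <oo) (u k)%:E <= B%:E)%E.
Proof.
move=> u0 uB; apply: lime_le; first by apply: is_cvg_nneseries => k _ _; rewrite lee_fin.
by apply: nearW => K; rewrite /= sumEFin lee_fin.
Qed.

(* At scale [1 / Q] with [Q] of order [N^alpha], the expected number of
   intervals meeting [free_times m] is at most of order
   [N^alpha / exp (S N)]. *)
Lemma interval_cover m s e n0 : (forall k, (m <= k)%N -> l k < 1) -> 0 <= s ->
  alpha * (1 - s) < beta0 l -> 0 < e ->
  exists Q N : nat, [/\ (0 < Q)%N, Q%:R^-1 <= e, (n0 <= N)%N &
    \sum_(0 <= q < Q.+1) Q%:R `^ (- s) * pr (hit m N (q%:R / Q%:R) Q%:R^-1) <= e].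
Proof.
move=> l1 s0 sb e0.
move: sb; set b := alpha * (1 - s) => sb; pose b' := (b + beta0 l) / 2.
have bb' : b < b' by rewrite /b'; lra.
have div : ~ (covering_series l b' < +oo)%E.
  by apply: (lt_beta0 l_gt0 M0_gt0 l_bnd); rewrite /b'; lra.
have [C1 C10 HC1] := ker_ge_unif l_gt0 M0_gt0 l_bnd alpha_gt0.
have [k0 Hk0] := y_small alpha_gt0 e0.
(* [6] is [3] from [Q + 1 <= 3 * N^alpha] times [2] from [pr_hit]; the exponential cancels the
   constant of [ker_ge_unif]. *)
pose D := 6 * expR (S m + C1) / e.
have [N nN HN] := growth D (maxn k0 n0) bb' div.
have Ny0 : 0 < N.+1%:R `^ alpha :> R by rewrite powR_gt0.
have Ny1 : 1 <= N.+1%:R `^ alpha :> R.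
  by rewrite -[leLHS](powRr0 N.+1%:R) ler_powR ?ler1n// ltW.
have [Q [Q0 Q1 Q2]] : exists Q : nat, [/\ (0 < Q)%N, N.+1%:R `^ alpha <= Q%:R :> R &
    Q.+1%:R <= 3 * N.+1%:R `^ alpha :> R].
  move: Ny0 Ny1; set yy := N.+1%:R `^ alpha => Ny0 Ny1; exists (Num.truncn yy).+1.
  have /andP[h1 h2] := truncn_itv (ltW Ny0); split => //; first exact: ltW.
  by rewrite -!natr1; lra.
have Q0' : (0 : R) < Q%:R by rewrite ltr0n.
have Qy : Q%:R^-1 <= N.+1%:R `^ (- alpha) :> R.
  by rewrite powRN lef_pV2 ?posrE.
exists Q, N.+1; split => //.
- apply: (le_trans Qy); apply: le_trans (ltW Hk0); apply: (y_le alpha_gt0).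
  by apply: leq_trans nN; rewrite leq_maxl.
- by apply: leqW; apply: leq_trans nN; rewrite leq_maxr.
pose kappa := expR (- S m - C1) * expR (S N.+1).
have kappa0 : 0 < kappa by rewrite mulr_gt0 ?expR_gt0.
have Hhit q : pr (hit m N.+1 (q%:R / Q%:R) Q%:R^-1) <= 2 / kappa.
  apply: (pr_hit l_gt0 model x_circle l1) => // G G0; have G0' : (0 : R) < G%:R by rewrite ltr0n.
  apply: (@le_trans _ _ (\sum_(i < G) kappa)); first by rewrite sumr_const card_ord mulr_natr.
  apply: ler_sum => i _; apply: HC1 => //.
  apply: le_trans Qy; rewrite mulrCA ger_pMr ?invr_gt0// ler_pdivrMr// mul1r ler_nat.
  exact: ltnW.
have Qs : Q%:R `^ (- s) <= (N.+1%:R `^ alpha) `^ (- s).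
  rewrite !powRN lef_pV2 ?posrE ?powR_gt0//.
  by apply: ge0_ler_powR => //; rewrite nnegrE ltW.
apply: (@le_trans _ _ (\sum_(0 <= q < Q.+1) (N.+1%:R `^ alpha) `^ (- s) * (2 / kappa))).
  by apply: ler_sum => q _; apply: ler_pM => //; exact: pr_ge0.
rewrite sumr_const_nat subn0 -[leLHS]mulr_natl.
have z0 : 0 <= (N.+1%:R `^ alpha) `^ (- s) * (2 / kappa).
  by rewrite mulr_ge0 ?powR_ge0// divr_ge0// ltW.
apply: (le_trans (ler_wpM2r z0 Q2)).
have -> : 3 * N.+1%:R `^ alpha * ((N.+1%:R `^ alpha) `^ (- s) * (2 / kappa)) =
    6 * N.+1%:R `^ b / kappa.
  have -> : N.+1%:R `^ b = N.+1%:R `^ alpha * (N.+1%:R `^ alpha) `^ (- s) :> R.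
    by rewrite -powRrM -powRD ?pnatr_eq0 ?implybT//; congr (_ `^ _); rewrite /b; ring.
  by ring.
rewrite ler_pdivrMr// /kappa.
have : D * N.+1%:R `^ b < expR (S N.+1) by [].
rewrite /D => /ltW HD.
have E1 : expR (- S m - C1) * expR (S m + C1) = 1.
  by rewrite -expRD -[RHS]expR0; congr expR; ring.
have p0 : 0 < e * expR (- S m - C1) by rewrite mulr_gt0// expR_gt0.
apply: le_trans (_ : e * expR (- S m - C1) * (6 * expR (S m + C1) / e * N.+1%:R `^ b) <= _).
  rewrite le_eqVlt; apply/orP; left; apply/eqP.
  have -> : e * expR (- S m - C1) * (6 * expR (S m + C1) / e * N.+1%:R `^ b) =
    (expR (- S m - C1) * expR (S m + C1)) * (6 * N.+1%:R `^ b) by field; rewrite gt_eqF.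
  by rewrite E1 mul1r.
by rewrite [leRHS]mulrA ler_wpM2l// ltW.
Qed.

(** At the [i]-th scale the expected cost is at most [4^(-i)], so by Markov it reaches [2^(-i)] with
    probability at most [2^(-i)]. By Borel-Cantelli the cost is eventually below [2^(-i)]. *)
Lemma ae_free_times_null m s : (forall k, (m <= k)%N -> l k < 1) -> 0 <= s ->
  alpha * (1 - s) < beta0 l -> {ae P, forall w, hausdorff_measure s (free_times m w) = 0%E}.
Proof.
move=> l1 s0 sb.
have e4 i : 0 < ((4 ^ i)%:R^-1 : R) by rewrite invr_gt0 ltr0n expn_gt0.
have /choice[Q /choice[N HQN]] : forall i : nat, exists Q N : nat,
    [/\ (0 < Q)%N, Q%:R^-1 <= (4 ^ i)%:R^-1 :> R, (0 <= N)%N &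
    \sum_(0 <= q < Q.+1) Q%:R `^ (- s) * pr (hit m N (q%:R / Q%:R) Q%:R^-1) <= (4 ^ i)%:R^-1].
  by move=> i; exact: interval_cover.
pose H i q := hit m (N i) (q%:R / (Q i)%:R) (Q i)%:R^-1.
have mH i q : measurable (H i q) by exact: measurable_hit.
pose cost i w : R := \sum_(0 <= q < (Q i).+1) (Q i)%:R `^ (- s) * \1_(H i q) w.
have mcost i : measurable_fun setT (cost i).
  apply: measurable_sum => q; apply: measurable_funM => //; exact: measurable_indic.
pose B i := cost i @^-1` `[(2 ^ i)%:R^-1, +oo[%classic.
have mB i : measurable (B i) by rewrite -[B i]setTI; exact: mcost.
have p2 i : 0 < (2 ^ i)%:R :> R by rewrite ltr0n expn_gt0.
have pB i : pr (B i) <= (2 ^ i)%:R^-1.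
  pose r := [seq ((Q i)%:R `^ (- s), H i q) | q <- index_iota 0 (Q i).+1].
  have := @pr_linear_le _ T R P ((2 ^ i)%:R^-1) (B i) r (mB i).
  rewrite /r !big_map => Hlin; rewrite -(ler_pM2l (_ : 0 < (2 ^ i)%:R^-1)) ?invr_gt0//.
  apply: le_trans (Hlin _ _) _.
  - by move=> p Hp; have [q ->] := In_mapE Hp; exact: mH.
  - move=> w; rewrite big_map.
    have [Bw|Bw] := pselect (B i w).
      by rewrite indicE mem_set// mulr1; move: Bw; rewrite /B/= in_itv/= andbT.
    rewrite indicE memNset// mulr0; apply: sumr_ge0 => q _.
    by rewrite mulr_ge0 ?powR_ge0.
  have [_ _ _ h] := HQN i; apply: (le_trans h).
  by rewrite -invfM -natrM -expnMn.
have sumB : (\sum_(0 <= i <oo) P (B i) < +oo)%E.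
  apply: (@le_lt_trans _ _ (\sum_(0 <= i <oo) (0 + (2 / (2 ^ i.+1)%:R)%:E))%E).
    apply: lee_nneseries => // i *; rewrite add0e prE// lee_fin (le_trans (pB i))//.
    by rewrite expnS natrM invfM mulrA divff ?mul1r.
  apply: le_lt_trans (epsilon_trick xpredT (fun=> lexx 0%E) (ler0n R 2)) _.
  by rewrite eseries0// add0e ltry.
have BC := lim_sup_set_cvg0 mB sumB.
have mL : measurable (lim_sup_set B).
  by apply: bigcapT_measurable => n; apply: bigcup_measurable => k _.
exists (lim_sup_set B); split => // w; apply: contra_notP => nL.
have [i0 Hi0] : exists i0, forall i, (i0 <= i)%N -> ~ B i w.
  move: nL => /existsNP[i0 /not_implyP[_ Hi0]]; exists i0 => i i0i Bw; apply: Hi0.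
  by exists i.
apply/hausdorff_measure_eq0 => e e0.
have [i i0i ie] : exists2 i, (i0 <= i)%N & (2 ^ i)%:R^-1 <= e.
  have ei0 : 0 <= e^-1 by rewrite invr_ge0 ltW.
  exists (maxn i0 (Num.bound e^-1)); first exact: leq_maxl.
  rewrite invf_ple ?posrE// natrX ltW//; apply: upper_nthrootP; exact: leq_maxr.
have [Q0 Q4 _ _] := HQN i; have Q0' : (0 : R) < (Q i)%:R by rewrite ltr0n.
have Qe : (Q i)%:R^-1 <= e.
  apply: (le_trans Q4); apply: le_trans ie; rewrite lef_pV2 ?posrE ?ltr0n ?expn_gt0//.
  by rewrite ler_nat; case: (i) => // j; rewrite leq_exp2r.
have costi : cost i w < (2 ^ i)%:R^-1.
  rewrite ltNge; apply/negP => h; apply: (Hi0 i i0i); rewrite /B/= in_itv/= h//.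
pose inV q := (q < (Q i).+1)%N && `[< H i q w >].
(* Only intervals that are hit are kept; [q = Q i] is allowed because [t = 1] lies in that
   interval. *)
pose V q : set R := if inV q then `[(q%:R / (Q i)%:R), (q.+1%:R / (Q i)%:R)[%classic else set0.
have Vdist q u v : V q u -> V q v -> `|u - v| <= (Q i)%:R^-1.
  rewrite /V; case: ifP => // _; rewrite /= !in_itv/= -natr1 mulrDl mul1r.
  by move=> /andP[a1 a2] /andP[b1 b2]; rewrite ler_norml; apply/andP; split; lra.
exists V; split.
- move=> t ft; have [/andP[t0 t1] _] := ft.
  have tQ0 : 0 <= t * (Q i)%:R by rewrite mulr_ge0.
  have /andP[h1 h2] := truncn_itv tQ0; set q := Num.truncn _ in h1 h2.
  have tq : q%:R / (Q i)%:R <= t < q.+1%:R / (Q i)%:R by rewrite ler_pdivrMr// ltr_pdivlMr// h1.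
  exists q => //; rewrite /V ifT /= ?in_itv//; apply/andP; split.
    by rewrite ltnS -(ler_nat R) (le_trans h1)// ler_piMl.
  apply/asboolP; apply: (hitP _ _ (free_times_all_free (N i) ft)); first by rewrite invr_gt0.
  by move: tq; rewrite -natr1 mulrDl mul1r.
- by move=> q; rewrite (le_trans (diam_le (@Vdist q)))// lee_fin.
pose u q := if inV q then (Q i)%:R `^ (- s) else 0.
have u0 q : 0 <= u q by rewrite /u; case: ifP => // _; exact: powR_ge0.
apply: (@le_trans _ _ (\sum_(0 <= q <oo) (u q)%:E)%E).
  apply: lee_nneseries => q *; first exact: diam_pow_ge0.
  rewrite /u; case: ifP => Vq; last by rewrite /V Vq diam_pow_set0.
  rewrite (_ : (Q i)%:R `^ (- s) = ((Q i)%:R^-1) `^ s).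
    by apply: diam_pow_le => //; exact: Vdist.
  by rewrite -powR_inv1 ?ler0n// -powRrM mulN1r.
apply: nneseries_le => // K; apply: le_trans ie; apply: le_trans (ltW costi).
apply: (@le_trans _ _ (\sum_(0 <= q < (Q i).+1 + K) u q)).
  have le1 : (K <= (Q i).+1 + K)%N by rewrite leq_addl.
  by rewrite [leRHS](big_cat_nat (leq0n K) le1)/= lerDl sumr_ge0.
have le2 : ((Q i).+1 <= (Q i).+1 + K)%N by rewrite leq_addr.
rewrite (big_cat_nat (leq0n _) le2)/= [X in _ + X]big_seq [X in _ + X]big1 ?addr0; last first.
  by move=> q; rewrite mem_index_iota => /andP[qQ _]; rewrite /u /inV ltnNge qQ.
apply: ler_sum => q _; rewrite /u /inV; case: ifP => [/andP[_ /asboolP Hq]|_].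
  by rewrite indicE mem_set// mulr1.
by rewrite mulr_ge0 ?powR_ge0.
Qed.

Lemma ae_exceptional_null s : 0 <= s -> alpha * (1 - s) < beta0 l ->
  {ae P, forall w, hausdorff_measure s (exceptional_times l C Y x w) = 0%E}.
Proof.
move=> s0 sb; have h2 : (0 : R) < 1 / 2 by rewrite divr_gt0.
have [m2 Hm2] := l_eventually_small M0_gt0 l_bnd h2.
have H : {ae P, forall w, forall m, hausdorff_measure s (free_times (m2 + m) w) = 0%E}.
  apply: ae_foralln => m; apply: ae_free_times_null => // k mk.
  by have := Hm2 k (leq_trans (leq_addr _ _) mk); lra.
apply: filterS2 H (ae_good l_gt0 model) => w H gw.
by rewrite (exceptional_times_bigcup m2 gw); exact: hausdorff_null_bigcup.
Qed.

Lemma ae_exceptional_not_null s : 0 < s -> beta0 l < alpha * (1 - s) ->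
  {ae P, forall w, hausdorff_measure s (exceptional_times l C Y x w) <> 0%E}.
Proof.
move=> s0 sb; have ser := gt_beta0 l_gt0 M0_gt0 l_bnd sb.
apply: filterS3 (ae_cover_cost l_gt0 M0_gt0 l_bnd alpha_gt0 model x_circle (ltW s0) ser)
  (ae_good l_gt0 model) (ae_no_ties model) => w [m [L [L0 HL]]] gw tw.
apply: (@not_hausdorff_null R _ s (4 * L)^-1) => //; first by rewrite invr_gt0 mulr_gt0.
by move=> V rho; exact: (open_cover_bound x_circle gw tw L0 HL).
Qed.

Lemma ae_hausdorff_dim : {ae P, forall w,
  hausdorff_dim (exceptional_times l C Y x w) = (Num.max (1 - beta0 l / alpha) 0)%:E}.
Proof.
set D := Num.max _ _; have D0 : 0 <= D by rewrite le_max lexx orbT.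
have DD : 1 - beta0 l / alpha <= D by rewrite le_max lexx.
have up : {ae P, forall w, forall q : nat,
    hausdorff_measure (D + q.+1%:R^-1) (exceptional_times l C Y x w) = 0%E}.
  apply: ae_foralln => q; have q0 : 0 < q.+1%:R^-1 :> R by rewrite invr_gt0.
  apply: ae_exceptional_null; first by rewrite addr_ge0// ltW.
  rewrite mulrC -ltr_pdivlMr//; move: q0 DD; set v := q.+1%:R^-1; set z := _ / alpha.
  by clearbody D; lra.
have low : {ae P, forall w, forall q : nat, 0 < D ->
    hausdorff_measure (D - D / q.+2%:R) (exceptional_times l C Y x w) <> 0%E}.
  (* For [D = 0] there is nothing to prove; [D > 0] identifies the maximum. *)
  apply: ae_foralln => q; have [D1|D1] := ltP 0 D; last by apply: nearW => w.
  have De : D = 1 - beta0 l / alpha.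
    by move: D1; rewrite /D lt_max ltxx orbF => /ltW/max_idPl.
  have q0 : 0 < D / q.+2%:R by rewrite divr_gt0.
  have q1 : D / q.+2%:R < D by rewrite ltr_pdivrMr// ltr_pMr// ltr1n.
  have s0 : 0 < D - D / q.+2%:R by rewrite subr_gt0.
  have sb : beta0 l < alpha * (1 - (D - D / q.+2%:R)).
    rewrite mulrC -ltr_pdivrMr//; move: q0 De; set v := D / q.+2%:R; set z := _ / alpha.
    by clearbody D; lra.
  by apply: filterS (ae_exceptional_not_null s0 sb).
apply: filterS2 up low => w up low; apply: hausdorff_dim_eq => // D1 q.
exact: low.
Qed.

End UpperBound.

Theorem theorem1p3 (R : realType) (d : measure_display)
    (T : measurableType d) (P : probability T R)
    (l : nat -> R) (M0 M1 alpha : R) (C Y : nat -> nat -> {RV P >-> R}) (x : R)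
    (l_decr : nonincreasing_seq l) (l_gt0 : forall n, 0 < l n)
    (l_cvg0 : l @ \oo --> (0 : R))
    (M0_gt0 : 0 < M0) (M01 : M0 <= M1)
    (l_bnd : forall n, M0 / n.+1%:R <= l n <= M1 / n.+1%:R)
    (alpha_gt0 : 0 < alpha)
    (model : poisson_model alpha l C Y)
    (x_circle : circle x) :
  (* (i) *)
  (({ae P, forall w, exists t : R, 0 <= t <= 1 /\ uncovered l C Y t w x} <->
    (covering_series l alpha < +oo)%E) /\
   (forall c : R, 0 < c -> (forall n, l n = c / n.+1%:R) ->
     ({ae P, forall w, exists t : R, 0 <= t <= 1 /\ uncovered l C Y t w x} <->
      c < alpha))) /\
  (* (ii) *)
  ({ae P, forall w, hausdorff_dim (exceptional_times l C Y x w) =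
      (Num.max (1 - beta0 l / alpha) 0)%:E} /\
   (forall c : R, 0 < c <= alpha -> (forall n, l n = c / n.+1%:R) ->
     {ae P, forall w, hausdorff_dim (exceptional_times l C Y x w) =
       (1 - c / alpha)%:E})).
Proof.
have iff : {ae P, forall w, exists t : R, 0 <= t <= 1 /\ uncovered l C Y t w x} <->
    (covering_series l alpha < +oo)%E.
  split=> [ex|ser]; last exact: (ae_exceptional_exists l_gt0 M0_gt0 l_bnd alpha_gt0 model x_circle ser).
  apply: contrapT => div.
  have no := ae_no_exceptional l_gt0 M0_gt0 l_bnd alpha_gt0 model x_circle div.
  (* Two contradictory almost sure properties would make the whole space a null set. *)
  have [B [mB PB HB]] : {ae P, forall w : T, False}.
    by apply: filterS2 ex no => w [t [t01 ut]] E; have : exceptional_times l C Y x w t by []; rewrite E.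
  have BT : B = setT by apply/seteqP; split => // w _; apply: HB => /=; apply.
  by move: PB; rewrite BT probability_setT => /eqP; rewrite onee_eq0.
have dim := ae_hausdorff_dim l_gt0 M0_gt0 l_bnd alpha_gt0 model x_circle.
split; split => //.
- by move=> c c0 lc; rewrite iff; exact: covering_series_harmonic.
- move=> c /andP[c0 ca] lc; apply: filterS dim => w ->; congr _%:E.
  rewrite (beta0_harmonic l_gt0 M0_gt0 l_bnd c0 lc); apply/max_idPl.
  by rewrite subr_ge0 ler_pdivrMr// mul1r.
Qed.
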